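(* Let $2\le p<\infty$. There exists a constant $C=C(p)>0$, depending only on $p$, such that the following holds. Let $(\Omega,\mathcal F,\mu)$ be a probability space, $m\in\mathbb N$, and let $\pmb\xi=(\xi^1,\ldots,\xi^m)$ be a collection of independent random elements of $\Omega$ satisfying \[ \mu(E)=\frac1m\sum_{j=1}^m\mathbb P[\xi^j\in E],\qquad E\in\mathcal F. \] Let $F$ be a class of bounded functions on $\Omega$ containing $0$. Let $p_0\in(1,p]$, $p_1:=\frac{pp_0}{p-p_0}$ (with $p_1=\infty$ if $p_0=p$), $H>0$, $m_0\in\mathbb N\cap[1,m]$ and $1\le q<\infty$ be such that \[ (\mathrm A_q)\qquad \Bigl(\mathbb E\Bigl(\sup_{f\in F}\|f\|_{L_\infty(\pmb\xi)}^{p-p_0}\cdot\sup_{g\in F}\|g\|_{L_{p_1}(\pmb\xi)}^{p_0}\Bigr)^q\Bigr)^{1/q}\le H^{p_0/p} \] and \[ (\mathrm B)\qquad \mathbb E\Bigl[\sup_{f\in F}\|f\|_{L_\infty(\pmb\xi)}^{p-p_0}\cdot\Bigl(\gamma_{p,p_0}\bigl(F,\|\cdot\|_{L_{p_1}(\pmb\xi)}\bigr)\Bigr)^{p_0}\Bigr]\le(Hm_0)^{p_0/p}. \] If \[ m\ge\max\Bigl\{16m_0,\ e\bigl(e\log\log\tfrac m{m_0}\bigr)^{p/p_0'}Hm_0\Bigr\}, \] then \[ \bigl(\mathbb E|\mathrm{Er}_p(F,\pmb\xi)|^q\bigr)^{1/q}\le\frac{Cq}{1+\log q}\,\Theta,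 \] where \[ \Theta:=\Bigl(\frac{Hm_0}m\Bigr)^{1/p}\Bigl(\log\log\frac m{m_0}+\log\frac m{Hm_0}\Bigr)^{1-\frac1{p_0}}\Bigl(1+\sup_{f\in F}\|f\|_{L_p(\mu)}^p\Bigr). \] Moreover, if $(\mathrm A_q)$ holds for all $1\le q<\infty$ (with the same $H$), then \[ \mathbb P\bigl[\mathrm{Er}_p(F,\pmb\xi)>C\,\Theta\,t\bigr]\le\exp\Bigl(-\frac{t\log t}e\Bigr),\qquad\forall\,t\ge e. \]
   Context: Here $p_0'=p_0/(p_0-1)$ and $\log$ is the natural logarithm. Functions in $F$ are measurable bounded functions $\Omega\to\mathbb C$, and the suprema and chaining functionals whose expectations or probabilities are taken are understood to be random variables. Discretization error: $\mathrm{Er}_p(F,\pmb\xi):=\sup_{f\in F}\bigl|\frac1m\sum_{j=1}^m|f(\xi^j)|^p-\|f\|_{L_p(\mu)}^p\bigr|$. Discrete norms: $\|f\|_{L_r(\pmb\xi)}:=\bigl(\frac1m\sum_{j=1}^m|f(\xi^j)|^r\bigr)^{1/r}$ for $1\le r<\infty$, and $\|f\|_{L_\infty(\pmb\xi)}:=\max_{1\le j\le m}|f(\xi^j)|$. Chaining functional: let $(\mathbf T,\varrho)$ be a metric space, $N_0:=1$, $N_n:=2^{2^n}$ for $n\ge1$. An admissible sequence of partitions of $\mathbf T$ is a sequence $\{\mathcal A_n\}_{n\ge0}$ of partitions such that $|\mathcal A_n|\le N_n$ and every element of $\mathcal A_{n+1}$ is contained in an element of $\mathcal A_n$, for all $n\ge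 0$; $\mathcal A_n(x)$ is the element of $\mathcal A_n$ containing $x$. For $\alpha>0$, $1\le\beta<\infty$, \[ \gamma_{\alpha,\beta}(\mathbf T,\varrho):=\Bigl(\inf_{\{\mathcal A_n\}}\sup_{x\in\mathbf T}\sum_{n=0}^\infty\bigl[2^{n/\alpha}\operatorname{diam}(\mathcal A_n(x),\varrho)\bigr]^\beta\Bigr)^{1/\beta}, \] the infimum being over admissible sequences. Finally, with $F(\pmb\xi):=\{(f(\xi^1),\dots,f(\xi^m))\colon f\in F\}\subset\mathbb C^m$ and $\|\cdot\|_{p_1}$ the (unnormalized) $\ell_{p_1}^m$ norm, \[ \gamma_{p,p_0}\bigl(F,\|\cdot\|_{L_{p_1}(\pmb\xi)}\bigr):=m^{\frac1p-\frac1{p_0}}\,\gamma_{p,p_0}\bigl(F(\pmb\xi),\|\cdot\|_{p_1}\bigr). \]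
   Formalization: The formal statement also assumes that, for all real weights c_j, the supremum over f in F of |sum_j c_j |f(x_j)|^p| is a measurable function of (x_1,...,x_m) in Omega^m; measurability of Er_p and of the integrands in (A_q) and (B) alone does not suffice. *)

(* Defs.v *)
From HB Require Import structures.
From mathcomp Require Import all_boot all_order all_algebra.
From mathcomp Require Import complex.
From mathcomp Require Import all_classical all_reals all_analysis.
From mathcomp Require Import measurable_realfun.

Set Implicit Arguments.
Unset Strict Implicit.
Unset Printing Implicit Defensive.

Import Order.TTheory GRing.Theory Num.Theory.
Import numFieldNormedType.Exports.

Local Open Scope classical_set_scope.
Local Open Scope ring_scope.

(* The real-valued modulus; the norm of [R[i]] itself takes values in [R[i]]. *)
Notation cmod := (@Normc.normc _).

Section FunctionClass.
Context {d : measure_display} {Omega : measurableType d} {R : realType}.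

Definition measurable_cfun (f : Omega -> R[i]) : Prop :=
  measurable_fun setT (fun x => complex.Re (f x)) /\
  measurable_fun setT (fun x => complex.Im (f x)).

Definition bounded_cfun (f : Omega -> R[i]) : Prop :=
  exists M : R, forall x, cmod (f x) <= M.

Definition bounded_class (F : set (Omega -> R[i])) : Prop :=
  forall f, F f -> measurable_cfun f /\ bounded_cfun f.

(* [||f||_{L_p(mu)}^p] *)
Definition Lp_pow (mu : probability Omega R) (p : R) (f : Omega -> R[i])
    : \bar R :=
  (('N[mu]_(p%:E) [EFin \o (cmod \o f)]) `^ p)%E.

End FunctionClass.

Section Independence.
Context {d d' : measure_display} {W : measurableType d}
  {Omega : measurableType d'} {R : realType}.

Definition independent_family (P : probability W R) (m : nat)
    (xi : 'I_m -> {RV P >-> Omega}) : Prop :=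
  forall (J : {set 'I_m}) (B : 'I_m -> set Omega),
    (forall j, measurable (B j)) ->
    P (\bigcap_(j in [set` J]) (xi j @^-1` B j)) =
    (\big[*%E/1%E]_(j in J) P (xi j @^-1` B j))%E.

End Independence.

Section Sampling.
Context {Omega : Type} {R : realType} {m : nat}.
Implicit Types (f : Omega -> R[i]) (F : set (Omega -> R[i])) (x : 'I_m -> Omega).

(* Normalized norm [||f||_{L_r(x)}], for [1 <= r <= +oo]; the value at
   [r = -oo] is junk. *)
Definition disc_norm (r : \bar R) f x : R :=
  match r with
  | EFin s => (m%:R^-1 * \sum_(j < m) cmod (f (x j)) `^ s) `^ s^-1
  | +oo%E => \big[Num.max/0]_(j < m) cmod (f (x j))
  | -oo%E => 0
  end.

(* Unnormalized norm of [l_r^m], same convention. *)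
Definition ell_norm (r : \bar R) (v : 'rV[R[i]]_m) : R :=
  match r with
  | EFin s => (\sum_(j < m) cmod (v 0 j) `^ s) `^ s^-1
  | +oo%E => \big[Num.max/0]_(j < m) cmod (v 0 j)
  | -oo%E => 0
  end.

(* [F(x)], a subset of [C^m] *)
Definition sample_image F x : set 'rV[R[i]]_m :=
  [set (\row_(j < m) f (x j)) | f in F].

(* Used only to express that the suprema of the (signed, weighted) empirical
   sums of the [|f|^p] are random variables. *)
Definition weighted_sup (p : R) F (c : 'I_m -> R) x : \bar R :=
  ereal_sup [set (`|\sum_(j < m) c j * cmod (f (x j)) `^ p|)%:E | f in F].

End Sampling.

Section Discretization.
Context {d : measure_display} {Omega : measurableType d} {R : realType}
  {m : nat}.

Definition disc_error (mu : probability Omega R) (p : R)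
    (F : set (Omega -> R[i])) (x : 'I_m -> Omega) : \bar R :=
  ereal_sup [set (`|(m%:R^-1 * \sum_(j < m) cmod (f (x j)) `^ p)%:E
                    - Lp_pow mu p f|)%E | f in F].

End Discretization.

(* The metric space is a subset [T] of the carrier [V] with the distance
   [rho]. *)
Section Chaining.
Context {R : realType} {V : Type}.
Implicit Types (T : set V) (rho : V -> V -> R).

Definition adm_card (n : nat) : nat := if n is 0%N then 1%N else (2 ^ (2 ^ n))%N.

Definition diam rho (B : set V) : \bar R :=
  ereal_sup [set (rho u.1 u.2)%:E | u in B `*` B].

Definition admissible T (A : nat -> set (set V)) : Prop :=
  forall n : nat,
    [/\ partition (A n) id T,
        (A n #<= `I_(adm_card n))%card &
        forall B, A n.+1 B -> exists2 B', A n B' & B `<=` B'].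

Definition gamma (alpha beta : R) T rho : \bar R :=
  ((ereal_inf
     [set ereal_sup
        [set (\sum_(0 <= n <oo)
               ((2 `^ (n%:R / alpha))%:E * diam rho (pblock (A n) id x)) `^ beta)%E
        | x in T]
     | A in admissible T]) `^ beta^-1)%E.

End Chaining.

(* [gamma_{p,p0}(F, ||.||_{L_{p1}(x)})], normalization included *)
Definition gamma_disc {Omega : Type} {R : realType} {m : nat} (p p0 : R)
    (p1 : \bar R) (F : set (Omega -> R[i])) (x : 'I_m -> Omega) : \bar R :=
  ((m%:R `^ (p^-1 - p0^-1))%:E
   * gamma p p0 (sample_image F x) (fun u v => ell_norm p1 (u - v)))%E.

Section Quantities.
Context {R : realType}.
Implicit Types p : R.

Definition conj_p1 p p0 : \bar R :=
  if p0 == p then +oo%E else (p * p0 / (p - p0))%:E.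

Definition holder_conj p0 : R := p0 / (p0 - 1).

(* The factor [sup_f ||f||_{L_oo(x)}^{p-p0}]; for [p0 = p] it is [1]. *)
Definition sup_unif {Omega : Type} {m : nat} p p0
    (F : set (Omega -> R[i])) (x : 'I_m -> Omega) : \bar R :=
  ereal_sup [set (disc_norm +oo%E f x `^ (p - p0))%:E | f in F].

(* The random variables inside the expectations of [condA] and [condB] below. *)
Definition integrandA {Omega : Type} {m : nat} p p0
    (F : set (Omega -> R[i])) (x : 'I_m -> Omega) : \bar R :=
  (sup_unif p p0 F x
   * ereal_sup [set (disc_norm (conj_p1 p p0) g x `^ p0)%:E | g in F])%E.

Definition integrandB {Omega : Type} {m : nat} p p0
    (F : set (Omega -> R[i])) (x : 'I_m -> Omega) : \bar R :=
  (sup_unif p p0 F x * (gamma_disc p p0 (conj_p1 p p0) F x) `^ p0)%E.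

Definition Theta {d : measure_display} {Omega : measurableType d}
    (mu : probability Omega R) p p0 (H : R) (m m0 : nat)
    (F : set (Omega -> R[i])) : \bar R :=
  (((H * m0%:R / m%:R) `^ p^-1
    * (ln (ln (m%:R / m0%:R)) + ln (m%:R / (H * m0%:R))) `^ (1 - p0^-1))%:E
   * (1 + ereal_sup [set Lp_pow mu p f | f in F]))%E.

End Quantities.

Section Conditions.
Context {d d' : measure_display} {W : measurableType d}
  {Omega : measurableType d'} {R : realType}.
Context (P : probability W R) (m : nat) (xi : 'I_m -> {RV P >-> Omega}).

(* The realization of the random sample at [w]. *)
Definition sample (w : W) : 'I_m -> Omega := fun j => xi j w.

Definition condA (p p0 H : R) (F : set (Omega -> R[i])) (q : R) : Prop :=
  ((\int[P]_w (integrandA p p0 F (sample w)) `^ q) `^ q^-1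
     <= (H `^ (p0 / p))%:E)%E.

Definition condB (p p0 H : R) (m0 : nat) (F : set (Omega -> R[i])) : Prop :=
  (\int[P]_w integrandB p p0 F (sample w) <= ((H * m0%:R) `^ (p0 / p))%:E)%E.

(* The suprema and chaining functionals are random variables: the integrands
   of [condA] and [condB] and the error are measurable, and so are, on the product
   sigma-algebra of [Omega^m], the weighted suprema, which are the quantities
   whose expectations symmetrization takes.  The last clause cannot be
   dropped.  Under the continuum hypothesis let [F] consist of 0 and the
   indicators of the proper initial segments of [0, 1] for a well-order of type
   omega_1, with [mu] the Lebesgue measure and [xi] the coordinates.  On
   pairwise distinct points [F] has only m + 1 traces, which form a chain, so
   that [condA] and [condB] hold with H and m0 independent of m if p0 < p; yet the
   error is identically 1 since all segments are null. *)
Definition random_variables (mu : probability Omega R) (p p0 : R)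
    (F : set (Omega -> R[i])) : Prop :=
  [/\ measurable_fun setT (fun w => disc_error mu p F (sample w)),
      measurable_fun setT (fun w => integrandA p p0 F (sample w)),
      measurable_fun setT (fun w => integrandB p p0 F (sample w)) &
      forall c : 'I_m -> R,
        measurable_fun setT
          (fun x : m.-tuple Omega => weighted_sup p F c (tnth x))].

End Conditions.

(* Main.v *)
(** The supremum of the centered sums of |f|^p over the sample is first compared,
for a fixed vector of signs, with signed sums: an independent copy replaces the
coordinates of one sign. It thus suffices to find a single good sign vector.

For a typical sample all |f(xi^j)|^p are at most lam = 4 m^(1-p0/p) H^(p0/p), and
chaining along the levels n1 <= n <= n1 + k of an admissible sequence, with
|v|^p truncated below a level-dependent threshold, bounds the signed sums over
indices with |f(xi^j)|^p <= lam by some c for most sign vectors. Levy's maximal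
inequality extends the bound to all prefixes, so that one sign vector works with
probability at least 3/4. For this vector, call a block of indices bad if its
signed sums exceed 2c. By superadditivity of -log P[block is good], l consecutive
disjoint bad blocks exist with probability at most 1/l!; this Poisson tail gives
moments of order q/(1 + log q). Entries above lam are also Poisson-rare and are
treated in the same way.

The number c involves the expectation s of the supremum of sum_j |f(xi^j)|^p over
these indices; the case q = 1 bounds s by S + C s^(1 - 1/(2p)), hence closes the
argument. The tail estimate is Markov's inequality with q = t log t. *)

Require Import Defs.
From HB Require Import structures.
From mathcomp Require Import all_boot all_order all_algebra.
From mathcomp Require Import complex.
From mathcomp Require Import all_classical all_reals all_analysis.
From mathcomp Require Import measurable_realfun.
From mathcomp Require Import ring lra.

Set Implicit Arguments.
Unset Strict Implicit.
Unset Printing Implicit Defensive.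

Import Order.TTheory GRing.Theory Num.Theory.
Import numFieldNormedType.Exports.

Local Open Scope classical_set_scope.
Local Open Scope ring_scope.

(** The exponent 1 - 1/p0 and both logarithms of Theta come from one Hölder inequality over the
    chaining levels. The increment at level n is governed by a radius and by the power 1 - 1/p0 of
    the mass, the sum of |v|^p, of the coordinates active there; the chaining functional bounds the
    radii, divided by 2^(-n/p), in l_p0. There are about log(m/m0) levels, each of mass up to the
    total w0, and the point is that the masses add up to O(W w0) only. To this end a coordinate is
    active just while its value lies between two thresholds tied to 2^(-n/p) up to a factor L, the
    number of levels. It then takes part in O(W) levels, where W collects log L, of order log
    log(m/m0), and the logarithm of w0 over the p-th power of the chaining radius, essentially
    log(m/(H m0)).

    Chaining works only on samples with controlled functionals, so by itself it gives a probability
    and no moments. Fixing the signs before the sample is drawn makes block events depend on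
    disjoint sets of independent coordinates, which is what a Poisson tail needs. *)

Section PowR.
Context {R : realType}.
Implicit Types (x y r s : R).

Lemma powRD_gt0 x r s : 0 < x -> x `^ (r + s) = x `^ r * x `^ s.
Proof. by move=> x0; rewrite powRD// (gt_eqF x0) implybT. Qed.

Lemma powR_le x y r : 0 <= r -> 0 <= x -> x <= y -> x `^ r <= y `^ r.
Proof. by move=> r0 x0 xy; rewrite ge0_ler_powR ?nnegrE// (le_trans x0). Qed.

Lemma powR_ltE x y r : 0 < r -> 0 <= x -> 0 <= y -> (x `^ r < y `^ r) = (x < y).
Proof.
move=> r0 x0 y0; apply/idP/idP; last by move=> h; rewrite gt0_ltr_powR ?nnegrE.
by apply: contraTT; rewrite -!leNgt => h; apply: powR_le => //; apply: ltW.
Qed.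

Lemma powR_leE x y r : 0 < r -> 0 <= x -> 0 <= y -> (x `^ r <= y `^ r) = (x <= y).
Proof. by move=> r0 x0 y0; rewrite !leNgt powR_ltE. Qed.

Lemma powR_le_neg x y r : r <= 0 -> 0 < x -> x <= y -> y `^ r <= x `^ r.
Proof.
move=> r0 x0 xy; have : x `^ (- r) <= y `^ (- r) by rewrite powR_le ?oppr_ge0// ltW.
by rewrite !powRN lef_pV2 ?posrE ?powR_gt0 ?(lt_le_trans x0).
Qed.

Lemma powRK x r : 0 <= x -> r != 0 -> (x `^ r) `^ r^-1 = x.
Proof. by move=> x0 r0; rewrite -powRrM mulfV// powRr1. Qed.

Lemma powRVK x r : 0 <= x -> r != 0 -> (x `^ r^-1) `^ r = x.
Proof. by move=> x0 r0; rewrite -powRrM mulVf// powRr1. Qed.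

End PowR.

(** * Signed sums *)

Section Rademacher.
Context {R : realType}.
Implicit Types (x t V k : R).

(** For x^2 <= 1/2 both exponentials are at most geometric series, and (1 - x)^-1 + (1 + x)^-1 = 2 /
    (1 - x^2) <= 2 (1 + 2 x^2); otherwise |x| <= 2 x^2. The exponent 2 x^2, in place of the sharp
    x^2 / 2, leaves room for this. *)
Lemma cosh_le_gauss x : expR x + expR (- x) <= 2 * expR (2 * x ^+ 2).
Proof.
have e1 : 1 + 2 * x ^+ 2 <= expR (2 * x ^+ 2) by apply: expR_ge1Dx.
have [h|h] := lerP (x ^+ 2) 2^-1.
  have x1 : x ^+ 2 < 1 by apply: le_lt_trans h _; lra.
  have hx : `|x| < 1 by rewrite -(@ltr_pXn2r _ 2) ?nnegrE// real_normK ?num_real// expr1n.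
  have [xl xr] : -1 < x /\ x < 1 by move: hx; rewrite ltr_norml => /andP[].
  have a1 : expR x <= (1 - x)^-1.
    rewrite -[x in expR x]opprK expRN lef_pV2 ?posrE ?expR_gt0 ?subr_gt0//.
    by have := expR_ge1Dx (- x).
  have a2 : expR (- x) <= (1 + x)^-1.
    rewrite expRN lef_pV2 ?posrE ?expR_gt0//; last lra.
    by have := expR_ge1Dx x.
  apply: le_trans (lerD a1 a2) _.
  apply: (@le_trans _ _ (2 * (1 + 2 * x ^+ 2))); last by rewrite ler_pM2l.
  have -> : (1 - x)^-1 + (1 + x)^-1 = 2 / (1 - x ^+ 2).
    by field; apply/and3P; split; apply/eqP => h0; nra.
  rewrite ler_pM2l// -[leLHS]mul1r ler_pdivrMr ?subr_gt0//.
  nra.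
have ex : forall y : R, `|y| = `|x| -> expR y <= expR (2 * x ^+ 2).
  move=> y yx; rewrite ler_expR.
  apply: le_trans (ler_norm _) _; rewrite yx.
  have -> : x ^+ 2 = `|x| ^+ 2 by rewrite real_normK ?num_real.
  have : 2^-1 < `|x| ^+ 2 by rewrite real_normK ?num_real.
  have := normr_ge0 x; set y' := `|x|; nra.
have := ex x erefl; have := ex (- x) (normrN _); lra.
Qed.

Context {m : nat}.
Implicit Types (a : 'I_m -> R) (e : {ffun 'I_m -> bool}).

Definition rsum e a : R := \sum_(j < m) (-1) ^+ e j * a j.

Lemma rsum_mgf a V l : \sum_j a j ^+ 2 <= V ->
  \sum_e expR (l * rsum e a) <= 2 ^+ m * expR (2 * l ^+ 2 * V).
Proof.
move=> aV.
have -> : \sum_e expR (l * rsum e a) =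
    \sum_(e : {ffun 'I_m -> bool}) \prod_j expR (l * ((-1) ^+ e j * a j)).
  by apply: eq_bigr => e _; rewrite /rsum mulr_sumr expR_sum.
rewrite -(bigA_distr_bigA (fun j (b : bool) => expR (l * ((-1) ^+ b * a j)))).
apply: (@le_trans _ _ (\prod_(j < m) (2 * expR (2 * l ^+ 2 * a j ^+ 2)))).
  apply: ler_prod => j _; rewrite big_bool/= expr1 expr0 mulN1r mul1r mulrN.
  rewrite addr_ge0 ?expR_ge0//= addrC.
  by apply: le_trans (cosh_le_gauss _) _; rewrite exprMn mulrA.
rewrite big_split/= prodr_const card_ord -expR_sum -mulr_sumr ler_pM2l ?exprn_gt0//.
by rewrite ler_expR ler_wpM2l// mulr_ge0// sqr_ge0.
Qed.

Lemma rsum_tail a V t k : \sum_j a j ^+ 2 <= V -> 0 <= t -> 8 * k * V <= t ^+ 2 ->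
  \sum_e (t < `|rsum e a|)%R%:R <= 2 * 2 ^+ m * expR (- k).
Proof.
move=> aV t0 kt.
have V0 : 0 <= V by apply: le_trans aV; apply: sumr_ge0 => j _; rewrite sqr_ge0.
have [Vp|] := ltP 0 V; last first.
  move=> Vn; rewrite big1; first by rewrite !mulr_ge0 ?expR_ge0// exprn_ge0.
  move=> e _; suff -> : rsum e a = 0 by rewrite normr0 ltNge t0.
  rewrite /rsum big1// => j _.
  have : a j ^+ 2 <= 0.
    apply: le_trans Vn; apply: le_trans aV; rewrite (bigD1 j)//= lerDl.
    by apply: sumr_ge0 => i _; rewrite sqr_ge0.
  move=> a0; have : a j ^+ 2 = 0 by apply/eqP; rewrite eq_le a0 sqr_ge0.
  by move/eqP; rewrite sqrf_eq0 => /eqP ->; rewrite mulr0.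
(* This value minimizes the Chernoff exponent - l t + 2 l^2 V. *)
set l := t / (4 * V).
have lt : - (l * t) + 2 * l ^+ 2 * V <= - k.
  have -> : - (l * t) + 2 * l ^+ 2 * V = - (t ^+ 2 / (8 * V)).
    by rewrite /l; field; apply/eqP; lra.
  by rewrite lerN2 ler_pdivlMr ?mulr_gt0//; apply: le_trans kt; rewrite mulrCA mulrA.
have l0 : 0 <= l by rewrite /l divr_ge0// mulr_ge0.
have one s (s1 : s ^+ 2 = 1) :
   \sum_e (t < s * rsum e a)%R%:R <= 2 ^+ m * expR (- k).
  apply: (@le_trans _ _ (\sum_e expR (- (l * t)) * expR (l * s * rsum e a))).
    apply: ler_sum => e _.
    rewrite -expRD; case: ltP => [h|_]; last exact: expR_ge0.
    rewrite -[leLHS]expR0 ler_expR -mulrA -mulrN -mulrDr mulr_ge0// addrC subr_ge0.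
    exact: ltW.
  rewrite -mulr_sumr.
  apply: (@le_trans _ _ (expR (- (l * t)) * (2 ^+ m * expR (2 * (l * s) ^+ 2 * V)))).
    by rewrite ler_wpM2l ?expR_ge0//; apply: rsum_mgf.
  by rewrite mulrCA -expRD ler_pM2l ?exprn_gt0// ler_expR exprMn s1 mulr1.
apply: (@le_trans _ _ (\sum_e (t < 1 * rsum e a)%R%:R + \sum_e (t < -1 * rsum e a)%R%:R)).
  rewrite -big_split; apply: ler_sum => e _; rewrite mul1r mulN1r.
  by rewrite lter_normr; do 2 case: (_ < _) => //=; lra.
have := one 1 (expr1n _ _); have := one (-1) (sqrr_sign _ 1%N : (-1) ^+ 1 ^+ 2 = 1 :> R).
lra.
Qed.

(** Split at the height A r^(-1/s). The entries above it have l_1 norm at most r^(1 - 1/s) A,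
    whatever the signs; those below have squared l_2 norm at most A^2 r^(1 - 2/s), so that the
    subgaussian tail has exponent K^2 r / 8. With r = 2^n and K a large constant, this beats the
    2^(2^n) vectors of level n. *)
Lemma rsum_tail_lp a s A r K : 1 < s <= 2 -> 0 <= A -> 0 < r -> 0 <= K ->
  \sum_j `|a j| `^ s <= A `^ s ->
  \sum_e ((1 + K) * r `^ (1 - s^-1) * A < `|rsum e a|)%R%:R <=
  2 * 2 ^+ m * expR (- (K ^+ 2 * r / 8)).
Proof.
move=> /andP[s1 s2] A0 r0 K0 aA; have s0 : 0 < s by lra.
have [Ap|] := ltP 0 A; last first.
  move=> An; have -> : A = 0 by apply/le_anti; rewrite An A0.
  rewrite big1; first by rewrite !mulr_ge0 ?expR_ge0// exprn_ge0.
  move=> e _; suff -> : rsum e a = 0 by rewrite normr0 mulr0 ltxx.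
  rewrite /rsum big1// => j _.
  have : `|a j| `^ s <= 0.
    have <- : A `^ s = 0.
      by rewrite (_ : A = 0) ?powR0 ?gt_eqF//; apply/le_anti; rewrite An A0.
    apply: le_trans aA; rewrite (bigD1 j)//= lerDl.
    by apply: sumr_ge0 => i _; rewrite powR_ge0.
  move=> a0; have /eqP : `|a j| `^ s = 0 by apply/eqP; rewrite eq_le a0 powR_ge0.
  by rewrite powR_eq0 normr_eq0 => /andP[/eqP-> _]; rewrite mulr0.
pose th := A * r `^ (- s^-1).
have th0 : 0 < th by rewrite mulr_gt0// powR_gt0.
pose hi := fun j => if th < `|a j| then a j else 0.
pose lo := fun j => if th < `|a j| then 0 else a j.
have hilo e : rsum e a = rsum e hi + rsum e lo.
  rewrite /rsum -big_split/=; apply: eq_bigr => j _; rewrite -mulrDr /hi /lo.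
  by case: ifP; rewrite ?addr0 ?add0r.
have thE k : th `^ k = A `^ k * r `^ (- (s^-1 * k)).
  by rewrite powRM ?powR_ge0 ?ltW// -powRrM mulNr.
have hiB e : `|rsum e hi| <= r `^ (1 - s^-1) * A.
  apply: le_trans (ler_norm_sum _ _ _) _.
  apply: (@le_trans _ _ (\sum_j `|a j| `^ s * th `^ (1 - s))).
    apply: ler_sum => j _; rewrite normrM normrX normrN1 expr1n mul1r /hi.
    case: ifP => [h|_]; last by rewrite normr0 mulr_ge0// powR_ge0.
    have a0 : 0 < `|a j| by apply: lt_trans h.
    rewrite [leLHS](_ : _ = `|a j| `^ s * `|a j| `^ (1 - s)); last first.
      by rewrite -powRD_gt0// addrC subrK powRr1.
    by rewrite ler_wpM2l ?powR_ge0// powR_le_neg//; [rewrite subr_le0 ltW|exact: ltW].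
  rewrite -mulr_suml; apply: (@le_trans _ _ (A `^ s * th `^ (1 - s))).
    by rewrite ler_wpM2r// powR_ge0.
  rewrite thE mulrA -powRD_gt0// [s + _]addrC subrK powRr1 ?(ltW Ap)// mulrC.
  by rewrite (_ : - (s^-1 * (1 - s)) = 1 - s^-1)//; field; rewrite gt_eqF.
have loB : \sum_j lo j ^+ 2 <= A ^+ 2 * r `^ (1 - 2 * s^-1).
  apply: (@le_trans _ _ (\sum_j `|a j| `^ s * th `^ (2 - s))).
    apply: ler_sum => j _; rewrite /lo; case: ltP => [_|h].
      by rewrite expr0n mulr_ge0// powR_ge0.
    have [->|an0] := eqVneq (a j) 0; first by rewrite expr0n mulr_ge0// powR_ge0.
    rewrite [leLHS](_ : _ = `|a j| `^ s * `|a j| `^ (2 - s)); last first.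
      rewrite -powRD_gt0 ?normr_gt0// addrC subrK (powR_mulrn 2)//.
      by rewrite real_normK ?num_real.
    by rewrite ler_wpM2l ?powR_ge0// powR_le ?subr_ge0.
  rewrite -mulr_suml; apply: (@le_trans _ _ (A `^ s * th `^ (2 - s))).
    by rewrite ler_wpM2r// powR_ge0.
  rewrite thE mulrA -powRD_gt0// [s + _]addrC subrK.
  by rewrite (powR_mulrn 2)// (_ : - (s^-1 * (2 - s)) = 1 - 2 * s^-1)//; field; rewrite gt_eqF.
apply: (@le_trans _ _ (\sum_e (K * r `^ (1 - s^-1) * A < `|rsum e lo|)%R%:R)).
  apply: ler_sum => e _; case: ltP => h //; case: ltP => //.
  move=> h'; exfalso; move: h; rewrite ltNge => /negP; apply.
  rewrite hilo; apply: le_trans (ler_normD _ _) _.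
  by rewrite mulrDl mulrDl mul1r lerD.
apply: (rsum_tail loB); first by rewrite !mulr_ge0 ?powR_ge0.
have -> : (K * r `^ (1 - s^-1) * A) ^+ 2 = K ^+ 2 * A ^+ 2 * r `^ (2 - 2 * s^-1).
  rewrite !exprMn -[in LHS](@powR_mulrn _ (_ `^ _) 2) ?powR_ge0// -powRrM.
  by rewrite mulrBl mul1r [_^-1 * _]mulrC mulrAC.
rewrite (_ : 2 - 2 * s^-1 = 1 + (1 - 2 * s^-1)); last ring.
rewrite [in leRHS]powRD_gt0// powRr1 ?(ltW r0)//.
by rewrite le_eqVlt; apply/orP; left; apply/eqP; field.
Qed.

End Rademacher.

Section Levy.
Context {R : realType} {m : nat} {I : Type}.
Implicit Types (a : I -> 'I_m -> R) (e : {ffun 'I_m -> bool}) (k : nat).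

Definition psum e (a : 'I_m -> R) k : R := \sum_(j < m | (j < k)%N) (-1) ^+ e j * a j.

Let flip k e : {ffun 'I_m -> bool} := [ffun j : 'I_m => if (j < k)%N then e j else ~~ e j].

Let flipK k : involutive (flip k).
Proof. by move=> e; apply/ffunP => j; rewrite !ffunE; case: ltnP => //; rewrite negbK. Qed.

Let psum_flip k l e (x : 'I_m -> R) : (l <= k)%N -> psum (flip k e) x l = psum e x l.
Proof.
by move=> lk; apply: eq_bigr => j jl; rewrite ffunE (leq_trans jl lk).
Qed.

Let rsum_flip k e (x : 'I_m -> R) : psum e x k = 2^-1 * (rsum e x + rsum (flip k e) x).
Proof.
rewrite /rsum -big_split mulr_sumr /psum big_mkcond /=; apply: eq_bigr => j _.
rewrite ffunE; case: ltnP => _; first by field.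
by rewrite signrN mulNr subrr mulr0.
Qed.

(* Reflecting the signs after the first exit time tau of the partial sums
   preserves the event {tau = k}, and the sum up to k is the mean of the two
   reflected total sums. *)
Lemma levy_maximal a (c : R) :
  \sum_e `[< exists k i, c < `|psum e (a i) k| >]%:R <=
  2 * \sum_e `[< exists i, c < `|rsum e (a i)| >]%:R :> R.
Proof.
pose X e k := `[< exists i, c < `|psum e (a i) k| >].
pose Z e := `[< exists i, c < `|rsum e (a i)| >].
pose T e k := X e k && [forall l : 'I_k, ~~ X e l].
have Xflip k l e : (l <= k)%N -> X (flip k e) l = X e l.
  move=> lk; apply: asbool_equiv_eq; split=> -[u cu]; exists u; move: cu;
    by rewrite psum_flip.
have Tflip k e : T (flip k e) k = T e k.
  rewrite /T Xflip//; congr (_ && _); apply: eq_forallb => l.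
  by rewrite Xflip// ltnW.
have XZ k e : X e k -> Z e || Z (flip k e).
  move=> /asboolP[i ci]; apply/orP.
  have : c < `|rsum e (a i)| \/ c < `|rsum (flip k e) (a i)|.
    have [|h1] := ltP c `|rsum e (a i)|; first by left.
    have [|h2] := ltP c `|rsum (flip k e) (a i)|; first by right.
    exfalso; move: ci; rewrite (rsum_flip k) ltNge => /negP; apply.
    rewrite normrM gtr0_norm ?invr_gt0//.
    have := ler_normD (rsum e (a i)) (rsum (flip k e) (a i)).
    by move: h1 h2; set u := `|_|; set v := `|_|; set w := `|_|; lra.
  by case=> h; [left|right]; apply/asboolP; exists i.
have psum_big e (x : 'I_m -> R) k : (m <= k)%N -> psum e x k = rsum e x.
  move=> mk; rewrite /psum /rsum; apply: eq_bigl => j.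
  by rewrite (leq_trans (ltn_ord j) mk).
have step e : `[< exists k i, c < `|psum e (a i) k| >]%:R <=
    \sum_(k < m.+1) (T e k)%:R :> R.
  case: asboolP => [[k [i ci]]|_]; last by rewrite sumr_ge0.
  have exX : exists k, (k <= m)%N && X e k.
    exists (minn k m); rewrite geq_minr/=; apply/asboolP; exists i.
    by move: ci; case: (leqP k m) => // /ltnW mk; rewrite !psum_big.
  case: (ex_minnP exX) => l /andP[lm Xl] lmin.
  rewrite (bigD1 (Ordinal (lm : (l < m.+1)%N)))//= ler_wpDr ?sumr_ge0//.
  rewrite /T Xl/= (_ : [forall _, _])//; apply/forallP => j; apply/negP => Xj.
  have := lmin j; rewrite Xj (leq_trans (ltnW (ltn_ord j)) lm)/= => /(_ isT).
  by rewrite leqNgt ltn_ord.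
apply: le_trans (ler_sum _ (fun e _ => step e)) _.
rewrite exchange_big/=.
apply: (@le_trans _ _ (\sum_(k < m.+1) \sum_e (2 * (T e k && Z e)%:R))).
  apply: ler_sum => k _.
  apply: (@le_trans _ _ (\sum_e ((T e k && Z e)%:R + (T e k && Z (flip k e))%:R))).
    apply: ler_sum => e _; have := XZ k e.
    rewrite /T; case: (X e k); case: [forall _, _] => //=; rewrite ?addr0 ?lexx//.
    by move=> /(_ isT); case: (Z e); case: (Z (flip k e)) => //= _; lra.
  rewrite big_split/= [X in _ + X](_ : _ = \sum_e (T e k && Z e)%:R).
    by rewrite -big_split/=; apply: ler_sum => e _; lra.
  rewrite (reindex_inj (inv_inj (flipK k)))/=.
  by apply: eq_bigr => e _; rewrite flipK Tflip.
rewrite exchange_big/= mulr_sumr; apply: ler_sum => e _.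
rewrite -mulr_sumr ler_pM2l//.
have [k kT|nT] := pickP (fun k : 'I_m.+1 => T e k); last first.
  by rewrite big1 ?ler0n// => k _; rewrite nT.
rewrite (bigD1 k)//= kT/= big1 ?addr0// => l lk.
suff -> : T e l = false by [].
apply/negP => lT; move: kT lT => /andP[Xk /forallP fk] /andP[Xl /forallP fl].
have [kl|kl|kl] := ltngtP k l.
- by have := fl (Ordinal kl); rewrite Xk.
- by have := fk (Ordinal kl); rewrite Xl.
- by move: lk; rewrite (val_inj kl) eqxx.
Qed.

End Levy.

(** * Elementary inequalities for powers and finite sums *)

Section FiniteSums.
Context {R : realType}.
Implicit Types (x y a b r s p : R).

(** The mean value inequality for x^p, obtained from Young's inequality for a and b^(p - 1) instead
    of a derivative. *)
Lemma powR_sub_le p a b : 1 < p -> 0 <= a -> a <= b ->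
  b `^ p - a `^ p <= p * (b - a) * b `^ (p - 1).
Proof.
move=> p1 a0 ab; have b0 := le_trans a0 ab; have p0 : 0 < p by lra.
have q0 : 0 < p / (p - 1) by rewrite divr_gt0// subr_gt0.
have E : (b `^ (p - 1)) `^ (p / (p - 1)) = b `^ p.
  by rewrite -powRrM [(p - 1) * _]mulrC divfK// gt_eqF// subr_gt0.
have := conjugate_powR a0 (powR_ge0 b (p - 1)) p0 q0; rewrite E.
have -> : p^-1 + (p / (p - 1))^-1 = 1 by field; rewrite !gt_eqF ?subr_gt0.
move=> /(_ erefl) h.
have eb : b `^ p = b * b `^ (p - 1) by rewrite mulr_powRB1.
have e1 : b `^ p / (p / (p - 1)) = b `^ p * (1 - p^-1).
  by field; rewrite !gt_eqF ?subr_gt0.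
rewrite e1 in h.
have : p * (a * b `^ (p - 1)) <= p * (a `^ p / p + b `^ p * (1 - p^-1)).
  by rewrite ler_pM2l.
have -> : p * (a `^ p / p + b `^ p * (1 - p^-1)) = a `^ p + b `^ p * (p - 1).
  by field; rewrite gt_eqF.
rewrite eb; set u := b `^ _; move=> h2; rewrite -subr_ge0; move: h2; rewrite -subr_ge0.
by congr (0 <= _); ring.
Qed.

(** Young's inequality term by term after division by X and Y. Stated with bounds in place of norms,
    it serves later both for sums over coordinates and for sums over chaining levels. *)
Lemma hoelder_sum (J : finType) (x y : J -> R) r X Y : 1 < r ->
  (forall i, 0 <= x i) -> (forall i, 0 <= y i) -> 0 <= X -> 0 <= Y ->
  \sum_i x i `^ r <= X `^ r -> \sum_i y i <= Y ->
  \sum_i x i * y i `^ (1 - r^-1) <= X * Y `^ (1 - r^-1).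
Proof.
move=> r1 x0 y0 X0 Y0 xX yY; have r0 : 0 < r by lra.
have rV : r^-1 < 1 by rewrite invf_lt1.
have th0 : 0 < 1 - r^-1 by lra.
have sum0 (z : J -> R) i : (forall i, 0 <= z i) -> \sum_i z i <= 0 -> z i = 0.
  move=> z0 zs; apply/le_anti; rewrite z0 andbT; apply: le_trans zs.
  by rewrite (bigD1 i)//= lerDl sumr_ge0.
move: X0; rewrite le_eqVlt => /predU1P[X0|X0].
  rewrite -X0 mul0r big1// => i _; suff -> : x i = 0 by rewrite mul0r.
  have /powR_eq0_eq0// : x i `^ r = 0.
  apply: (sum0 (fun i => x i `^ r)) => [k|]; first exact: powR_ge0.
  by apply: le_trans xX _; rewrite -X0 powR0// gt_eqF.
move: Y0; rewrite le_eqVlt => /predU1P[Y0|Y0].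
  rewrite -Y0 powR0 ?gt_eqF// mulr0 big1// => i _.
  have -> : y i = 0 by apply: (sum0 y) => //; apply: le_trans yY _; rewrite -Y0.
  by rewrite powR0 ?mulr0// gt_eqF.
apply: (@le_trans _ _ (\sum_i X * Y `^ (1 - r^-1) *
    (x i `^ r / X `^ r / r + (1 - r^-1) * (y i / Y)))).
  apply: ler_sum => i _.
  have h0 : 0 < (1 - r^-1)^-1 by rewrite invr_gt0.
  have hh : r^-1 + (1 - r^-1)^-1^-1 = 1 by rewrite invrK addrC subrK.
  have := conjugate_powR (divr_ge0 (x0 i) (ltW X0))
    (powR_ge0 (y i / Y) (1 - r^-1)) r0 h0 hh.
  rewrite powRK ?divr_ge0 ?(ltW Y0) ?gt_eqF// invrK.
  have powRV (z : R) k : 0 < z -> z^-1 `^ k = (z `^ k)^-1.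
    by move=> z0; rewrite -powR_inv1 ?(ltW z0)// -powRrM mulN1r powRN.
  rewrite !powRM ?invr_ge0 ?(ltW X0) ?(ltW Y0)// !powRV// => h.
  apply: le_trans (ler_wpM2l (mulr_ge0 (ltW X0) (powR_ge0 Y (1 - r^-1))) _); last first.
    by rewrite [_ * (y i / Y)]mulrC; exact: h.
  rewrite le_eqVlt; apply/orP; left; apply/eqP; field.
  by rewrite (gt_eqF X0) gt_eqF// powR_gt0.
rewrite -mulr_sumr ler_piMr ?mulr_ge0 ?powR_ge0 ?(ltW X0)//.
rewrite big_split/= -!mulr_suml -mulr_sumr -mulr_suml.
rewrite [leRHS](_ : 1 = r^-1 + (1 - r^-1)); last by rewrite addrC subrK.
apply: lerD; rewrite ?ler_piMl ?ler_piMr ?invr_ge0 ?(ltW r0) ?(ltW th0)//.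
  by rewrite ler_pdivrMr ?powR_gt0// mul1r.
by rewrite ler_pdivrMr// mul1r.
Qed.

Lemma hoelder_card (J : finType) (Q : pred J) (x : J -> R) r X N : 1 < r ->
  (forall i, 0 <= x i) -> 0 <= X -> \sum_i x i `^ r <= X `^ r ->
  \sum_(i | Q i) 1 <= N -> \sum_(i | Q i) x i <= X * N `^ (1 - r^-1).
Proof.
move=> r1 x0 X0 xX QN.
have rV : 0 < 1 - r^-1 by rewrite subr_gt0 invf_lt1//; lra.
have := @hoelder_sum J x (fun i => (Q i)%:R) r X N r1 x0 (fun=> ler0n _ _) X0 _ xX.
rewrite big_mkcond/= in QN.
have N0 : 0 <= N by apply: le_trans QN; apply: sumr_ge0 => i _; case: ifP.
move=> /(_ N0) H; rewrite big_mkcond; apply: le_trans (H _).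
  apply: ler_sum => i _; case: (Q i) => /=; first by rewrite powR1 mulr1.
  by rewrite powR0 ?mulr0// gt_eqF.
by apply: le_trans QN; apply: ler_sum => i _; case: (Q i).
Qed.

Lemma count_between (u v : R) k :
  \sum_(n < k) ((u < n%:R) && (n%:R < v))%:R <= Num.max 0 (v + 1 - u).
Proof.
(* With the cap [k] inside the bound the induction on [k] goes through: the bound grows by 1 at each
   index that is counted. *)
suff H : \sum_(n < k) ((u < n%:R) && (n%:R < v))%:R <= Num.max 0 (Num.min k%:R (v + 1) - u).
  apply: le_trans H _; rewrite ge_max !le_max lexx/=; apply/orP; right.
  by rewrite lerD2r ge_min lexx orbT.
elim: k => [|k IH]; first by rewrite big_ord0 le_max lexx.
rewrite big_ord_recr/=.
have mono : Num.max 0 (Num.min k%:R (v + 1) - u) <=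
    Num.max 0 (Num.min k.+1%:R (v + 1) - u).
  rewrite ge_max !le_max lexx/=; apply/orP; right; rewrite lerD2r.
  by rewrite le_min !ge_min lexx orbT ler_nat leqnSn.
case: ltP => uk /=; last by rewrite addr0; apply: le_trans IH mono.
case: ltP => kv /=; last by rewrite addr0; apply: le_trans IH mono.
have k1 : k.+1%:R = k%:R + 1 :> R by rewrite -natr1.
rewrite (min_idPl _) in IH; last by rewrite (le_trans (ltW kv))// lerDl.
rewrite (min_idPl _) ?k1 ?lerD2r ?(ltW kv)//.
rewrite (max_idPr _) in IH; last by rewrite subr_ge0 ltW.
rewrite le_max; apply/orP; right; lra.
Qed.

(** Nothing is summed before the sequence falls below 1, and from then on it is a geometric series
    with first term below 1; hence a bound free of [x]. *)
Lemma geom_below1 x r k : 0 <= x -> 0 < r < 1 ->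
  \sum_(n < k) (if x * r ^+ n < 1 then x * r ^+ n else 0) <= (1 - r)^-1.
Proof.
move=> + /andP[r0 r1]; elim: k x => [|k IH] x x0.
  by rewrite big_ord0 invr_ge0 subr_ge0 ltW.
have geom n y : 0 <= y -> \sum_(i < n) y * r ^+ i <= y / (1 - r).
  move=> y0; rewrite -mulr_sumr ler_wpM2l//.
  have e : 1 - r ^+ n = (1 - r) * \sum_(i < n) r ^+ i.
    by rewrite -[LHS]opprB subrX1 -mulNr opprB.
  by rewrite -[_^-1]mul1r ler_pdivlMr ?subr_gt0// mulrC -e gerBl exprn_ge0// ltW.
rewrite big_ord_recl expr0 mulr1.
under eq_bigr => i _ do rewrite lift0 exprS mulrA.
case: ltP => x1; last by rewrite add0r; apply: IH; rewrite mulr_ge0// ltW.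
apply: le_trans (lerD (lexx x) (ler_sum _ _)) _; last first.
  apply: le_trans (lerD (lexx _) (geom k (x * r) _)) _; first by rewrite mulr_ge0// ltW.
  have -> : x + x * r / (1 - r) = x / (1 - r) by field; rewrite subr_eq0 gt_eqF.
  by rewrite ler_piMl ?invr_ge0 ?subr_ge0 ?ltW.
move=> i _; case: ifP => // _; rewrite !mulr_ge0 ?exprn_ge0//; exact: ltW.
Qed.

End FiniteSums.

Section PowRSums.
Context {R : realType}.
Lemma powR_add3 (r x y z : R) : 0 <= r -> 0 <= x -> 0 <= y -> 0 <= z ->
  (x + y + z) `^ r <= 3 `^ r * (x `^ r + y `^ r + z `^ r).
Proof.
move=> r0 x0 y0 z0.
have H u : 0 <= u -> x <= u -> y <= u -> z <= u -> (x + y + z) `^ r <= 3 `^ r * u `^ r.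
  by move=> u0 xu yu zu; rewrite -powRM//; apply: powR_le => //; [rewrite !addr_ge0|lra].
have nx := powR_ge0 x r; have ny := powR_ge0 y r; have nz := powR_ge0 z r.
have le3 := powR_ge0 3 r.
have [xy|yx] := leP x y; [have [yz|zy] := leP y z|have [xz|zx] := leP x z].
- apply: le_trans (H z _ _ _ _) _ => //; first exact: le_trans yz.
  by rewrite ler_wpM2l//; lra.
- apply: le_trans (H y _ _ _ _) _ => //; first exact: ltW.
  by rewrite ler_wpM2l//; lra.
- apply: le_trans (H z _ _ _ _) _ => //; first exact: le_trans (ltW yx) xz.
  by rewrite ler_wpM2l//; lra.
- apply: le_trans (H x _ _ _ _) _ => //; try exact: ltW.
  by rewrite ler_wpM2l//; lra.
Qed.

Lemma powR_sum3 (J : finType) (X Y Z : J -> R) (c r B : R) : 1 <= c -> 1 <= r -> 0 <= B ->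
  (forall j, 0 <= X j) -> (forall j, 0 <= Y j) -> (forall j, 0 <= Z j) ->
  \sum_j X j `^ r <= B `^ r -> \sum_j Y j `^ r <= B `^ r -> \sum_j Z j `^ r <= B `^ r ->
  \sum_j (X j + c * Y j + c * Z j) `^ r <= (9 * c * B) `^ r.
Proof.
move=> c1 r1 B0 X0 Y0 Z0 XB YB ZB; have c0 : 0 <= c by lra.
have r0 : 0 <= r by lra.
apply: (@le_trans _ _ (\sum_j 3 `^ r * (X j `^ r + c `^ r * Y j `^ r + c `^ r * Z j `^ r))).
  apply: ler_sum => j _; rewrite -!powRM//.
  by apply: powR_add3; rewrite ?mulr_ge0.
rewrite -mulr_sumr !big_split/= -!mulr_sumr.
apply: (@le_trans _ _ (3 `^ r * (B `^ r + c `^ r * B `^ r + c `^ r * B `^ r))).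
  by rewrite ler_wpM2l ?powR_ge0// !lerD// ler_wpM2l ?powR_ge0.
have -> : 9 * c * B = 3 * (3 * (c * B)) by ring.
have cr : 1 <= c `^ r by apply: (le_trans c1); exact: le1r_powR.
have tr : 3 <= 3 `^ r :> R by apply: le1r_powR => //; lra.
rewrite !powRM ?mulr_ge0// ler_wpM2l ?powR_ge0//.
have -> : B `^ r + c `^ r * B `^ r + c `^ r * B `^ r = (1 + 2 * c `^ r) * B `^ r by ring.
by rewrite mulrA ler_wpM2r ?powR_ge0//; nra.
Qed.
End PowRSums.

(** * Chaining for a fixed sample *)

Section LpSmall.
Context {R : realType} {m : nat}.
Variables (p p0 M : R).
Hypotheses (p2 : 2 <= p) (p01 : 1 < p0) (p0p : p0 <= p) (M0 : 0 < M).
Implicit Types (d v a : 'I_m -> R) (s t w : R).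

Let kap : R := p0^-1 - p^-1.
Let q : R := p / (p - 1).

(* [M^{p/p1} ||d||_{L_p1} <= t] for the normalized norm and [1/p1 = 1/p0 - 1/p]. *)
Definition lp1_le d t : Prop :=
  if p0 == p then forall j, d j <= t
  else M `^ p * \sum_j d j `^ kap^-1 <= m%:R * t `^ kap^-1.

Local Ltac plra := move: p2 p01 p0p; lra.

Let pp : 0 < p. Proof. plra. Qed.
Let p0p0 : 0 < p0. Proof. plra. Qed.
Let q1 : 1 < q. Proof. by rewrite /q ltr_pdivlMr; plra. Qed.
Let q0 : 0 < q. Proof. by apply: lt_trans q1. Qed.
Let qE : q * (p - 1) = p. Proof. by rewrite /q divfK// subr_eq0 gt_eqF//; plra. Qed.
Let qV : q^-1 = 1 - p^-1. Proof. by rewrite /q; field; rewrite subr_eq0 ?gt_eqF//; plra. Qed.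
Let kap0 : p0 != p -> 0 < kap.
Proof. by move=> h; rewrite subr_gt0 ltf_pV2 ?posrE// lt_neqAle h. Qed.
Let kap1 : kap < 1.
Proof.
have : p0^-1 < 1 by rewrite invf_lt1.
have : 0 < p^-1 by rewrite invr_gt0.
by rewrite /kap; lra.
Qed.

Lemma lp1_le_nonneg d t j : 0 <= t -> (forall j, 0 <= d j) -> lp1_le d t -> t = 0 -> d j = 0.
Proof.
move=> t0 d0; rewrite /lp1_le; case: eqVneq => [_ h t00|h hd t00].
  by apply/le_anti; rewrite d0 -[X in _ <= X]t00 h.
have k0 := kap0 h.
have k1 : kap^-1 != 0 by rewrite invr_eq0 gt_eqF.
have s0 : \sum_j d j `^ kap^-1 <= 0.
  rewrite -(@pmulr_rle0 _ (M `^ p)) ?powR_gt0//; apply: le_trans hd _.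
  by rewrite t00 powR0// mulr0.
have : d j `^ kap^-1 <= 0.
  by apply: le_trans s0; rewrite (bigD1 j)//= lerDl sumr_ge0// => i _; rewrite powR_ge0.
move=> d00; apply: (@powR_eq0_eq0 _ _ kap^-1).
by apply/le_anti; rewrite d00 powR_ge0.
Qed.

(** For p0 < p write d^q v^p = d^q v^(p al) v^(p (1 - al)) with al = q (1/p0 - 1/p). Since v <= M,
    the middle factor is at most M^(p al), which is matched by the weight M^p in [lp1_le]; Young's
    inequality with weights al and 1 - al does the rest. The exponent of [w] reflects 1 - al = q (1
    - 1/p0). *)
Lemma lp1_hoelder d v t w : (forall j, 0 <= d j) -> (forall j, 0 <= v j <= M) ->
  0 <= t -> 0 <= w -> lp1_le d t -> \sum_j v j `^ p <= w ->
  \sum_j (d j * v j `^ (p - 1)) `^ q <= (m%:R `^ kap * t * w `^ (1 - p0^-1)) `^ q.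
Proof.
move=> d0 vM t0 w0 hd vw.
have v0 j : 0 <= v j by case/andP: (vM j).
have zero : (forall j, d j * v j `^ (p - 1) = 0) ->
  \sum_j (d j * v j `^ (p - 1)) `^ q <= (m%:R `^ kap * t * w `^ (1 - p0^-1)) `^ q.
  by move=> h; rewrite big1 ?powR_ge0// => j _; rewrite h powR0// gt_eqF.
have [t00|tn0] := eqVneq t 0.
  by apply: zero => j; rewrite (lp1_le_nonneg j t0 d0 hd t00) mul0r.
have [w00|wn0] := eqVneq w 0.
  apply: zero => j; suff -> : v j = 0.
    by rewrite powR0 ?mulr0// gt_eqF//; plra.
  apply: (@powR_eq0_eq0 _ _ p); apply/le_anti; rewrite powR_ge0 andbT -[X in _ <= X]w00.
  by apply: le_trans vw; rewrite (bigD1 j)//= lerDl sumr_ge0// => i _; rewrite powR_ge0.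
have tp : 0 < t by rewrite lt_neqAle eq_sym tn0.
have wp : 0 < w by rewrite lt_neqAle eq_sym wn0.
have dvE j : (d j * v j `^ (p - 1)) `^ q = d j `^ q * v j `^ p.
  by rewrite powRM ?powR_ge0// -powRrM [(p - 1) * _]mulrC qE.
under eq_bigr => j _ do rewrite dvE.
move: hd; rewrite /lp1_le; case: eqVneq => [e|ne] hd.
  rewrite /kap e subrr powRr0 mul1r powRM ?powR_ge0// -powRrM -qV mulVf ?gt_eqF//.
  rewrite powRr1//.
  apply: le_trans (ler_wpM2l (powR_ge0 _ _) vw); rewrite mulr_sumr.
  by apply: ler_sum => j _; rewrite ler_wpM2r ?powR_ge0// powR_le// ltW.
have k0 := kap0 ne.
have [m0|mn0] := eqVneq m%:R (0 : R).
  rewrite big1 ?powR_ge0// => j _; exfalso.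
  move/eqP: m0; rewrite pnatr_eq0 => /eqP m00; have := ltn_ord j.
  by move: (nat_of_ord j) => k; rewrite m00.
have mp : 0 < m%:R :> R by rewrite lt_neqAle eq_sym mn0 ler0n.
set al := q * kap.
have al0 : 0 < al by rewrite mulr_gt0.
have alE : 1 - al = q * (1 - p0^-1).
  have : q * q^-1 = 1 by rewrite mulfV ?gt_eqF.
  by rewrite qV /al /kap => h; rewrite -[X in X - _]h; ring.
have al1 : 0 < 1 - al.
  by rewrite alE mulr_gt0// subr_gt0 invf_lt1.
have young j : d j `^ q * v j `^ p <=
   (m%:R `^ kap * t * w `^ (1 - p0^-1)) `^ q *
   (al * (M `^ p * d j `^ kap^-1 / (m%:R * t `^ kap^-1)) + (1 - al) * (v j `^ p / w)).
  set x := M `^ p * d j `^ kap^-1 / (m%:R * t `^ kap^-1).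
  have x0 : 0 <= x by rewrite divr_ge0 ?mulr_ge0 ?powR_ge0 ?ler0n.
  have y0 : 0 <= v j `^ p / w by rewrite divr_ge0 ?powR_ge0.
  have h1 : 0 < al^-1 by rewrite invr_gt0.
  have h2 : 0 < (1 - al)^-1 by rewrite invr_gt0.
  have h3 : al^-1^-1 + (1 - al)^-1^-1 = 1 by rewrite !invrK addrC subrK.
  have := conjugate_powR (powR_ge0 x al) (powR_ge0 (v j `^ p / w) (1 - al)) h1 h2 h3.
  rewrite !powRK ?(gt_eqF al0) ?(gt_eqF al1)// !invrK [x * al]mulrC [_ / w * _]mulrC => h.
  have X0 : 0 < (m%:R `^ kap * t * w `^ (1 - p0^-1)) `^ q.
    by rewrite powR_gt0// !mulr_gt0 ?powR_gt0.
  apply: le_trans (ler_wpM2l (ltW X0) h).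
  rewrite !powRM ?mulr_ge0 ?powR_ge0 ?invr_ge0 ?(ltW tp) ?(ltW wp) ?(ltW mp)//; last first.
    by rewrite mulr_ge0 ?powR_ge0// ltW.
  have i1 : ((m%:R * t `^ kap^-1)^-1) `^ al = (m%:R `^ al)^-1 * (t `^ q)^-1.
    rewrite -powR_inv1 ?mulr_ge0 ?powR_ge0 ?(ltW mp)// -powRrM mulN1r powRN.
    rewrite powRM ?powR_ge0 ?(ltW mp)// -[in t `^ _ `^ _]powRrM invfM.
    by rewrite (_ : kap^-1 * al = q)// /al mulrC mulfK ?gt_eqF.
  have i2 : (w^-1) `^ (1 - al) = (w `^ (1 - al))^-1.
    by rewrite -powR_inv1 ?(ltW wp)// -powRrM mulN1r powRN.
  rewrite i1 i2 -!powRrM (_ : kap^-1 * al = q); last by rewrite /al mulrC mulfK ?gt_eqF.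
  rewrite -[kap * q]mulrC -/al [(1 - p0^-1) * q]mulrC -alE.
  have -> : m%:R `^ al * t `^ q * w `^ (1 - al) *
    (M `^ (p * al) * d j `^ q * ((m%:R `^ al)^-1 * (t `^ q)^-1) *
     (v j `^ (p * (1 - al)) * (w `^ (1 - al))^-1)) =
     d j `^ q * (M `^ (p * al) * v j `^ (p * (1 - al))).
    by field; rewrite !gt_eqF// powR_gt0.
  rewrite ler_wpM2l ?powR_ge0//.
  have [->|vn0] := eqVneq (v j) 0.
    by rewrite powR0 ?gt_eqF// mulr_ge0 ?powR_ge0.
  have vp : 0 < v j by rewrite lt_neqAle eq_sym vn0 v0.
  rewrite [leLHS](_ : _ = v j `^ (p * al) * v j `^ (p * (1 - al))); last first.
    by rewrite -powRD_gt0// -mulrDr addrC subrK mulr1.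
  rewrite ler_wpM2r ?powR_ge0// powR_le ?(ltW vp)//; last by case/andP: (vM j).
  exact: mulr_ge0 (ltW pp) (ltW al0).
apply: le_trans (ler_sum _ (fun j _ => young j)) _.
rewrite -mulr_sumr ler_piMr ?powR_ge0// big_split/= -!mulr_sumr -!mulr_suml.
rewrite [leRHS](_ : 1 = al * 1 + (1 - al) * 1); last by ring.
apply: lerD; rewrite ler_pM2l// ler_pdivrMr ?mul1r//.
  by rewrite -mulr_sumr.
by rewrite mulr_gt0// powR_gt0.
Qed.

(** These are the coordinates at which the distance [d] is not small compared with [v]. For p0 = p
    there are none, as d <= s / 4. Otherwise Chebyshev's inequality in l_p1, where p1 = [kap^-1],
    gives m (s/M)^p or m (s/M)^p1, according to the order of p and p1. Only the common bound, linear
    in s/M, is kept: it can be summed along geometric levels. *)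
Lemma lp1_bad_sum d v t s : (forall j, 0 <= d j) -> (forall j, 0 <= v j <= M) ->
  0 <= t -> 4 * t <= s -> 0 < s -> s <= M -> lp1_le d t ->
  \sum_(j | (s < v j) && (v j <= 2 * d j)) v j `^ p <= m%:R * (s / M).
Proof.
move=> d0 vM t0 ts s0 sM; rewrite /lp1_le; case: eqVneq => [_|ne] hd.
  rewrite big1 ?mulr_ge0 ?invr_ge0 ?(ltW s0) ?(ltW M0)// => j /andP[sv vd].
  by exfalso; have := hd j; move: sv vd; set x := v j; set y := d j; lra.
have k0 := kap0 ne.
have k1 : 1 <= kap^-1 by rewrite invf_ge1// ltW.
have kn : 0 < kap^-1 by lra.
have sM1 r : 1 <= r -> (s / M) `^ r <= s / M.
  by move=> r1; apply: ge1r_powR => //; rewrite divr_gt0//= ler_pdivrMr// mul1r.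
have sumd c : 0 <= c -> \sum_(j | (s < v j) && (v j <= 2 * d j)) c * (2 * d j) `^ kap^-1
    <= c * (m%:R * (s `^ kap^-1 / M `^ p)).
  move=> c0; rewrite -mulr_sumr ler_wpM2l//.
  apply: (@le_trans _ _ (\sum_j (2 * d j) `^ kap^-1)).
    rewrite big_mkcond; apply: ler_sum => j _; case: ifP => // _; exact: powR_ge0.
  apply: (@le_trans _ _ (2 `^ kap^-1 * (m%:R * t `^ kap^-1 / M `^ p))).
    under eq_bigr => j _ do rewrite powRM//.
    by rewrite -mulr_sumr ler_wpM2l ?powR_ge0// ler_pdivlMr ?powR_gt0// mulrC.
  have -> : 2 `^ kap^-1 * (m%:R * t `^ kap^-1 / M `^ p) =
            m%:R * ((2 * t) `^ kap^-1 / M `^ p) by rewrite powRM//; ring.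
  rewrite ler_wpM2l// ler_wpM2r ?invr_ge0 ?powR_ge0// powR_le ?(ltW kn) ?mulr_ge0//.
  lra.
have [kp|kp] := leP p kap^-1.
  apply: (@le_trans _ _ (\sum_(j | (s < v j) && (v j <= 2 * d j))
      s `^ (p - kap^-1) * (2 * d j) `^ kap^-1)).
    apply: ler_sum => j /andP[sv vd]; have v0 : 0 < v j := lt_trans s0 sv.
    rewrite [leLHS](_ : _ = v j `^ (p - kap^-1) * v j `^ kap^-1); last first.
      by rewrite -powRD_gt0// subrK.
    apply: ler_pM; rewrite ?powR_ge0//; last by rewrite powR_le ?(ltW kn) ?(ltW v0).
    by rewrite powR_le_neg ?subr_le0 ?(ltW sv).
  apply: le_trans (sumd _ (powR_ge0 _ _)) _.
  rewrite mulrCA ler_wpM2l// mulrA -powRD_gt0// subrK.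
  rewrite [leLHS](_ : _ = (s / M) `^ p); first by apply: sM1; plra.
  by rewrite powRM ?invr_ge0 ?(ltW s0) ?(ltW M0)// -[M^-1]powR_inv1 ?(ltW M0)// -powRrM
    mulN1r powRN.
apply: (@le_trans _ _ (\sum_(j | (s < v j) && (v j <= 2 * d j))
      M `^ (p - kap^-1) * (2 * d j) `^ kap^-1)).
  apply: ler_sum => j /andP[sv vd]; have v0 : 0 < v j := lt_trans s0 sv.
  rewrite [leLHS](_ : _ = v j `^ (p - kap^-1) * v j `^ kap^-1); last first.
    by rewrite -powRD_gt0// subrK.
  apply: ler_pM; rewrite ?powR_ge0//; last by rewrite powR_le ?(ltW kn) ?(ltW v0).
  by case/andP: (vM j) => _ vM'; rewrite powR_le ?subr_ge0 ?(ltW kp) ?(ltW v0).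
apply: le_trans (sumd _ (powR_ge0 _ _)) _.
rewrite mulrCA ler_wpM2l//.
rewrite [leLHS](_ : _ = (s / M) `^ kap^-1); first exact: sM1.
rewrite powRM ?invr_ge0 ?(ltW s0) ?(ltW M0)// -[M^-1]powR_inv1 ?(ltW M0)// -powRrM
    mulN1r powRN powRD_gt0// powRN.
by field; rewrite !gt_eqF// powR_gt0.
Qed.

(* The truncation of [v ^ p] below the level [s]; constant below [s], so that
   its increments are supported on the coordinates above [s]. *)
Definition psi s x : R := Num.max x s `^ p - s `^ p.

Let p1 : 1 < p. Proof. plra. Qed.

Lemma powR_pB1 x : 0 <= x -> x * x `^ (p - 1) = x `^ p.
Proof. by move=> x0; rewrite mulr_powRB1. Qed.

Let powR_sub_abs x y : 0 <= x -> 0 <= y ->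
  `|x `^ p - y `^ p| <= p * `|x - y| * Num.max x y `^ (p - 1).
Proof.
wlog xy : x y / x <= y => [H x0 y0|x0 y0].
  have /orP[xy|yx] := le_total x y; first exact: H.
  by rewrite distrC [`|x - y|]distrC maxC; apply: H.
rewrite (max_idPr xy) distrC [`|x - y|]distrC !ger0_norm ?subr_ge0//.
  exact: powR_sub_le.
by rewrite powR_le// ltW.
Qed.

Lemma psi_lip s x y : 0 <= s -> 0 <= x -> 0 <= y ->
  `|psi s x - psi s y| <= p * `|x - y| *
    ((if s < x then x else 0) `^ (p - 1) + (if s < y then y else 0) `^ (p - 1)).
Proof.
move=> s0 x0 y0; have pm : p - 1 != 0 by rewrite subr_eq0 gt_eqF.
have -> : psi s x - psi s y = Num.max x s `^ p - Num.max y s `^ p.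
  by rewrite /psi; ring.
case: (ltP s x) => sx; case: (ltP s y) => sy.
- apply: le_trans (powR_sub_abs _ _) _ => //.
  rewrite ler_wpM2l ?mulr_ge0 ?(ltW pp)// /Order.max; case: ifP => _.
    by rewrite lerDr powR_ge0.
  by rewrite lerDl powR_ge0.
- apply: le_trans (powR_sub_abs _ _) _ => //.
  rewrite (max_idPl (ltW sx)) powR0// addr0 ler_wpM2r ?powR_ge0// ler_pM2l//.
  by rewrite !ger0_norm ?subr_ge0 ?(ltW sx) ?(le_trans sy (ltW sx))// lerB.
- apply: le_trans (powR_sub_abs _ _) _ => //.
  rewrite (max_idPr (ltW sy)) powR0// add0r ler_wpM2r ?powR_ge0// ler_pM2l//.
  by rewrite distrC [`|x - y|]distrC !ger0_norm ?subr_ge0 ?(ltW sy) ?(le_trans sx (ltW sy))// lerB.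
by rewrite subrr normr0 !mulr_ge0 ?addr_ge0 ?powR_ge0// ltW.
Qed.

Lemma psi_level s s' x : 0 <= s -> s <= s' -> 0 <= x ->
  `|psi s x - psi s' x| <= s' * (if s < x then x else 0) `^ (p - 1).
Proof.
move=> s0 ss x0; have pm : p - 1 != 0 by rewrite subr_eq0 gt_eqF.
have s'0 := le_trans s0 ss.
have le_p y z : 0 <= y -> y <= z -> y `^ p <= z `^ p.
  by move=> y0 yz; rewrite powR_le// ltW.
rewrite /psi; case: (ltP s x) => sx.
  case: (leP s' x) => sx'.
    rewrite [X in `|X|](_ : _ = s' `^ p - s `^ p); last by ring.
    rewrite ger0_norm ?subr_ge0 ?le_p//.
    apply: (@le_trans _ _ (s' `^ p)); first by rewrite gerBl powR_ge0.
    by rewrite -powR_pB1// ler_wpM2l// powR_le//; plra.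
  rewrite subrr subr0 ger0_norm; last by rewrite subr_ge0 le_p// ltW.
  apply: (@le_trans _ _ (x `^ p)); first by rewrite gerBl powR_ge0.
  by rewrite -powR_pB1// ler_wpM2r ?powR_ge0// ltW.
rewrite (max_idPr (le_trans sx ss)) !subrr normr0.
by rewrite powR0// mulr0.
Qed.

Lemma psi_top s x : 0 <= s -> 0 <= x -> `|x `^ p - psi s x| <= s * x `^ (p - 1).
Proof.
move=> s0 x0; rewrite /psi; have [sx|xs] := leP s x.
  rewrite subKr ger0_norm ?powR_ge0//.
  by rewrite -powR_pB1// ler_wpM2l// powR_le//; plra.
by rewrite subrr subr0 ger0_norm ?powR_ge0// -powR_pB1// ler_wpM2r ?powR_ge0// ltW.
Qed.

Lemma psi_bound s x : 0 <= s -> 0 <= x -> 0 <= psi s x <= x `^ p.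
Proof.
move=> s0 x0; rewrite /psi; have [sx|xs] := leP s x.
  by rewrite subr_ge0 gerBl powR_ge0 powR_le// ltW.
by rewrite subrr lexx powR_ge0.
Qed.

(** In the bound on [a] the first term accounts for a change of the truncation level, the second for
    a change of the function. The first has l_q norm at most s w^(1/q), and 1/q = kap + (1 - 1/p0)
    splits off w^kap <= w0^kap; the second is treated by [lp1_hoelder] with m <= w0. Both thus take
    the same form, in which only the power 1 - 1/p0 of the two masses is left free. *)
Lemma lp1_increment d v v' a t s w w' w0 : (forall j, 0 <= d j) ->
  (forall j, 0 <= v j <= M) -> (forall j, 0 <= v' j <= M) -> 0 <= t <= s ->
  lp1_le d t -> 0 <= w <= w0 -> 0 <= w' <= w0 -> m%:R <= w0 ->
  \sum_j v j `^ p <= w -> \sum_j v' j `^ p <= w' ->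
  (forall j, `|a j| <= s * v j `^ (p - 1) +
     p * d j * (v j `^ (p - 1) + v' j `^ (p - 1))) ->
  \sum_j `|a j| `^ q <=
    (9 * p * w0 `^ kap * s * (w `^ (1 - p0^-1) + w' `^ (1 - p0^-1))) `^ q.
Proof.
move=> d0 vM v'M /andP[t0 ts] hd /andP[wge ww0] /andP[w'ge w'w0] mw0 vw v'w' av.
have s0 := le_trans t0 ts; have w00 := le_trans wge ww0.
have kapge : 0 <= kap.
  by have [e|ne] := eqVneq p0 p; [rewrite /kap e subrr|rewrite ltW ?kap0].
have v0 j : 0 <= v j by case/andP: (vM j).
have v'0 j : 0 <= v' j by case/andP: (v'M j).
set th := 1 - p0^-1.
have th0 : 0 < th by rewrite subr_gt0 invf_lt1.
set B := w0 `^ kap * s * (w `^ th + w' `^ th).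
have B0 : 0 <= B by rewrite !mulr_ge0 ?addr_ge0 ?powR_ge0.
have le_B x : x <= w0 `^ kap -> m%:R `^ kap * t * w `^ th <= B /\
    m%:R `^ kap * t * w' `^ th <= B /\ x * s * w `^ th <= B.
  move=> x0; rewrite /B; split; [|split].
  - apply: ler_pM; rewrite ?mulr_ge0 ?powR_ge0 ?lerDl ?powR_ge0//.
    by apply: ler_pM; rewrite ?powR_ge0// powR_le.
  - apply: ler_pM; rewrite ?mulr_ge0 ?powR_ge0 ?lerDr ?powR_ge0//.
    by apply: ler_pM; rewrite ?powR_ge0// powR_le.
  - apply: (@le_trans _ _ (w0 `^ kap * s * w `^ th)).
      by rewrite ler_wpM2r ?powR_ge0// ler_wpM2r.
    by rewrite ler_wpM2l ?mulr_ge0 ?powR_ge0// lerDl powR_ge0.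
have qle x y : 0 <= x -> x <= y -> x `^ q <= y `^ q by move=> *; rewrite powR_le// ltW.
have b1 : \sum_j (s * v j `^ (p - 1)) `^ q <= B `^ q.
  under eq_bigr => j _ do rewrite powRM ?powR_ge0// -[in v j `^ _ `^ _]powRrM
    [(p - 1) * _]mulrC qE.
  rewrite -mulr_sumr.
  apply: (@le_trans _ _ (s `^ q * w)); first by rewrite ler_wpM2l ?powR_ge0.
  apply: (@le_trans _ _ ((w `^ kap * s * w `^ th) `^ q)); last first.
    apply: qle; first by rewrite !mulr_ge0 ?powR_ge0.
    by have [_ [_]] := le_B (w `^ kap) (powR_le kapge wge ww0).
  move: wge; rewrite le_eqVlt => /predU1P[w0'|wp].
    by rewrite -w0' mulr0 powR_ge0.
  rewrite mulrAC -powRD_gt0// (_ : kap + th = q^-1); last by rewrite qV /kap /th; ring.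
  rewrite powRM ?powR_ge0// powRVK ?(ltW wp) ?gt_eqF// mulrC.
  by [].
have b2 : \sum_j (d j * v j `^ (p - 1)) `^ q <= B `^ q.
  apply: le_trans (lp1_hoelder d0 vM t0 wge hd vw) _.
  apply: qle; first by rewrite !mulr_ge0 ?powR_ge0.
  by have [] := le_B (w0 `^ kap) (lexx _).
have b3 : \sum_j (d j * v' j `^ (p - 1)) `^ q <= B `^ q.
  apply: le_trans (lp1_hoelder d0 v'M t0 w'ge hd v'w') _.
  apply: qle; first by rewrite !mulr_ge0 ?powR_ge0.
  by have [_ []] := le_B (w0 `^ kap) (lexx _).
rewrite (_ : 9 * p * w0 `^ kap * s * (w `^ th + w' `^ th) = 9 * p * B); last by rewrite /B; ring.
apply: le_trans (powR_sum3 (ltW p1) (ltW q1) B0 _ _ _ b1 b2 b3) => [|j|j|j]; last 3 first.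
- by rewrite mulr_ge0 ?powR_ge0.
- by rewrite mulr_ge0 ?powR_ge0.
- by rewrite mulr_ge0 ?powR_ge0.
apply: ler_sum => j _; apply: qle => //; apply: le_trans (av j) _.
by rewrite mulrDr !mulrA addrA.
Qed.

End LpSmall.

Lemma powRV {R : realType} (x r : R) : 0 <= x -> x^-1 `^ r = (x `^ r)^-1.
Proof. by move=> x0; rewrite -powR_inv1// -powRrM mulN1r powRN. Qed.

Section LnTwo.
Context {R : realType}.

Lemma ln2_ge_half : 2^-1 <= ln 2 :> R.
Proof.
have : ln (1 + - 2^-1) <= - 2^-1 :> R by apply: le_ln1Dx; lra.
by rewrite (_ : 1 + - 2^-1 = 2^-1 :> R); [rewrite lnV ?posrE// lerN2|field].
Qed.

Lemma powR2E (x : R) : 2 `^ x = expR (x * ln 2).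
Proof. by rewrite /powR pnatr_eq0. Qed.

End LnTwo.

Section ChainAux.
Context {R : realType}.

Lemma window_bound (p l x : R) : 2 <= p -> 0 <= l -> 0 <= x ->
  1 + (2 * p + 4 * p * l + 2 * x) <= (1 + 4 * p) * (1 + l + x).
Proof. by move=> *; nra. Qed.

Lemma window_bound' (p l x u : R) : 2 <= p -> 0 <= l -> 0 <= x -> u <= p * l * 2 ->
  1 + (p + u) <= (1 + 2 * p) * (1 + l + x).
Proof. by move=> *; nra. Qed.

End ChainAux.

Section Chain.
Context {R : realType} {m : nat} {I : Type}.
(** The chain is described by integer codes: [c i f] numbers the block of [f] at level n1 + i, and
    [t i] assigns a radius to each code. Here [v] stands for the moduli of the sampled functions,
    [dd] for those of their differences, [b] for the coordinates that are kept, [w0] for the bound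
    on the mass, [D] for the chaining radius and [L] for the number of levels. *)
Variables (p p0 M w0 D L : R) (b : pred 'I_m) (v : I -> 'I_m -> R)
  (dd : I -> I -> 'I_m -> R) (n1 k : nat) (c : nat -> I -> nat)
  (t : nat -> nat -> R) (f0 : I).
Hypotheses (p2 : 2 <= p) (p01 : 1 < p0) (p0p : p0 <= p) (M0 : 0 < M)
  (w00 : 0 < w0) (mw0 : m%:R <= w0) (D0 : 0 < D) (L1 : 1 <= L) (kL : k.+1%:R <= L)
  (vM : forall f j, 0 <= v f j <= M) (bv : forall f, \sum_(j | b j) v f j `^ p <= w0)
  (dd0 : forall f g j, 0 <= dd f g j) (ddv : forall f g j, `|v f j - v g j| <= dd f g j)
  (c_lt : forall i f, (c i f < 2 ^ (2 ^ (n1 + i)))%N)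
  (c_nest : forall i f g, c i.+1 f = c i.+1 g -> c i f = c i g)
  (t0 : forall i x, 0 <= t i x)
  (t_small : forall i f g, c i f = c i g -> lp1_le p p0 M (dd f g) (t i (c i f)))
  (t_mono : forall i f, t i.+1 (c i.+1 f) <= t i (c i f)).

Local Notation kap := (p0^-1 - p^-1).
Local Notation q := (p / (p - 1)).
Local Notation th := (1 - p0^-1).

(* Level [i] of the chain is level [n1 + i] of the admissible sequence. *)
Definition lev i : R := 2 `^ (- ((n1 + i)%:R / p)).
Local Notation e := lev.

Hypotheses (t_sum : forall f, \sum_(i < k.+1) (t i (c i f) / e i) `^ p0 <= D `^ p0)
  (start : forall f, lp1_le p p0 M (v f) (D * e 0%N))
  (mk : m%:R <= 2 ^+ (n1 + k).+1 :> R).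

Local Ltac plra := move: p2 p01 p0p; lra.

Let pp : 0 < p. Proof. plra. Qed.
Let p1 : 1 < p. Proof. plra. Qed.
Let p00 : 0 < p0. Proof. plra. Qed.
Let LL : 0 < L. Proof. by apply: lt_le_trans L1. Qed.
Let q1 : 1 < q. Proof. by rewrite ltr_pdivlMr; plra. Qed.
Let q0 : 0 < q. Proof. by apply: lt_trans q1. Qed.
Let qV : 1 - q^-1 = p^-1. Proof. by field; rewrite !gt_eqF//; plra. Qed.
Let th0 : 0 < th. Proof. by rewrite subr_gt0 invf_lt1. Qed.
Let th1 : th <= 1. Proof. by rewrite gerBl invr_ge0 ltW. Qed.
Let w0E : w0 `^ kap * w0 `^ th = w0 `^ (1 - p^-1).
Proof. by rewrite -powRD_gt0//; congr (_ `^ _); ring. Qed.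

Let e0 i : 0 < e i. Proof. by rewrite powR_gt0. Qed.
Let eS i : e i.+1 <= e i.
Proof.
rewrite ler_powR ?ler1n// lerN2 ler_pM2r ?invr_gt0//.
by rewrite ler_nat leq_add2l.
Qed.
Let eS2 i : e i <= 2 * e i.+1.
Proof.
have -> : 2 * e i.+1 = 2 `^ (1 - (n1 + i.+1)%:R / p) by rewrite powRD_gt0// powRr1.
rewrite ler_powR ?ler1n// addnS -natr1 mulrDl opprD addrCA lerDl subr_ge0 mul1r.
by rewrite invf_le1//; plra.
Qed.
Let eP i : e i `^ p = (2 ^+ (n1 + i))^-1.
Proof.
rewrite -powRrM mulNr divfK ?gt_eqF// powRN powR_mulrn//.
Qed.
Let eV i : (2 ^+ (n1 + i)) `^ p^-1 = (e i)^-1.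
Proof. by rewrite /lev powRN invrK -powR_mulrn// -powRrM. Qed.

(** The representative depends on the code alone, so that the union bound can run over codes; [f0]
    fills the codes of no block. *)
Definition cellrep i x : I :=
  if pselect (exists f, c i f = x) is left h then sval (cid h) else f0.
Local Notation F := cellrep.

Let F_c i f : c i (F i (c i f)) = c i f.
Proof.
rewrite /F; case: pselect => [h|[]]; last by exists f.
by case: (cid h).
Qed.

Let pi i f := F i (c i f).
(** The lower threshold. Its part 4 t makes a value above it large compared with the distances
    inside the block, up to exceptional coordinates of small mass. The floor D / L e keeps it above
    a geometric sequence, yet over at most L levels adds only O(D) to the l_p0 norm of s / e. The
    upper threshold [sig] carries a factor [L], so that each of the l_1 errors above it is smaller
    by 1 / L and their sum over the levels stays bounded. *)
Let s i f := 4 * t i (c i f) + D / L * e i.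
Let sig i := L * w0 `^ p^-1 * e i.
Let U i f j := if b j && (s i f < v (pi i f) j) then v (pi i f) j else 0.
(* The increments of the coordinates below [sig] are controlled by the tails of
   signed sums; those of the few coordinates above it in [l_1] norm. *)
Let T i f j := if U i f j < sig i then U i f j else 0.
Let ww i f := \sum_j T i f j `^ p.
Let Y i f j := if b j then psi p (s i f) (v (pi i f) j) else 0.
Let inc i f j := Y i.+1 f j - Y i f j.
Let lo i f j := if (U i.+1 f j < sig i.+1) && (U i f j < sig i) then inc i f j else 0.

Let v0 f j : 0 <= v f j. Proof. by case/andP: (vM f j). Qed.
Let DL : 0 < D / L. Proof. by rewrite divr_gt0. Qed.
Let s0 i f : 0 < s i f.
Proof. by rewrite ltr_wpDl ?mulr_ge0// mulr_gt0. Qed.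
Let ts i f : 4 * t i (c i f) <= s i f.
Proof. by rewrite lerDl mulr_ge0// ltW. Qed.
Let ts1 i f : t i (c i f) <= s i f.
Proof. by apply: le_trans (ts i f); have := t0 i (c i f); lra. Qed.
Let sDe i f : D / L * e i <= s i f.
Proof. by rewrite lerDr mulr_ge0. Qed.
Let sS i f : s i.+1 f <= s i f.
Proof. by rewrite lerD// ler_pM2l// ?t_mono. Qed.
Let tDe i f : (i <= k)%N -> t i (c i f) <= D * e i.
Proof.
move=> ik; rewrite -ler_pdivrMr// -(@powR_leE _ _ _ p0) ?divr_ge0 ?(ltW D0) ?(ltW (e0 i))//.
apply: le_trans (t_sum f); rewrite (bigD1 (Ordinal (ik : (i < k.+1)%N)))//= lerDl.
by apply: sumr_ge0 => *; exact: powR_ge0.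
Qed.
Let s5 i f : (i <= k)%N -> s i f <= 5 * (D * e i).
Proof.
move=> ik; have := tDe f ik; rewrite /s.
have : D / L * e i <= D * e i by rewrite ler_pM2r// ler_piMr ?(ltW D0)// invf_le1.
set x := D * e i; set y := D / L * e i; lra.
Qed.
Let sig0 i : 0 < sig i. Proof. by rewrite !mulr_gt0// powR_gt0. Qed.
Let U0 i f j : 0 <= U i f j <= M.
Proof. by rewrite /U; case: ifP => _; rewrite ?vM// lexx ltW. Qed.
Let T0 i f j : 0 <= T i f j <= M.
Proof. by rewrite /T; case: ifP => _; rewrite ?U0// lexx ltW. Qed.
Let pz : p != 0. Proof. by rewrite gt_eqF. Qed.
Let pm1 : p - 1 != 0. Proof. by rewrite subr_eq0 gt_eqF. Qed.
Let Usum i f : \sum_j U i f j `^ p <= w0.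
Proof.
apply: le_trans (bv (pi i f)); rewrite [leRHS]big_mkcond; apply: ler_sum => j _.
rewrite /U; case: (b j) => /=; last by rewrite powR0.
by case: ifP => _ //; rewrite powR0// powR_ge0.
Qed.
Let Tsum i f : ww i f <= w0.
Proof.
apply: le_trans (Usum i f); apply: ler_sum => j _; rewrite /T; case: ifP => // _.
by rewrite powR0// powR_ge0.
Qed.
Let ww0 i f : 0 <= ww i f <= w0.
Proof. by rewrite Tsum andbT sumr_ge0// => j _; rewrite powR_ge0. Qed.

Let pi_eq i f g : c i f = c i g -> pi i f = pi i g.
Proof. by rewrite /pi => ->. Qed.
Let s_eq i f g : c i f = c i g -> s i f = s i g.
Proof. by rewrite /s => ->. Qed.
Let lo_eq i f g : c i.+1 f = c i.+1 g -> lo i f = lo i g.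
Proof.
move=> h; have h' := c_nest h.
by rewrite /lo /inc /Y /U (pi_eq h) (pi_eq h') (s_eq h) (s_eq h').
Qed.
Let Y_eq i f g : c i f = c i g -> Y i f = Y i g.
Proof. by move=> h; rewrite /Y (pi_eq h) (s_eq h). Qed.

Let c_pi i f : c i (pi i.+1 f) = c i f.
Proof. by apply: c_nest; rewrite F_c. Qed.

Let inc_rhs0 i f j g h x y : 0 <= x -> 0 <= y ->
  0 <= s i f * x + p * dd g h j * (x + y).
Proof.
move=> x0 y0; apply: addr_ge0; first exact: mulr_ge0 (ltW (s0 i f)) x0.
by apply: mulr_ge0; [apply: mulr_ge0; [exact: ltW|exact: dd0]|exact: addr_ge0].
Qed.

Let inc_abs i f j : `|inc i f j| <= s i f * U i.+1 f j `^ (p - 1) +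
  p * dd (pi i.+1 f) (pi i f) j * (U i.+1 f j `^ (p - 1) + U i f j `^ (p - 1)).
Proof.
rewrite /inc /Y /U; case: (b j) => /=; last first.
  by rewrite powR0// !addr0 !mulr0 addr0 subrr normr0.
rewrite -[X in `|X - _|](subrK (psi p (s i f) (v (pi i.+1 f) j))) -addrA.
apply: le_trans (ler_normD _ _) _; apply: lerD.
  exact: (psi_level p2 p01 p0p) (ltW (s0 _ _)) (sS _ _) (v0 _ _).
apply: le_trans (psi_lip p2 p01 p0p (ltW (s0 i f)) (v0 _ _) (v0 _ _)) _.
apply: ler_pM.
- by rewrite mulr_ge0// ltW.
- by rewrite addr_ge0 ?powR_ge0.
- by rewrite ler_pM2l.
rewrite lerD2r; case: ltP => h; last by rewrite powR0// powR_ge0.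
by rewrite (le_lt_trans (sS i f) h).
Qed.

Let d_small i f : lp1_le p p0 M (dd (pi i.+1 f) (pi i f)) (t i (c i f)).
Proof. by rewrite -c_pi; apply: t_small; rewrite c_pi F_c. Qed.

Let lo_norm i f : \sum_j `|lo i f j| `^ q <=
  (9 * p * w0 `^ kap * s i f * (ww i.+1 f `^ th + ww i f `^ th)) `^ q.
Proof.
apply: (lp1_increment p2 p01 p0p M0 (dd0 _ _) (T0 i.+1 f) (T0 i f) _ (d_small i f)
  (ww0 _ _) (ww0 _ _) mw0 (lexx _) (lexx _)) => [|j].
  by rewrite t0 ts1.
rewrite /lo /T; case: (ltP (U i.+1 f j)) => _; case: (ltP (U i f j)) => _ /=;
  first exact: inc_abs.
all: by rewrite normr0 inc_rhs0// powR_ge0.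
Qed.

Let inc_norm i f : \sum_j `|inc i f j| `^ q <=
  (18 * p * s i f * w0 `^ (1 - p^-1)) `^ q.
Proof.
rewrite -w0E (_ : 18 * p * s i f * (w0 `^ kap * w0 `^ th) =
  9 * p * w0 `^ kap * s i f * (w0 `^ th + w0 `^ th)); last by ring.
apply: (lp1_increment p2 p01 p0p M0 (dd0 _ _) (U0 i.+1 f) (U0 i f) _ (d_small i f)
  _ _ mw0 (Usum _ _) (Usum _ _)) => [|||j].
- by rewrite t0 ts1.
- by rewrite (ltW w00) lexx.
- by rewrite (ltW w00) lexx.
- exact: inc_abs.
Qed.

Let count_big i f : \sum_(j | ~~ (U i f j < sig i)) 1 <= 2 ^+ (n1 + i) / L `^ p.
Proof.
apply: (@le_trans _ _ ((sig i `^ p)^-1 * \sum_j U i f j `^ p)).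
  rewrite mulr_sumr big_mkcond; apply: ler_sum => j _; rewrite -leNgt; case: (leP (sig i) (U i f j)) => h.
    by rewrite mulrC ler_pdivlMr ?powR_gt0// mul1r powR_le// ltW.
  by rewrite mulr_ge0 ?invr_ge0 ?powR_ge0.
rewrite mulrC ler_pdivrMr ?powR_gt0//; apply: le_trans (Usum i f) _.
rewrite /sig !powRM ?mulr_ge0 ?powR_ge0 ?(ltW LL) ?(ltW (e0 _))// powRVK ?(ltW w00)//.
rewrite eP le_eqVlt; apply/orP; left; apply/eqP; field.
by rewrite !gt_eqF// ?powR_gt0// exprn_gt0.
Qed.

(** Hölder's inequality on at most 2^(n1 + i + 2) / L^p coordinates costs the factor 2^(1/p) / (L
    e_(i+1)), in which e_(i+1) cancels against s_i <= 10 D e_(i+1). An l_1 norm bounds the signed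
    sum for every choice of signs. *)
Let hi_l1 i f : (i < k)%N ->
  \sum_j `|inc i f j - lo i f j| <= 360 * p * D * w0 `^ (1 - p^-1) / L.
Proof.
move=> ik.
pose Q := [pred j | ~~ ((U i.+1 f j < sig i.+1) && (U i f j < sig i))].
have -> : \sum_j `|inc i f j - lo i f j| = \sum_(j | Q j) `|inc i f j|.
  rewrite [RHS]big_mkcond; apply: eq_bigr => j _; rewrite /lo /=.
  by case: (_ && _) => /=; rewrite ?subrr ?normr0 ?subr0.
have Qc : \sum_(j | Q j) 1 <= 2 * 2 ^+ (n1 + i.+1) / L `^ p :> R.
  apply: (@le_trans _ _ (\sum_(j | ~~ (U i.+1 f j < sig i.+1)) 1 +
                        \sum_(j | ~~ (U i f j < sig i)) 1)).
    rewrite [leLHS]big_mkcond [X in _ <= X + _]big_mkcond [X in _ <= _ + X]big_mkcond.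
    rewrite -big_split; apply: ler_sum => j _ /=.
    by do 2 case: (_ < _) => /=; rewrite ?addr0 ?add0r ?lexx// lerDl.
  apply: le_trans (lerD (count_big _ _) (count_big _ _)) _.
  have -> : 2 * 2 ^+ (n1 + i.+1) / L `^ p =
    2 ^+ (n1 + i.+1) / L `^ p + 2 ^+ (n1 + i.+1) / L `^ p by ring.
  rewrite lerD2l ler_pM2r ?invr_gt0 ?powR_gt0//.
  by rewrite ler_eXn2l ?ltr1n// leq_add2l.
have := hoelder_card q1 (fun j => normr_ge0 (inc i f j)) _ (inc_norm i f) Qc.
rewrite qV => /(_ _) H; apply: le_trans (H _) _.
  by rewrite !mulr_ge0 ?powR_ge0 ?(ltW pp) ?(ltW (s0 _ _)).
have -> : (2 * 2 ^+ (n1 + i.+1) / L `^ p) `^ p^-1 = 2 `^ p^-1 / (e i.+1 * L).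
  rewrite powRM ?mulr_ge0 ?invr_ge0 ?powR_ge0 ?exprn_ge0// powRM ?exprn_ge0//.
  rewrite eV powRV ?powR_ge0// powRK ?(ltW LL)//.
  by rewrite invfM mulrA.
have b2 : 2 `^ p^-1 <= 2 :> R.
  by apply: ler1_powR; rewrite ?ler1n// invf_le1//; plra.
have ss : s i f <= 10 * (D * e i.+1).
  apply: le_trans (s5 f (ltnW ik)) _; have := eS2 i.
  by rewrite -(ler_pM2l D0); set x := D * e i; nra.
apply: (@le_trans _ _ (18 * p * (10 * (D * e i.+1)) * w0 `^ (1 - p^-1) * (2 / (e i.+1 * L)))).
  have eL : 0 < e i.+1 * L by rewrite mulr_gt0.
  apply: ler_pM; rewrite ?mulr_ge0 ?powR_ge0 ?invr_ge0 ?(ltW eL) ?(ltW pp) ?(ltW (s0 _ _))//.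
    by rewrite ler_wpM2r ?powR_ge0// ler_pM2l// mulr_gt0.
  by rewrite ler_pM2r ?invr_gt0.
rewrite le_eqVlt; apply/orP; left; apply/eqP; field.
by rewrite !gt_eqF.
Qed.

(** Since m <= 2^(n1 + k + 1), Hölder's inequality over all coordinates costs at most 2 / e_k at the
    last level. The remainder is thus controlled for all signs at once. *)
Let last_l1 f : \sum_j `|(if b j then v f j `^ p else 0) - Y k f j| <=
  180 * p * D * w0 `^ (1 - p^-1).
Proof.
pose V g j := if b j then v g j else 0.
have VM g j : 0 <= V g j <= M by rewrite /V; case: (b j); rewrite ?vM// lexx ltW.
have Vs g : \sum_j V g j `^ p <= w0.
  apply: le_trans (bv g); rewrite [leRHS]big_mkcond; apply: ler_sum => j _.
  by rewrite /V; case: (b j) => //; rewrite powR0.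
pose a j := (if b j then v f j `^ p else 0) - Y k f j.
have aq : \sum_j `|a j| `^ q <= (18 * p * s k f * w0 `^ (1 - p^-1)) `^ q.
  rewrite -w0E (_ : 18 * p * s k f * (w0 `^ kap * w0 `^ th) =
    9 * p * w0 `^ kap * s k f * (w0 `^ th + w0 `^ th)); last by ring.
  have dk : lp1_le p p0 M (dd f (pi k f)) (t k (c k f)) by apply: t_small; rewrite F_c.
  apply: (lp1_increment p2 p01 p0p M0 (dd0 _ _) (VM (pi k f)) (VM f) _ dk
    _ _ mw0 (Vs _) (Vs _)) => [|||j].
  - by rewrite t0 ts1.
  - by rewrite (ltW w00) lexx.
  - by rewrite (ltW w00) lexx.
  rewrite /a /Y /V; case: (b j) => /=; last first.
    by rewrite powR0// !addr0 !mulr0 addr0 subrr normr0.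
  rewrite -[X in `|X - _|](subrK (v (pi k f) j `^ p)) -addrA.
  apply: le_trans (ler_normD _ _) _; rewrite [leRHS]addrC; apply: lerD; last first.
    by rewrite (psi_top p2 p01 p0p)// ltW.
  have := psi_lip p2 p01 p0p (lexx 0) (v0 f j) (v0 (pi k f) j).
  have psi0 x : 0 <= x -> psi p 0 x = x `^ p.
    by move=> x0; rewrite /psi (max_idPl x0) powR0// subr0.
  rewrite !psi0// => /le_trans; apply; rewrite [X in _ <= _ * X]addrC; apply: ler_pM.
  - by rewrite mulr_ge0// ltW.
  - by rewrite addr_ge0 ?powR_ge0.
  - by rewrite ler_pM2l.
  by apply: lerD; case: ltP => // _; rewrite powR0// powR_ge0.
have c1 : \sum_(j < m | xpredT j) 1 <= m%:R :> R by rewrite sumr_const card_ord.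
have := hoelder_card q1 (fun j => normr_ge0 (a j)) _ aq c1.
rewrite qV => H; apply: le_trans (H _) _.
  by rewrite !mulr_ge0 ?powR_ge0 ?(ltW pp) ?(ltW (s0 _ _)).
have mp : m%:R `^ p^-1 <= 2 / e k :> R.
  apply: (@le_trans _ _ ((2 ^+ (n1 + k).+1) `^ p^-1)).
    by rewrite powR_le ?invr_ge0 ?(ltW pp).
  rewrite exprS powRM ?exprn_ge0// eV ler_pM2r ?invr_gt0//.
  by apply: ler1_powR; rewrite ?ler1n// invf_le1//; plra.
apply: (@le_trans _ _ (18 * p * (5 * (D * e k)) * w0 `^ (1 - p^-1) * (2 / e k))).
  apply: ler_pM; rewrite ?mulr_ge0 ?powR_ge0 ?(ltW pp) ?(ltW (s0 _ _))//.
  by rewrite ler_wpM2r ?powR_ge0// ler_pM2l ?mulr_gt0// s5.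
rewrite le_eqVlt; apply/orP; left; apply/eqP; field.
by rewrite !gt_eqF.
Qed.

Let ln20 : 0 < ln 2 :> R. Proof. by apply: lt_le_trans ln2_ge_half. Qed.

(** [e] is geometric with ratio 2^(-1/p), so the number of its terms in a window is p times the
    binary logarithm of the ratio of the ends, up to rounding. *)
Let count_lev (al be : R) : 0 < al -> 0 < be ->
  \sum_(i < k.+1) ((al < e i) && (e i < be))%:R <= 1 + Num.max 0 (p / ln 2 * ln (be / al)).
Proof.
move=> al0 be0.
pose g (x : R) := - (p / ln 2 * ln x) - n1%:R.
have lnE i x : 0 < x -> (x < e i) = (p / ln 2 * ln x < - (n1 + i)%:R) /\
    (e i < x) = (- (n1 + i)%:R < p / ln 2 * ln x).
  move=> x0; have pl : 0 < p / ln 2 by rewrite divr_gt0.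
  have eqn : - (n1 + i)%:R = p / ln 2 * (- ((n1 + i)%:R / p) * ln 2).
    by field; rewrite !gt_eqF.
  by rewrite eqn !ltr_pM2l// /lev powR2E -[in (x < _)%R](lnK x0) -[in (_ < x)%R](lnK x0) !ltr_expR.
have gE i x : 0 < x -> (i%:R < g x) = (x < e i).
  by move=> /(lnE i)[-> _]; rewrite /g natrD; apply/idP/idP; lra.
have gE' i x : 0 < x -> (g x < i%:R) = (e i < x).
  by move=> /(lnE i)[_ ->]; rewrite /g natrD; apply/idP/idP; lra.
apply: (@le_trans _ _ (\sum_(i < k.+1) ((g be < i%:R) && (i%:R < g al))%:R)).
  by apply: ler_sum => i _; rewrite gE// gE'// andbC.
apply: le_trans (count_between _ _ _) _.
have -> : g al + 1 - g be = 1 + p / ln 2 * ln (be / al).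
  by rewrite /g ln_div ?posrE//; ring.
by rewrite ge_max addr_ge0 ?le_max ?lexx//= lerD2l le_max lexx orbT.
Qed.

(* A coordinate with small increments contributes to [ww i] only if [e i] lies
   in a window around its value, hence for O([chain_W]) levels. *)
Definition chain_W : R := 1 + ln L + Num.max 0 (ln (w0 / D `^ p)).
Local Notation W := chain_W.

Let lnL : 0 <= ln L. Proof. exact: ln_ge0. Qed.
Let W1 : 1 <= W.
Proof. by rewrite /chain_W -addrA lerDl addr_ge0// le_max lexx. Qed.
Let iln2 : (ln 2)^-1 <= 2 :> R.
Proof. by rewrite -[leRHS]invrK lef_pV2 ?posrE// ln2_ge_half. Qed.

(** The window of a coordinate whose value at the representative lies within a factor 2 of [v f j]:
    being below [sig] forces e_i > [good_al], being above [s] forces e_i < [good_be]. *)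
Let good_al f j := v f j / (2 * L * w0 `^ p^-1).
Let good_be f j := 2 * L * v f j / D.

Let good_count f j : 0 < v f j ->
  \sum_(i < k.+1) ((good_al f j < e i) && (e i < good_be f j))%:R <= (1 + 4 * p) * W.
Proof.
move=> vp; have wp : 0 < w0 `^ p^-1 by rewrite powR_gt0.
have al0 : 0 < good_al f j by rewrite divr_gt0// !mulr_gt0.
have be0 : 0 < good_be f j by rewrite divr_gt0// !mulr_gt0.
apply: le_trans (count_lev al0 be0) _.
have -> : good_be f j / good_al f j = (2 * L) * (2 * L) * (w0 / D `^ p) `^ p^-1.
  rewrite powRM ?invr_ge0 ?powR_ge0 ?(ltW w00)// powRV ?powR_ge0// powRK ?(ltW D0)//.
  by rewrite /good_be /good_al; field; rewrite !gt_eqF.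
have Dp : 0 < w0 / D `^ p by rewrite divr_gt0// powR_gt0.
rewrite !lnM ?posrE ?mulr_gt0 ?powR_gt0// ln_powR.
set l2 := ln 2; set lL := ln L; set lw := ln (w0 / D `^ p).
have -> : p / l2 * (l2 + lL + (l2 + lL) + p^-1 * lw) =
    2 * p + 2 * p * lL * l2^-1 + l2^-1 * lw.
  by field; rewrite !gt_eqF.
have h1 : 2 * p * lL * l2^-1 <= 4 * p * lL.
  rewrite (_ : 4 * p * lL = 2 * p * lL * 2); last by ring.
  by rewrite ler_wpM2l ?iln2// !mulr_ge0// ltW.
set mx := Num.max 0 lw.
have mx0 : 0 <= mx by rewrite le_max lexx.
have h2 : l2^-1 * lw <= 2 * mx.
  apply: (@le_trans _ _ (l2^-1 * mx)).
    by rewrite ler_wpM2l ?invr_ge0 ?(ltW ln20)// le_max lexx orbT.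
  by rewrite ler_wpM2r.
apply: (@le_trans _ _ (1 + (2 * p + 4 * p * lL + 2 * mx))).
  rewrite lerD2l ge_max; apply/andP; split; last by rewrite !lerD.
  by rewrite !addr_ge0 ?mulr_ge0// ltW.
exact: window_bound.
Qed.

Let badP i f j := (s i f < v (pi i f) j) && (v (pi i f) j <= 2 * dd f (pi i f) j).
Let bad i f := \sum_(j | b j && badP i f j) v (pi i f) j `^ p.

Let bad_le_w0 i f : bad i f <= w0.
Proof.
apply: le_trans (bv (pi i f)); rewrite [leLHS]big_mkcond [leRHS]big_mkcond.
by apply: ler_sum => j _; case: (b j) => //=; case: ifP => // _; rewrite powR_ge0.
Qed.

(** Three regimes. If M <= s, no value exceeds s. If D e_i < M, the bound m s / M of [lp1_bad_sum]
    decays geometrically in i. In between only the trivial bound w0 is left, but on a window whose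
    ends have ratio 2 L. *)
Let bad_le i f : (i <= k)%N -> bad i f <= w0 * ((M / (2 * D) < e i) && (e i < L * M / D))%:R +
  5 * w0 * (if D / M * e i < 1 then D / M * e i else 0).
Proof.
move=> ik; have [sM|Ms] := ltP (s i f) M; last first.
  rewrite /bad big1; last first.
    move=> j /andP[_ /andP[h _]]; exfalso; have /andP[_ vM'] := vM (pi i f) j.
    by have := lt_le_trans h vM'; rewrite ltNge Ms.
  rewrite addr_ge0 ?mulr_ge0 ?(ltW w00)//; case: ifP => // _.
  by rewrite mulr_ge0 ?(ltW (e0 _))// divr_ge0 ?ltW.
have eLM : e i < L * M / D.
  rewrite ltr_pdivlMr// -ltr_pdivrMl//; apply: le_lt_trans sM.
  by apply: le_trans (sDe i f); rewrite le_eqVlt; apply/orP; left; apply/eqP; ring.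
rewrite eLM andbT; have [De|De] := ltP (D / M * e i) 1.
  apply: (@le_trans _ _ (5 * w0 * (D / M * e i))); last by rewrite lerDr mulr_ge0// ltW.
  have dk : lp1_le p p0 M (dd f (pi i f)) (t i (c i f)) by apply: t_small; rewrite F_c.
  apply: (@le_trans _ _ (m%:R * (s i f / M))).
    apply: le_trans (lp1_bad_sum p2 p01 p0p M0 (dd0 _ _) (vM (pi i f)) (t0 _ _) (ts i f)
       (s0 _ _) (ltW sM) dk).
    rewrite [leLHS]big_mkcond [leRHS]big_mkcond.
    by apply: ler_sum => j _; rewrite /badP; case: (b j) => //=; case: ifP => // _; rewrite powR_ge0.
  apply: (@le_trans _ _ (w0 * (5 * (D * e i) / M))).
    by apply: ler_pM; rewrite ?divr_ge0 ?(ltW M0) ?(ltW (s0 _ _))// ler_pM2r ?invr_gt0// s5.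
  by rewrite le_eqVlt; apply/orP; left; apply/eqP; field; rewrite gt_eqF.
rewrite mulr0 addr0 (_ : (M / (2 * D) < e i) = true) ?mulr1//.
rewrite ltr_pdivrMr ?mulr_gt0//; move: De; rewrite mulrAC ler_pdivlMr// mul1r.
by have := M0; set x := D * e i; rewrite mulrCA [e i * D]mulrC -/x; lra.
Qed.

Let r : R := 2 `^ (- p^-1).
Let r01 : 0 < r < 1.
Proof.
rewrite /r powR_gt0//= powRN invf_lt1 ?powR_gt0// -[ltLHS](powRr0 2).
rewrite !powR2E ltr_expR mul0r mulr_gt0// invr_gt0//.
Qed.
Definition chain_Cw : R := 2 `^ p * (1 + 4 * p) + (1 + 2 * p) + 5 / (1 - 2 `^ (- p^-1)).
Local Notation Cw := chain_Cw.

Let bad_total f : \sum_(i < k.+1) bad i f <= ((1 + 2 * p) + 5 / (1 - r)) * W * w0.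
Proof.
apply: (@le_trans _ _ (\sum_(i < k.+1) (w0 * ((M / (2 * D) < e i) && (e i < L * M / D))%:R +
  5 * w0 * (if D / M * e i < 1 then D / M * e i else 0)))).
  by apply: ler_sum => i _; apply: bad_le; rewrite -ltnS.
rewrite big_split/= -!mulr_sumr.
have D2 : 0 < 2 * D by rewrite mulr_gt0.
have := count_lev (divr_gt0 M0 D2) (divr_gt0 (mulr_gt0 LL M0) D0).
have -> : L * M / D / (M / (2 * D)) = 2 * L by field; rewrite !gt_eqF.
rewrite lnM ?posrE// => h1.
have h2 : \sum_(i < k.+1) (if D / M * e i < 1 then D / M * e i else 0) <= (1 - r)^-1.
  have eE i : D / M * e i = D / M * e 0%N * r ^+ i.
    rewrite -[RHS]mulrA; congr (_ * _).
    rewrite /r /lev addn0 -(powR_mulrn i) ?powR_ge0// -powRrM -powRD_gt0//.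
    by congr (_ `^ _); rewrite natrD; ring.
  under eq_bigr => i _ do rewrite eE.
  by apply: geom_below1 => //; rewrite mulr_ge0 ?(ltW (e0 _))// divr_ge0 ?ltW.
have h3 : 1 + Num.max 0 (p / ln 2 * (ln 2 + ln L)) <= (1 + 2 * p) * W.
  rewrite (max_idPr _); last by rewrite mulr_ge0 ?addr_ge0 ?(ltW ln20)// divr_ge0 ?ltW.
  have -> : p / ln 2 * (ln 2 + ln L) = p + p * ln L * (ln 2)^-1 by field; rewrite gt_eqF.
  have : p * ln L * (ln 2)^-1 <= p * ln L * 2.
    by rewrite ler_wpM2l ?iln2// mulr_ge0// ltW.
  by move=> h; apply: window_bound' => //; rewrite le_max lexx.
have r1 : 0 <= (1 - r)^-1 by rewrite invr_ge0 subr_ge0; case/andP: r01 => _ /ltW.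
rewrite [leRHS](_ : _ = w0 * ((1 + 2 * p) * W) + 5 * w0 * ((1 - r)^-1 * W)); last by ring.
apply: lerD; first by rewrite ler_pM2l//; apply: le_trans h1 h3.
rewrite ler_pM2l ?mulr_gt0//; apply: le_trans h2 _.
by rewrite ler_peMr.
Qed.

Let T_split i f j : T i f j `^ p <=
  2 `^ p * (if b j then v f j `^ p else 0) *
    ((good_al f j < e i) && (e i < good_be f j))%:R +
  (if b j && badP i f j then v (pi i f) j `^ p else 0).
Proof.
have rhs0 : 0 <= 2 `^ p * (if b j then v f j `^ p else 0) *
    ((good_al f j < e i) && (e i < good_be f j))%:R +
  (if b j && badP i f j then v (pi i f) j `^ p else 0).
  by rewrite addr_ge0 ?mulr_ge0 ?powR_ge0//; case: ifP => // _; rewrite powR_ge0.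
move: rhs0; rewrite /T /U; case: (b j) => /=; last by rewrite sig0 powR0.
rewrite /badP; case: (ltP (s i f)) => /= sv; last by rewrite sig0 powR0.
case: (ltP _ (sig i)) => vs; last by rewrite powR0.
case: (leP (v (pi i f) j) (2 * dd f (pi i f) j)) => vd /= rhs0; first by rewrite lerDr mulr_ge0 ?mulr_ge0 ?powR_ge0.
rewrite addr0.
have := ddv f (pi i f) j; rewrite ler_distl => /andP[lo_v up_v].
have vfpi : v (pi i f) j <= 2 * v f j by move: lo_v up_v vd; lra.
have vpif : v f j <= 2 * v (pi i f) j by move: lo_v up_v vd; lra.
have -> : (good_al f j < e i) && (e i < good_be f j).
  apply/andP; split.
    rewrite /good_al ltr_pdivrMr ?mulr_gt0 ?powR_gt0//.
    have -> : e i * (2 * L * w0 `^ p^-1) = 2 * sig i by rewrite /sig; ring.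
    by apply: le_lt_trans vpif _; rewrite ltr_pM2l.
  rewrite /good_be ltr_pdivlMr// -mulrA mulrCA -ltr_pdivrMl//.
  apply: le_lt_trans (lt_le_trans sv vfpi).
  by apply: le_trans (sDe i f); rewrite le_eqVlt; apply/orP; left; apply/eqP; ring.
rewrite mulr1 -powRM//; exact: powR_le (ltW pp) (v0 _ _) vfpi.
Qed.

(** The gain over the bound w0 for each level: a good coordinate is counted at O(W) levels only, and
    the bad ones contribute O(W w0) in all. *)
Let ww_total f : \sum_(i < k.+1) ww i f <= Cw * W * w0.
Proof.
apply: (@le_trans _ _ (2 `^ p * (1 + 4 * p) * W * w0 + ((1 + 2 * p) + 5 / (1 - r)) * W * w0)).
  apply: le_trans (lerD (lexx _) (bad_total f)).
  apply: (@le_trans _ _ (\sum_(i < k.+1) (\sum_j (2 `^ p * (if b j then v f j `^ p else 0) *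
    ((good_al f j < e i) && (e i < good_be f j))%:R) + bad i f))).
    apply: ler_sum => i _; rewrite /ww /bad [X in _ + X]big_mkcond -big_split/=.
    by apply: ler_sum => j _; exact: T_split.
  rewrite big_split/= lerD2r exchange_big/=.
  apply: (@le_trans _ _ (\sum_j 2 `^ p * (if b j then v f j `^ p else 0) * ((1 + 4 * p) * W))).
    apply: ler_sum => j _; rewrite -mulr_sumr.
    have [->|vn0] := eqVneq (v f j) 0.
      by rewrite powR0// if_same mulr0 !mul0r.
    rewrite ler_wpM2l ?good_count// ?lt_neqAle 1?eq_sym ?vn0 ?v0//.
    by rewrite mulr_ge0 ?powR_ge0//; case: ifP => // _; rewrite powR_ge0.
  rewrite -mulr_suml -mulr_sumr -big_mkcond/=.
  rewrite [leRHS](_ : _ = 2 `^ p * w0 * ((1 + 4 * p) * W)); last by ring.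
  rewrite ler_wpM2r ?ler_wpM2l ?powR_ge0 ?bv//.
  by rewrite mulr_ge0 ?(le_trans ler01 W1)// addr_ge0 ?mulr_ge0 ?(ltW pp).
by rewrite le_eqVlt; apply/orP; left; apply/eqP; rewrite /chain_Cw -/r; ring.
Qed.

Let A i f := 9 * p * w0 `^ kap * s i f * (ww i.+1 f `^ th + ww i f `^ th).

Let kap0 : 0 <= kap. Proof. by rewrite subr_ge0 lef_pV2. Qed.

Let Y0_norm f : \sum_j `|Y 0%N f j| `^ q <= (D * e 0%N * w0 `^ (1 - p^-1)) `^ q.
Proof.
set g := pi 0%N f; pose V j := if b j then v g j else 0.
have VM j : 0 <= V j <= M by rewrite /V; case: (b j); rewrite ?vM// lexx ltW.
have Vs : \sum_j V j `^ p <= w0.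
  apply: le_trans (bv g); rewrite [leRHS]big_mkcond; apply: ler_sum => j _.
  by rewrite /V; case: (b j) => //; rewrite powR0.
have De : 0 <= D * e 0%N by rewrite mulr_ge0 ?ltW.
apply: le_trans (@powR_le _ (m%:R `^ kap * (D * e 0%N) * w0 `^ th) _ _ (ltW q0) _ _); last 2 first.
- by rewrite mulr_ge0 ?powR_ge0// mulr_ge0 ?powR_ge0.
- rewrite -w0E [leRHS](_ : _ = w0 `^ kap * (D * e 0%N) * w0 `^ th); last by ring.
  by rewrite ler_wpM2r ?powR_ge0// ler_wpM2r// powR_le.
apply: le_trans (lp1_hoelder p2 p01 p0p M0 (v0 g) VM De (ltW w00) (start g) Vs).
apply: ler_sum => j _; apply: powR_le; rewrite ?(ltW q0)//.
rewrite /Y /V -/g; case: (b j); last by rewrite normr0 mulr_ge0 ?powR_ge0.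
have /andP[h1 h2] := psi_bound p2 p01 p0p (ltW (s0 0%N f)) (v0 g j).
by rewrite ger0_norm// mulr_powRB1.
Qed.

Let vec i x : 'I_m -> R := if i is i'.+1 then lo i' (F i x) else Y 0%N (F 0%N x).
Let thr i x : R := if i is i'.+1 then A i' (F i x) else D * e 0%N * w0 `^ (1 - p^-1).
(** The constant 8 is the K of [rsum_tail_lp], with r = 2^(n1 + i): one vector fails for a
    proportion of at most 2 exp (- 8 r) of the signs, which survives summation over 2^r codes. *)
Let fail (eps : {ffun 'I_m -> bool}) i x : bool :=
  (1 + 8) * (2 ^+ (n1 + i)) `^ (1 - q^-1) * thr i x < `|rsum eps (vec i x)|.

Let A0 i f : 0 <= A i f.
Proof.
rewrite /A; apply: mulr_ge0; last by rewrite addr_ge0 ?powR_ge0.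
by rewrite mulr_ge0 ?(ltW (s0 _ _))// mulr_ge0 ?powR_ge0// mulr_ge0 ?(ltW pp).
Qed.

Let fail_count i x : \sum_eps (fail eps i x)%:R <= 2 * 2 ^+ m * expR (- 8) ^+ (2 ^ (n1 + i)) :> R.
Proof.
have -> : expR (- 8) ^+ (2 ^ (n1 + i)) = expR (- (8 ^+ 2 * 2 ^+ (n1 + i) / 8)) :> R.
  by rewrite -expRM_natl natrX; congr expR; field.
apply: rsum_tail_lp.
(* The tail estimate asks for q <= 2, that is p >= 2. *)
- by rewrite q1/= ler_pdivrMr ?subr_gt0//; plra.
- case: i => [|i] /=; last exact: A0.
  by rewrite mulr_ge0 ?powR_ge0// mulr_ge0 ?(ltW (e0 _))// ltW.
- by rewrite exprn_gt0.
- by [].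
- by case: i => [|i] /=; [exact: Y0_norm|exact: lo_norm].
Qed.

Let fail_total : \sum_eps \sum_(i < k.+1) \sum_(x < 2 ^ (2 ^ (n1 + i))) (fail eps i x)%:R
  <= 2 ^+ m / 16 :> R.
Proof.
have e8 : 2 * expR (- 8) <= 128^-1 :> R.
  have e1 : expR (- 1) <= 2^-1 :> R.
    by rewrite expRN lef_pV2 ?posrE ?expR_gt0//; have := expR_ge1Dx (1 : R); lra.
  have -> : - 8 = - 1 * 8%:R :> R by ring.
  rewrite expRM_natr.
  have : expR (- 1) ^+ 8 <= 2^-1 ^+ 8 :> R by rewrite lerXn2r// nnegrE ?expR_ge0.
  by set y := expR _ ^+ 8 => h; apply: le_trans (ler_wpM2l _ h) _ => //; lra.
rewrite exchange_big/=.
apply: (@le_trans _ _ (\sum_(i < k.+1) 2 * 2 ^+ m * 128^-1 * 128^-1 ^+ i)).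
  apply: ler_sum => i _; rewrite exchange_big/=.
  apply: (@le_trans _ _ (\sum_(x < 2 ^ (2 ^ (n1 + i))) 2 * 2 ^+ m * expR (- 8) ^+ (2 ^ (n1 + i)))).
    by apply: ler_sum => x _; exact: fail_count.
  rewrite sumr_const card_ord -[_ *+ (2 ^ _)]mulr_natr natrX -!mulrA ler_pM2l//.
  rewrite ler_pM2l ?exprn_gt0// -exprMn mulrC -exprS.
  apply: (@le_trans _ _ (128^-1 ^+ (2 ^ (n1 + i)))).
    by rewrite lerXn2r ?nnegrE ?mulr_ge0 ?expR_ge0 ?invr_ge0// mulrC.
  rewrite ler_wiXn2l ?invr_ge0// ?invf_le1 ?ler1n//.
  by apply: leq_trans (ltn_expl _ (ltnSn 1)) _; rewrite leq_exp2l// leq_addl.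
rewrite -mulr_sumr.
have gs : \sum_(i < k.+1) 128^-1 ^+ i <= 2 :> R.
  have e : 1 - 128^-1 ^+ k.+1 = (1 - 128^-1) * \sum_(i < k.+1) 128^-1 ^+ i :> R.
    by rewrite -[LHS]opprB subrX1 -mulNr opprB.
  have : 0 <= 128^-1 ^+ k.+1 :> R by rewrite exprn_ge0 ?invr_ge0.
  move: e; set y := 128^-1 ^+ k.+1; set z := \sum_(_ < _) _; lra.
apply: le_trans (ler_wpM2l _ gs) _; first by rewrite !mulr_ge0 ?exprn_ge0 ?invr_ge0.
have : 0 <= 2 ^+ m :> R by rewrite exprn_ge0.
by set y := 2 ^+ m; lra.
Qed.

Let s_sum f : \sum_(i < k.+1) (s i f / e i) `^ p0 <= (24 * D) `^ p0.
Proof.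
apply: (@le_trans _ _ (\sum_(i < k.+1) 3 `^ p0 * (4 `^ p0 * (t i (c i f) / e i) `^ p0 + (D / L) `^ p0))).
  apply: ler_sum => i _.
  have -> : s i f / e i = 4 * (t i (c i f) / e i) + D / L + 0.
    by rewrite /s; field; rewrite !gt_eqF.
  apply: le_trans (powR_add3 (ltW p00) _ _ _) _ => //.
  - by rewrite mulr_ge0// divr_ge0 ?(ltW (e0 _)).
  - exact: ltW.
  - by rewrite ler_pM2l ?powR_gt0// powRM ?divr_ge0 ?(ltW (e0 _))// powR0 ?addr0// gt_eqF.
rewrite -mulr_sumr big_split/= -mulr_sumr.
have -> : 24 * D = 3 * (8 * D) by ring.
rewrite [in leRHS]powRM ?mulr_ge0 ?(ltW D0)// ler_pM2l ?powR_gt0//.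
apply: (@le_trans _ _ (4 `^ p0 * D `^ p0 + D `^ p0)).
  apply: lerD; first by rewrite ler_pM2l ?powR_gt0.
  rewrite sumr_const card_ord -mulr_natl powRM ?invr_ge0 ?(ltW D0) ?(ltW LL)//.
  rewrite powRV ?(ltW LL)// mulrCA ger_pMr ?powR_gt0// ler_pdivrMr ?powR_gt0// mul1r.
  by apply: le_trans kL _; apply: le1r_powR => //; exact: ltW.
rewrite powRM ?(ltW D0)// -[X in _ + X]mul1r -mulrDl ler_pM2r ?powR_gt0//.
have -> : 8 = 2 * 4 :> R by ring.
rewrite powRM//.
have h2 : 2 <= 2 `^ p0 :> R by apply: le1r_powR => //; [lra|exact: ltW].
have h4 : 1 <= 4 `^ p0 :> R.
  by apply: (@le_trans _ _ 4); [lra|apply: le1r_powR; [lra|exact: ltW]].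
move: h2 h4; set x := 2 `^ p0; set y := 4 `^ p0; nra.
Qed.

Let Cw1 : 1 <= Cw.
Proof.
rewrite /chain_Cw -/r; have h1 : 0 <= 5 / (1 - r).
  by rewrite divr_ge0// subr_ge0; case/andP: r01 => _ /ltW.
have h2 : 0 <= 2 `^ p * (1 + 4 * p) by rewrite mulr_ge0 ?powR_ge0// addr_ge0// mulr_ge0 ?ltW.
by move: h1 h2 p2; set x := 5 / _; set y := 2 `^ p * _; lra.
Qed.

(** Hölder's inequality over the levels, with exponent p0 for the radii s / e and its conjugate for
    the masses: the source of W^(1 - 1/p0). *)
Let mid f : \sum_(i < k) 9 / e i.+1 * A i f <= 7776 * p * Cw * D * w0 `^ (1 - p^-1) * W `^ th.
Proof.
have CW0 : 0 <= Cw * W * w0.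
  by rewrite !mulr_ge0 ?(ltW w00) ?(le_trans ler01 Cw1) ?(le_trans ler01 W1).
have x0 i : 0 <= s i f / e i.+1 by rewrite divr_ge0 ?(ltW (e0 _)) ?(ltW (s0 _ _)).
have xs : \sum_(i < k) (s i f / e i.+1) `^ p0 <= (48 * D) `^ p0.
  have -> : 48 * D = 2 * (24 * D) by ring.
  rewrite powRM ?mulr_ge0 ?(ltW D0)//; apply: le_trans (ler_wpM2l (powR_ge0 _ _) (s_sum f)).
  rewrite big_ord_recr/= mulrDr ler_wpDr ?mulr_ge0 ?powR_ge0// mulr_sumr.
  apply: ler_sum => i _.
  rewrite -powRM ?divr_ge0 ?(ltW (e0 _)) ?(ltW (s0 _ _))//.
  apply: powR_le; rewrite ?(ltW p00) ?x0//.
  have h : 1 <= 2 * e i.+1 / e i by rewrite ler_pdivlMr// mul1r.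
  rewrite ler_pdivrMr// (_ : _ * _ * e i.+1 = s i f * (2 * e i.+1 / e i)); last by ring.
  by rewrite ler_peMr// ltW.
have ysS : \sum_(i < k) ww i.+1 f <= Cw * W * w0.
  apply: le_trans (ww_total f); rewrite [leRHS]big_ord_recl/=.
  rewrite ler_wpDl//; first by case/andP: (ww0 0%N f).
have ys : \sum_(i < k) ww i f <= Cw * W * w0.
  apply: le_trans (ww_total f); rewrite [leRHS]big_ord_recr/=.
  by rewrite ler_wpDr//; case/andP: (ww0 k f).
have D48 : 0 <= 48 * D by rewrite mulr_ge0// ltW.
have w0S i : 0 <= ww i f by case/andP: (ww0 i f).
have := hoelder_sum p01 (fun i : 'I_k => x0 i) (fun i : 'I_k => w0S i.+1) D48 CW0 xs ysS.
have := hoelder_sum p01 (fun i : 'I_k => x0 i) (fun i : 'I_k => w0S i) D48 CW0 xs ys.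
set Z := 48 * D * _ => hi hiS.
have -> : \sum_(i < k) 9 / e i.+1 * A i f = 81 * p * w0 `^ kap *
   (\sum_(i < k) s i f / e i.+1 * ww i.+1 f `^ th + \sum_(i < k) s i f / e i.+1 * ww i f `^ th).
  rewrite -big_split mulr_sumr; apply: eq_bigr => i _; rewrite /A /=.
  move: (w0 `^ kap) (s i f) (ww i.+1 f `^ th) (ww i f `^ th) (e i.+1)^-1.
  by clear=> a1 a2 a3 a4 a5; ring.
have pw : 0 <= 81 * p * w0 `^ kap by rewrite !mulr_ge0 ?powR_ge0// ltW.
apply: le_trans (ler_wpM2l pw (lerD hiS hi)) _.
have Cth : Cw `^ th <= Cw by apply: ler1_powR.
have CW1 : 0 <= Cw by apply: le_trans Cw1.
have W0 : 0 <= W by apply: le_trans W1.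
rewrite /Z !powRM ?mulr_ge0 ?(ltW w00)// -w0E.
apply: (@le_trans _ _ (81 * p * w0 `^ kap * (48 * D * (Cw * W `^ th * w0 `^ th) +
  48 * D * (Cw * W `^ th * w0 `^ th)))).
  rewrite ler_wpM2l//; apply: lerD; rewrite ler_wpM2l// ler_wpM2r ?powR_ge0//.
    by rewrite ler_wpM2r ?powR_ge0.
  by rewrite ler_wpM2r ?powR_ge0.
by rewrite le_eqVlt; apply/orP; left; apply/eqP; ring.
Qed.

Let rsum_le (eps : {ffun 'I_m -> bool}) (a : 'I_m -> R) : `|rsum eps a| <= \sum_j `|a j|.
Proof.
apply: le_trans (ler_norm_sum _ _ _) _; apply: ler_sum => j _.
by rewrite normrM normrX normrN1 expr1n mul1r.
Qed.

Let telescope f j : Y k f j = Y 0%N f j + \sum_(i < k) inc i f j.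
Proof.
elim: k => [|n IH]; first by rewrite big_ord0 addr0.
by rewrite big_ord_recr/= addrA -IH /inc addrC subrK.
Qed.

Definition chain_C : R := 9 + 7776 * p * Cw + 540 * p.

Let det (eps : {ffun 'I_m -> bool}) f : (forall i x, (i <= k)%N -> (x < 2 ^ (2 ^ (n1 + i)))%N -> ~~ fail eps i x) ->
  `|rsum eps (fun j => if b j then v f j `^ p else 0)| <=
  chain_C * D * w0 `^ (1 - p^-1) * W `^ th.
Proof.
move=> nofail.
have fE i : (i <= k)%N -> `|rsum eps (vec i (c i f))| <= 9 / e i * thr i (c i f).
  move=> ik; have := nofail i (c i f) ik (c_lt i f).
  by rewrite /fail -leNgt qV eV (_ : 1 + 8 = 9 :> R)//; ring.
have thrE i : thr i.+1 (c i.+1 f) = A i f.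
  rewrite /thr /A; have h1 : c i.+1 (F i.+1 (c i.+1 f)) = c i.+1 f by exact: F_c.
  have h2 := c_nest h1.
  by rewrite /ww /T /U (s_eq h1) (s_eq h2) (pi_eq h1) (pi_eq h2).
have vecE i : vec i.+1 (c i.+1 f) = lo i f by apply: lo_eq; exact: F_c.
have vec0 : vec 0%N (c 0%N f) = Y 0%N f by apply: Y_eq; exact: F_c.
(* The start, the low increments, the high increments and the remainder. Only the first two use that
   the signs do not fail. *)
have -> : rsum eps (fun j => if b j then v f j `^ p else 0) =
   rsum eps (Y 0%N f) + \sum_(i < k) rsum eps (lo i f) +
   \sum_(i < k) rsum eps (fun j => inc i f j - lo i f j) +
   rsum eps (fun j => (if b j then v f j `^ p else 0) - Y k f j).
  rewrite /rsum ![\sum_(i < k) \sum_(j < m) _]exchange_big/= -!big_split/=.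
  apply: eq_bigr => j _; rewrite -!mulr_sumr -!mulrDr; congr (_ * _).
  by rewrite telescope big_split/= sumrN; ring.
apply: le_trans (ler_normD _ _) _; apply: le_trans (lerD (ler_normD _ _) (lexx _)) _.
apply: le_trans (lerD (lerD (ler_normD _ _) (lexx _)) (lexx _)) _.
have Wth : 1 <= W `^ th by apply: le_trans (powR_le (ltW th0) ler01 W1); rewrite powR1.
have B0 : 0 <= D * w0 `^ (1 - p^-1) by rewrite mulr_ge0 ?powR_ge0// ltW.
have b1 : `|rsum eps (Y 0%N f)| <= 9 * D * w0 `^ (1 - p^-1).
  rewrite -vec0; apply: le_trans (fE 0%N isT) _ => /=.
  by rewrite le_eqVlt; apply/orP; left; apply/eqP; field; rewrite gt_eqF.
have b2 : `|\sum_(i < k) rsum eps (lo i f)| <= 7776 * p * Cw * D * w0 `^ (1 - p^-1) * W `^ th.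
  apply: le_trans (ler_norm_sum _ _ _) _; apply: le_trans (mid f).
  by apply: ler_sum => i _; rewrite -vecE -thrE; apply: fE.
have b3 : `|\sum_(i < k) rsum eps (fun j => inc i f j - lo i f j)| <=
    360 * p * D * w0 `^ (1 - p^-1).
  apply: le_trans (ler_norm_sum _ _ _) _.
  apply: (@le_trans _ _ (\sum_(i < k) 360 * p * D * w0 `^ (1 - p^-1) / L)).
    by apply: ler_sum => i _; apply: le_trans (rsum_le _ _) _; exact: hi_l1.
  rewrite sumr_const card_ord -[_ *+ k]mulr_natr -[X in X <= _]mulrA; apply: ler_piMr.
    apply: mulr_ge0; [apply: mulr_ge0; [apply: mulr_ge0|]|exact: powR_ge0].
    - exact: ler0n.
    - exact: ltW.
    - exact: ltW.
  by rewrite mulrC ler_pdivrMr// mul1r; apply: le_trans kL; rewrite ler_nat leqnSn.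
have b4 := le_trans (rsum_le eps _) (last_l1 f).
apply: le_trans (lerD (lerD (lerD b1 b2) b3) b4) _.
have B1 : D * w0 `^ (1 - p^-1) <= D * w0 `^ (1 - p^-1) * W `^ th by rewrite ler_peMr.
set B := D * w0 `^ (1 - p^-1) in B0 B1.
have e1 : 9 * D * w0 `^ (1 - p^-1) + 7776 * p * Cw * D * w0 `^ (1 - p^-1) * W `^ th +
    360 * p * D * w0 `^ (1 - p^-1) + 180 * p * D * w0 `^ (1 - p^-1) =
    (9 + 540 * p) * B + 7776 * p * Cw * (B * W `^ th) by rewrite /B; ring.
have e2 : chain_C * D * w0 `^ (1 - p^-1) * W `^ th =
    (9 + 540 * p) * (B * W `^ th) + 7776 * p * Cw * (B * W `^ th).
  by rewrite /B /chain_C; ring.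
rewrite e1 e2 lerD2r; apply: ler_wpM2l; last exact: B1.
by apply: addr_ge0; [exact: ler0n|apply: mulr_ge0; [exact: ler0n|exact: ltW]].
Qed.

Lemma chain_signs : \sum_(eps : {ffun 'I_m -> bool})
   `[< exists f, chain_C * D * w0 `^ (1 - p^-1) * W `^ th <
        `|rsum eps (fun j => if b j then v f j `^ p else 0)| >]%:R <= 2 ^+ m / 16 :> R.
Proof.
apply: le_trans fail_total; apply: ler_sum => eps _; case: asboolP => [[f fc]|_]; last first.
  by apply: sumr_ge0 => i _; apply: sumr_ge0.
apply: contrapT => /negP; rewrite -ltNge => lt1.
move: fc; rewrite ltNge => /negP; apply; apply: det => i x ik xN.
apply/negP => Fx; move: lt1; rewrite ltNge => /negP; apply.
have ik' : (i < k.+1)%N by rewrite ltnS.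
rewrite (bigD1 (Ordinal ik'))//= (bigD1 (Ordinal xN))//= Fx -addrA lerDl.
by rewrite addr_ge0// ?sumr_ge0// => j _; apply: sumr_ge0.
Qed.

End Chain.

(** * Independence and restarts *)

Section Mixing.
Context {d d' : measure_display} {W : measurableType d} {Omega : measurableType d'}
  {R : realType} (P : probability W R) (m : nat) (xi : 'I_m -> {RV P >-> Omega}).

Definition box (B : 'I_m -> set Omega) : set (m.-tuple Omega) :=
  [set x | forall j, B j (tnth x j)].

Definition xit (w : W) : m.-tuple Omega := [tuple xi j w | j < m].

Definition mix (J : {set 'I_m}) (z : W * W) : m.-tuple Omega :=
  [tuple (if j \in J then xi j z.1 else xi j z.2) | j < m].

Definition mixt (J : {set 'I_m}) (x y : m.-tuple Omega) : m.-tuple Omega :=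
  [tuple (if j \in J then tnth x j else tnth y j) | j < m].

Lemma mixE J w w' : mix J (w, w') = mixt J (xit w) (xit w').
Proof. by apply: eq_from_tnth => j; rewrite !tnth_mktuple. Qed.

Lemma measurable_xit : measurable_fun setT xit.
Proof.
apply/measurable_fun_tnthP => i; rewrite (_ : _ \o _ = xi i)//.
by apply/funext => w /=; rewrite tnth_mktuple.
Qed.

Lemma measurable_mix J : measurable_fun setT (mix J).
Proof.
apply/measurable_fun_tnthP => i.
rewrite (_ : _ \o _ = if i \in J then xi i \o fst else xi i \o snd).
  by case: (i \in J); apply: measurableT_comp.
by apply/funext => z /=; rewrite tnth_mktuple; case: (i \in J).
Qed.

(** Boxes form a pi-system that generates the product sigma-algebra. *)
Lemma box_unique (m1 m2 : {measure set (m.-tuple Omega) -> \bar R}) :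
  (m1 setT < +oo)%E ->
  (forall B, (forall j, measurable (B j)) -> m1 (box B) = m2 (box B)) ->
  forall A, measurable A -> m1 A = m2 A.
Proof.
move=> m1oo mB.
pose G : set (set (m.-tuple Omega)) :=
  [set A | exists2 B, (forall j, measurable (B j)) & A = box B].
have GT : G setT.
  by exists (fun=> setT) => //; apply/seteqP; split.
have boxE B : box B = \bigcap_(j in [set: 'I_m]) ((@tnth _ _ ^~ j) @^-1` B j).
  by apply/seteqP; split => x /= h j; [move=> _; exact: h|exact: h].
apply: (measure_unique G (fun=> setT)) => //.
- apply/seteqP; split.
    apply: smallest_sub; first exact: smallest_sigma_algebra.
    rewrite -bigcup_seq; apply: bigcup_sub => i _ A [C mC <-].
    apply: sub_sigma_algebra; exists (fun j => if j == i then C else setT).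
      by move=> j; case: ifP.
    rewrite setTI; apply/seteqP; split => x /= h.
      by move=> j; case: eqP => [->|].
    by have := h i; rewrite eqxx.
  apply: smallest_sub; first exact: sigma_algebra_measurable.
  move=> A [B mB' ->]; rewrite boxE; apply: fin_bigcap_measurable => // j _.
  by rewrite -[X in measurable X]setTI; apply: measurable_tnth.
- move=> A1 A2 [B1 m1' ->] [B2 m2' ->]; exists (fun j => B1 j `&` B2 j).
    by move=> j; exact: measurableI.
  by apply/seteqP; split => x /=; [move=> [h1 h2] j; split|move=> h; split=> j; case: (h j)].
- by rewrite bigcup_const//; exists 0%N.
- by move=> A [B mB' ->]; exact: mB.
Qed.

Hypothesis ind : independent_family xi.

Lemma independent_box (J : {set 'I_m}) (B : 'I_m -> set Omega) :
  (forall j, measurable (B j)) ->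
  P [set w | forall j, j \in J -> B j (xi j w)] =
  (\big[*%E/1%E]_(j in J) P (xi j @^-1` B j))%E.
Proof.
move=> mB; by rewrite -(ind _ mB); congr (P _).
Qed.

(** By independence both tuples give a box the same product of probabilities. This exchange of
    coordinates with an independent copy serves three ends: independence of events on disjoint
    coordinates, symmetrization, and decoupling of one large entry from the others. *)
Lemma mix_law J (f : m.-tuple Omega -> \bar R) : measurable_fun setT f ->
  (forall x, 0 <= f x)%E ->
  (\int[P]_w f (xit w) = \int[P]_w \int[P]_w' f (mix J (w, w')))%E.
Proof.
move=> mf f0.
pose Q := (P \x P)%E.
have law A : measurable A -> pushforward P xit A = pushforward Q (mix J) A.
  apply: box_unique; [exact: measurable_xit|exact: measurable_mix|move=> mx|move=> mx mm B mB].
    by rewrite /= /pushforward [X in P X](_ : _ = setT)// probability_setT ltry.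
  rewrite /= /pushforward.
  have -> : xit @^-1` box B = [set w | forall j, j \in [set: 'I_m]%SET -> B j (xi j w)].
    apply/seteqP; split => w /= h j.
      by move=> _; have := h j; rewrite tnth_mktuple.
    by rewrite tnth_mktuple; apply: h; rewrite finset.in_setT.
  have -> : mix J @^-1` box B = [set w | forall j, j \in J -> B j (xi j w)] `*`
      [set w | forall j, j \in (~: J)%SET -> B j (xi j w)].
    apply/seteqP; split => -[w w'] /=.
      move=> h; split => j jJ; have := h j; rewrite tnth_mktuple.
        by rewrite jJ.
      by move: jJ; rewrite finset.in_setC => /negbTE ->.
    move=> [h1 h2] j; rewrite tnth_mktuple; case: ifPn => jJ; first exact: h1.
    by apply: h2; rewrite finset.in_setC.
  have mK (K : {set 'I_m}) : measurable [set w | forall j, j \in K -> B j (xi j w)].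
    rewrite (_ : [set w | _] = \bigcap_(j in [set` K]) (xi j @^-1` B j)).
      apply: fin_bigcap_measurable => // j _; rewrite -[X in measurable X]setTI.
      exact: measurable_funP.
    by apply/seteqP; split => w /= h j jJ; exact: h.
  rewrite /Q product_measure1E//.
  rewrite (independent_box [set: _]%SET mB).
  transitivity ((\prod_(j in J) P (xi j @^-1` B j)) *
    (\prod_(j in (~: J)%SET) P (xi j @^-1` B j)))%E; last first.
    by congr (_ * _)%E; exact/esym/independent_box.
  rewrite (bigID (mem J))/=; congr (_ * _)%E; apply: eq_bigl => j.
    by rewrite finset.in_setT.
  by rewrite finset.in_setT finset.in_setC.
have -> : (\int[P]_w f (xit w) = \int[pushforward P xit]_x f x)%E.
  rewrite ge0_integral_pushforward//; last exact: measurable_xit.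
have -> : (\int[P]_w \int[P]_w' f (mix J (w, w')) = \int[pushforward Q (mix J)]_x f x)%E.
  rewrite ge0_integral_pushforward//; last exact: measurable_mix.
  rewrite preimage_setT fubini_tonelli1//.
    by apply: measurableT_comp => //; exact: measurable_mix.
  by move=> z; exact: f0.
apply: eq_measure_integral; [exact: measurable_mix|exact: measurable_xit|].
by move=> mm mx A mA _; exact: law.
Qed.

End Mixing.

Section Blocks.
Context {d d' : measure_display} {W : measurableType d} {Omega : measurableType d'}
  {R : realType} (P : probability W R) (m : nat) (xi : 'I_m -> {RV P >-> Omega}).
Hypothesis ind : independent_family xi.

Definition coord_in (J : {set 'I_m}) (A : set (m.-tuple Omega)) : Prop :=
  forall x y, (forall j, j \in J -> tnth x j = tnth y j) -> A x -> A y.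

Definition Pt (A : set (m.-tuple Omega)) : R := fine (P (xit xi @^-1` A)).

Lemma measurable_xit_preimage A : measurable A -> measurable (xit xi @^-1` A).
Proof.
by move=> mA; rewrite -[X in measurable X]setTI; apply: measurable_xit.
Qed.

Lemma PtE A : measurable A -> P (xit xi @^-1` A) = (Pt A)%:E.
Proof.
by move=> mA; rewrite /Pt fineK// fin_num_measure//; exact: measurable_xit_preimage.
Qed.

Lemma Pt_ge0 A : 0 <= Pt A. Proof. by rewrite /Pt fine_ge0. Qed.

Lemma Pt_le A B : measurable A -> measurable B -> A `<=` B -> Pt A <= Pt B.
Proof.
move=> mA mB AB; rewrite -lee_fin -!PtE//; apply: le_measure.
- by rewrite inE; exact: measurable_xit_preimage.
- by rewrite inE; exact: measurable_xit_preimage.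
- by move=> w; exact: AB.
Qed.

Lemma Pt_setT : Pt setT = 1.
Proof. by rewrite /Pt preimage_setT probability_setT. Qed.

Lemma Pt_setC A : measurable A -> Pt (~` A) = 1 - Pt A.
Proof.
move=> mA; apply/EFin_inj; rewrite -PtE; last exact: measurableC.
by rewrite preimage_setC probability_setC ?PtE//; exact: measurable_xit_preimage.
Qed.

Lemma Pt_setD A B : measurable A -> measurable B -> B `<=` A -> Pt (A `\` B) = Pt A - Pt B.
Proof.
move=> mA mB BA; apply/EFin_inj; rewrite -PtE; last exact: measurableD.
have mA' := measurable_xit_preimage mA; have mB' := measurable_xit_preimage mB.
rewrite (_ : _ @^-1` _ = (xit xi @^-1` A) `\` (xit xi @^-1` B))//.
rewrite measureD//; last by rewrite -ge0_fin_numE// fin_num_measure.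
rewrite EFinB -!PtE//; congr (_ - P _)%E; apply/seteqP; split => w /=; first by case.
by move=> h; split => //; exact: BA.
Qed.

(** On the mixed tuple, [A] sees only the first sample and [B] only the second, so the double
    integral factorizes. *)
Lemma Pt_indep J A B : measurable A -> measurable B ->
  coord_in J A -> coord_in (~: J)%SET B -> Pt (A `&` B) = Pt A * Pt B.
Proof.
move=> mA mB cA cB; apply/EFin_inj; rewrite -PtE; last exact: measurableI.
have mAB := measurableI _ _ mA mB.
have iE (C : set (m.-tuple Omega)) : measurable C ->
    P (xit xi @^-1` C) = (\int[P]_w (\1_C (xit xi w))%:E)%E.
  move=> mC; rewrite -[X in P X]setIT -integral_indic//; exact: measurable_xit_preimage.
rewrite iE// (@mix_law _ _ _ _ _ P m xi ind J (EFin \o \1_(A `&` B)))/=; last 2 first.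
- by apply/measurable_EFinP; apply: measurable_indic.
- by move=> x; rewrite lee_fin.
have e w w' : \1_(A `&` B) (mix xi J (w, w')) = \1_A (xit xi w) * \1_B (xit xi w') :> R.
  rewrite mixE !indicE -natrM mulnb; congr (_ %:R); congr nat_of_bool.
  have jN j : j \in (~: J)%SET -> (j \in J) = false by rewrite finset.in_setC => /negbTE.
  rewrite in_setI; congr (_ && _); apply/idP/idP; rewrite !inE.
  - by apply: cA => j jJ; rewrite [tnth (mixt _ _ _) _]tnth_mktuple jJ.
  - by apply: cA => j jJ; rewrite [tnth (mixt _ _ _) _]tnth_mktuple jJ.
  - by apply: cB => j jJ; rewrite [tnth (mixt _ _ _) _]tnth_mktuple jN.
  - by apply: cB => j jJ; rewrite [tnth (mixt _ _ _) _]tnth_mktuple jN.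
under eq_integral => w _.
  under eq_integral => w' _ do rewrite e EFinM.
  rewrite ge0_integralZl//; last first.
    apply/measurable_EFinP; apply: measurableT_comp; last exact: measurable_xit.
    exact: measurable_indic.
  rewrite -iE// PtE//; over.
rewrite ge0_integralZr//; last 2 first.
- apply/measurable_EFinP; apply: measurableT_comp; last exact: measurable_xit.
  exact: measurable_indic.
- by rewrite lee_fin Pt_ge0.
by rewrite -iE// PtE// EFinM.
Qed.

End Blocks.

Section Abel.
Context {R : realType}.

(** Summation by parts: nonnegative decreasing weights carry F <= G over to the weighted sums of
    increments. *)
Lemma abel_le (F G phi : nat -> R) n : F 0%N = G 0%N -> (forall k, F k <= G k) ->
  (forall k, phi k.+1 <= phi k) -> (forall k, 0 <= phi k) ->
  \sum_(k < n) (F k.+1 - F k) * phi k.+1 <= \sum_(k < n) (G k.+1 - G k) * phi k.+1.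
Proof.
move=> F0 FG phiS phi0; rewrite -subr_ge0 -sumrB.
suff H : (G n - F n) * phi n <= \sum_(k < n) ((G k.+1 - G k) * phi k.+1 - (F k.+1 - F k) * phi k.+1).
  by apply: le_trans H; rewrite mulr_ge0// subr_ge0.
elim: n => [|n IH]; first by rewrite F0 subrr mul0r big_ord0.
rewrite big_ord_recr/=; apply: le_trans (lerD IH (lexx _)).
have := mulr_ge0 (_ : 0 <= G n - F n) (_ : 0 <= phi n - phi n.+1).
rewrite !subr_ge0 => /(_ (FG n) (phiS n)); lra.
Qed.

(** A rectangle of height y^l lies below the graph of u^l on [y, x]. Summed in telescoping form,
    this produces the factorial in [runs_tail]. *)
Lemma mul_powerB_le (x y : R) l : 0 <= y -> y <= x ->
  (x - y) * y ^+ l <= (x ^+ l.+1 - y ^+ l.+1) / l.+1%:R.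
Proof.
move=> y0 yx; have x0 := le_trans y0 yx.
rewrite subrXX -mulrA ler_wpM2l ?subr_ge0// ler_pdivlMr ?ltr0n//.
rewrite mulr_natr -[X in _ *+ X](card_ord l.+1) -sumr_const; apply: ler_sum => i _.
have il : (i <= l)%N by rewrite -ltnS.
rewrite -{1}(subnK il) exprD /=; apply: ler_pM; rewrite ?exprn_ge0//.
by rewrite lerXn2r.
Qed.

End Abel.

Lemma measurable_poweR_comp {d : measure_display} {T : measurableType d} {R : realType}
  (f : T -> \bar R) (q : R) :
  measurable_fun setT f -> measurable_fun setT (fun x => (f x `^ q)%E).
Proof. by move=> mf; exact: (measurableT_comp (measurable_poweR q) mf). Qed.

Section PoissonMoment.
Context {R : realType}.

Lemma exp_partial (x : R) n : 0 <= x -> \sum_(l < n) x ^+ l / l`!%:R <= expR x.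
Proof.
move=> x0; apply: (@le_trans _ _ (series (exp_coeff x) n)).
  by rewrite /series/= big_mkord.
apply: nondecreasing_cvgn_le; last exact: is_cvg_series_exp_coeff.
by apply: nondecreasing_series => k _ _; exact: exp_coeff_ge0.
Qed.

Definition poisson_const (q : R) : R := expR (expR 1) * (q / (1 + ln q)).

Lemma ln_add1_le (q : R) : 0 < q -> 1 + ln q <= q.
Proof.
by move=> q1; have := @le_ln1Dx R (q - 1); rewrite [1 + (q - 1)]addrC subrK ltrBrDl subrr => /(_ q1); lra.
Qed.

Lemma poisson_const_ge1 (q : R) : 1 <= q -> 1 <= poisson_const q.
Proof.
move=> q1; have s1 : 1 <= 1 + ln q by rewrite lerDl ln_ge0.
have h : 1 <= q / (1 + ln q).
  by rewrite ler_pdivlMr ?mul1r ?ln_add1_le// (lt_le_trans ltr01).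
by rewrite -[leLHS]mulr1; apply: ler_pM => //; apply: le_trans (expR_ge1Dx _); rewrite lerDl expR_ge0.
Qed.

(** With s = 1 + ln q, the inequality 1 + ln u <= u at u = s (l + 1) / q gives (l + 1)^q <= (q /
    s)^q exp (s (l + 1) - q). Since e^s = e q, the sum over [l] costs exp (e q), and the leftover
    exp (s - q) is at most 1. This is the origin of e^e in [poisson_const]. *)
Lemma poisson_moment (q : R) n : 1 <= q ->
  \sum_(l < n) l.+1%:R `^ q / l`!%:R <= poisson_const q `^ q.
Proof.
move=> q1; have q0 : 0 < q by lra.
set s := 1 + ln q; have s1 : 1 <= s by rewrite lerDl ln_ge0.
have s0 : 0 < s by lra.
have sq : s <= q by exact: ln_add1_le.
have es : expR s = expR 1 * q by rewrite expRD lnK.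
have pw (l : nat) : l.+1%:R `^ q <= (q / s) `^ q * expR (s * l.+1%:R - q).
  have -> : l.+1%:R = (q / s) * (s * l.+1%:R / q) :> R.
    by field; rewrite !gt_eqF.
  rewrite powRM ?divr_ge0 ?mulr_ge0 ?ler0n ?(ltW s0) ?(ltW q0)//.
  apply: ler_wpM2l; first exact: powR_ge0.
  have u0 : 0 < s * l.+1%:R / q by rewrite divr_gt0 ?mulr_gt0.
  rewrite /powR (gt_eqF u0) ler_expR.
  have := ln_add1_le u0; set u := _ / q in u0 *.
  have -> : s * (q / s * u) = q * u by field; rewrite gt_eqF.
  nra.
apply: (@le_trans _ _ ((q / s) `^ q * expR (s - q) * \sum_(l < n) (expR s) ^+ l / l`!%:R)).
  rewrite mulr_sumr; apply: ler_sum => l _; rewrite [leRHS]mulrA ler_wpM2r ?invr_ge0//.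
  apply: le_trans (pw l) _; rewrite -!mulrA ler_wpM2l ?powR_ge0//.
  rewrite -expRM_natr -expRD -natr1 ler_expR mulrDr mulr1; lra.
apply: (@le_trans _ _ ((q / s) `^ q * expR (s - q) * expR (expR s))).
  by rewrite ler_wpM2l ?mulr_ge0 ?powR_ge0 ?expR_ge0// exp_partial// expR_ge0.
rewrite /poisson_const -/s [leRHS]powRM ?expR_ge0 ?divr_ge0 ?(ltW s0) ?(ltW q0)//.
rewrite [leRHS]mulrC -mulrA ler_wpM2l ?powR_ge0// -expRD.
by rewrite -expRM ler_expR es; lra.
Qed.

End PoissonMoment.

Section Restart.
Context {d d' : measure_display} {W : measurableType d} {Omega : measurableType d'}
  {R : realType} (P : probability W R) (m : nat) (xi : 'I_m -> {RV P >-> Omega}).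
Hypothesis ind : independent_family xi.
Variable B : nat -> nat -> set (m.-tuple Omega).

Local Notation Pt := (Pt xi).

Definition interval (a b : nat) : {set 'I_m} := [set j : 'I_m | (a <= j < b)%N]%SET.

Hypotheses (mB : forall a b, measurable (B a b))
  (cB : forall a b, coord_in (interval a b) (B a b))
  (monoB : forall a b a' b', (a' <= a)%N -> (b <= b')%N -> B a b `<=` B a' b')
  (B0 : forall a, B a a = set0)
  (Bm : Pt (B 0%N m) <= 4^-1).

(** Each block starts exactly where the preceding one ends. As [B] grows with its interval, this is
    as general as disjoint blocks with gaps between them. *)
Fixpoint runs (l a : nat) : set (m.-tuple Omega) :=
  if l is l'.+1 then \bigcup_(k < m.+1) (if (a < k)%N then B a k `&` runs l' k else set0)
  else setT.

Lemma runsP l a x : runs l.+1 a x <-> exists k, [/\ (a < k <= m)%N, B a k x & runs l k x].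
Proof.
split=> /=.
  by move=> [k /= km]; case: ltnP => // ak [h1 h2]; exists k; split => //; rewrite ak.
by move=> [k [/andP[ak km] h1 h2]]; exists k => //=; rewrite ak.
Qed.

Lemma measurable_runs l a : measurable (runs l a).
Proof.
elim: l a => [|l IH] a /=; first exact: measurableT.
apply: bigcup_measurable => k _; case: ifP => _ //.
by apply: measurableI.
Qed.

Lemma runs_anti l a a' : (a <= a')%N -> runs l a' `<=` runs l a.
Proof.
elim: l a a' => [//|l IH] a a' aa x /runsP[k [/andP[ak km] h1 h2]].
apply/runsP; exists k; split => //; first by rewrite (leq_ltn_trans aa ak) km.
exact: monoB h1.
Qed.

Lemma coord_runs l a : coord_in (interval a m) (runs l a).
Proof.
elim: l a => [//|l IH] a x y xy /runsP[k [/andP[ak km] h1 h2]]; apply/runsP.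
exists k; split => //; first by rewrite ak km.
  apply: cB h1 => j; rewrite inE => /andP[aj jk]; apply: xy.
  by rewrite inE aj (leq_trans jk km).
apply: IH h2 => j; rewrite inE => /andP[kj jm]; apply: xy.
by rewrite inE jm (leq_trans (ltnW ak) kj).
Qed.

Let s a k : R := 1 - Pt (B a k).

Let s_bound a k : (k <= m)%N -> 3 / 4 <= s a k.
Proof.
move=> km; have : Pt (B a k) <= 4^-1.
  by apply: le_trans Bm; apply: Pt_le => //; exact: monoB.
by rewrite /s; lra.
Qed.

Let s_gt0 a k : (k <= m)%N -> 0 < s a k.
Proof. by move=> /(s_bound a); apply: lt_le_trans. Qed.

Let s_le1 a k : s a k <= 1. Proof. by rewrite /s lerBlDr lerDl Pt_ge0. Qed.

Let s_mul a k : (a <= k <= m)%N -> s a m <= s a k * s k m.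
Proof.
move=> /andP[ak km]; rewrite /s -!Pt_setC//.
rewrite -(Pt_indep ind (J := interval a k)); try exact: measurableC.
- apply: Pt_le; [exact: measurableC|by apply: measurableI; exact: measurableC|].
  by move=> x /= nB; split => h; apply: nB; apply: monoB h.
- move=> x y xy nB By; apply: nB; apply: cB By => j jI; apply/esym; exact: xy.
- move=> x y xy nB By; apply: nB; apply: cB By => j jI; apply/esym; apply: xy.
  move: jI; rewrite finset.in_setC !inE => /andP[kj _]; apply/negP => /andP[_].
  by rewrite ltnNge kj.
Qed.

Let lam a : R := - ln (s a m).

Let lam_ge0 a : 0 <= lam a.
Proof. by rewrite oppr_ge0 ln_le0. Qed.

Let lam_anti a k : (a <= k <= m)%N -> 1 - s a k <= lam a - lam k.
Proof.
move=> akm; have /andP[ak km] := akm.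
have h : ln (s a m) <= ln (s a k) + ln (s k m).
  rewrite -lnM ?posrE ?s_gt0//; rewrite ler_ln ?posrE ?mulr_gt0 ?s_gt0//.
  exact: s_mul.
have := @le_ln1Dx R (s a k - 1).
have -> : 1 + (s a k - 1) = s a k by ring.
rewrite ltrBrDr addNr s_gt0// => /(_ isT).
by move: h; rewrite /lam; lra.
Qed.

(* The number of restarts has the tail of a Poisson variable: the hazards
   [- ln s] are superadditive because a bad block stays bad when enlarged. *)
Lemma runs_tail l a : (a <= m)%N -> Pt (runs l a) <= lam a ^+ l / l`!%:R.
Proof.
elim: l a => [|l IH] a am; first by rewrite /= Pt_setT expr0 fact0 divr1.
(* The first block started at [a] turns bad precisely with its coordinate a + k; the other blocks
   live on the later coordinates, which are independent of it. *)
pose E k := (B a (a + k).+1 `\` B a (a + k)) `&` runs l (a + k).+1.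
have mE k : measurable (E k).
  apply: measurableI; last exact: measurable_runs.
  exact: measurableD.
have sub : runs l.+1 a `<=` \bigcup_(k < (m - a)%N) E k.
  move=> x /runsP[k0 [/andP[ak0 k0m] h1 h2]].
  have ex : exists k, (k0 <= m)%N && `[< B a (a + k).+1 x >].
    exists (k0 - a).-1; rewrite k0m; apply/asboolP; apply: monoB h1 => //.
    by rewrite -addnS prednK ?subn_gt0// subnKC// ltnW.
  case: (ex_minnP ex) => k /andP[_ /asboolP Bk] kmin.
  have kk0 : (k <= (k0 - a).-1)%N.
    apply: kmin; rewrite k0m; apply/asboolP; apply: monoB h1 => //.
    by rewrite -addnS prednK ?subn_gt0// subnKC// ltnW.
  have k1 : ((a + k).+1 <= k0)%N.
    by rewrite -ltn_subRL; apply: leq_ltn_trans kk0 _; rewrite ltn_predL subn_gt0.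
  exists k => /=; first by rewrite ltn_subRL (leq_trans k1 k0m).
  split; last exact: runs_anti h2.
  split=> //; case: k Bk kmin kk0 k1 => [|k] Bk kmin kk0 k1; first by rewrite addn0 B0.
  move=> Bk'; have /kmin : (k0 <= m)%N && `[< B a (a + k).+1 x >].
    by rewrite k0m; apply/asboolP; rewrite -addnS.
  by rewrite ltnn.
have Pb : Pt (runs l.+1 a) <= \sum_(k < m - a) Pt (E k).
  rewrite -lee_fin -PtE; last exact: measurable_runs.
  apply: (@le_trans _ _ (\sum_(k < m - a) P (xit xi @^-1` E k))%E); last first.
    by rewrite -sumEFin; apply: lee_sum => k _; rewrite PtE.
  apply: (@le_trans _ _ (P (\big[setU/set0]_(k < m - a) (xit xi @^-1` E k)))).
    apply: le_measure; rewrite ?inE.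
    - by apply: measurable_xit_preimage; exact: measurable_runs.
    - by apply: bigsetU_measurable => k _; exact: measurable_xit_preimage.
    - rewrite -(bigcup_mkord (m - a) (fun k => xit xi @^-1` E k)).
      by move=> w /sub[k /= km h]; exists k.
  exact: (@Boole_inequality _ R W P (fun k => xit xi @^-1` E k) _
    (fun k _ => measurable_xit_preimage xi (mE k))).
apply: le_trans Pb _.
have PE (k : 'I_(m - a)) : Pt (E k) <=
    ((1 - s a (a + k).+1) - (1 - s a (a + k))) * (lam (a + k).+1 ^+ l / l`!%:R).
  have km : ((a + k).+1 <= m)%N by rewrite -ltn_subRL.
  rewrite /E (Pt_indep ind (J := interval a (a + k).+1)).
  - rewrite Pt_setD//; last by apply: monoB.
    rewrite /s !subKr; apply: ler_wpM2l; last exact: IH.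
    by rewrite subr_ge0 Pt_le//; apply: monoB.
  - exact: measurableD.
  - exact: measurable_runs.
  - move=> x y xy [h1 h2]; split; first exact: cB h1.
    move=> h; apply: h2; apply: cB h => j; rewrite inE => /andP[aj jk].
    by apply/esym; apply: xy; rewrite inE aj (leq_trans jk).
  - move=> x y xy; apply: coord_runs => j; rewrite inE => /andP[kj jm]; apply: xy.
    by rewrite finset.in_setC inE negb_and -!ltnNge ltnS kj orbT.
apply: le_trans (ler_sum _ (fun k _ => PE k)) _.
(* Clipping at [m] extends the hazards monotonically to all indices, as the summation by parts
   requires. *)
pose cl k := minn (a + k) m.
pose F k := 1 - s a (cl k); pose G k := lam a - lam (cl k).
pose phi k := lam (cl k) ^+ l / l`!%:R.
have clm k : (cl k <= m)%N by rewrite geq_minr.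
have acl k : (a <= cl k)%N by rewrite leq_min leq_addr am.
have lamS b c : (b <= c <= m)%N -> lam c <= lam b.
  move=> bc; have := lam_anti bc; have := s_le1 b c; lra.
have clS k : (cl k <= cl k.+1 <= m)%N.
  by rewrite clm andbT leq_min clm andbT geq_min addnS leqnSn.
have phiS k : phi k.+1 <= phi k.
  by rewrite ler_wpM2r ?invr_ge0// lerXn2r ?nnegrE ?lam_ge0// lamS.
have phi0 k : 0 <= phi k by rewrite divr_ge0// exprn_ge0.
have F0 : F 0%N = G 0%N.
  by rewrite /F /G /cl addn0 (minn_idPl am) subrr /s B0 /Pt preimage_set0 measure0 subr0 subrr.
have FG k : F k <= G k by apply: lam_anti; rewrite acl clm.
apply: (@le_trans _ _ (\sum_(k < m - a) (F k.+1 - F k) * phi k.+1)).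
  apply: ler_sum => k _; have km : ((a + k).+1 <= m)%N by rewrite -ltn_subRL.
  by rewrite /F /phi /cl addnS (minn_idPl km) (minn_idPl (ltnW km)).
apply: le_trans (abel_le (m - a) F0 FG phiS phi0) _.
have tel n : \sum_(k < n) (G k.+1 - G k) * phi k.+1 <= (lam a ^+ l.+1 - lam (cl n) ^+ l.+1) / l.+1`!%:R.
  elim: n => [|n IHn]; first by rewrite big_ord0 /cl addn0 (minn_idPl am) subrr mul0r.
  rewrite big_ord_recr/=; apply: le_trans (lerD IHn (lexx _)) _.
  have h := @mul_powerB_le R (lam (cl n)) (lam (cl n.+1)) l (lam_ge0 _) (lamS _ _ (clS n)).
  have f0 : 0 <= l`!%:R^-1 :> R by rewrite invr_ge0.
  have := ler_wpM2r f0 h.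
  rewrite factS natrM invfM /G /phi.
  by set x := lam (cl n.+1) ^+ l; set y := l`!%:R^-1; set z := l.+1%:R^-1;
    set u := lam (cl n) ^+ _; set v := lam (cl n.+1) ^+ l.+1; nra.
apply: le_trans (tel _) _.
by rewrite ler_pM2r ?invr_gt0 ?ltr0n ?fact_gt0// gerBl exprn_ge0.
Qed.

Lemma runs_empty a l : (m < a + l)%N -> (a <= m)%N -> runs l a = set0.
Proof.
elim: l a => [|l IH] a; first by rewrite addn0 ltnNge => /negbTE ->.
move=> ml am; apply/seteqP; split => // x /runsP[k [/andP[ak km] _]].
by rewrite IH// (leq_trans ml)// addnS -addSn leq_add2r.
Qed.

Lemma runs_tail_fact l : Pt (runs l 0%N) <= l`!%:R^-1.
Proof.
apply: le_trans (runs_tail l (leq0n m)) _.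
rewrite ler_piMl ?invr_ge0// exprn_ile1 ?lam_ge0//.
have s34 := s_bound 0%N (leqnn m).
rewrite /lam -lnV ?posrE ?s_gt0// -(expRK 1) ler_ln ?posrE ?expR_gt0 ?invr_gt0 ?s_gt0//.
apply: (@le_trans _ _ (1 + 1)); last exact: expR_ge1Dx.
by rewrite -[leLHS]mul1r ler_pdivrMr ?s_gt0//; lra.
Qed.

Lemma runs_moment (f : m.-tuple Omega -> \bar R) (A q : R) : measurable_fun setT f ->
  (forall x, 0 <= f x)%E -> 0 <= A -> 1 <= q ->
  (forall l x, ~ runs l.+1 0 x -> (f x <= (l.+1%:R * A)%:E)%E) ->
  (\int[P]_w (f (xit xi w) `^ q) <= ((poisson_const q * A) `^ q)%:E)%E.
Proof.
move=> mf f0 A0 q1 fr; have q0 : 0 <= q by lra.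
pose c l : R := (l.+1%:R * A) `^ q.
have mx := measurable_xit xi.
have pw w : (f (xit xi w) `^ q <=
    \sum_(l <- iota 0 m.+1) (c l)%:E * (\1_(runs l 0) (xit xi w))%:E)%E.
  set x := xit xi w.
  (* The least such [l] places the sample in [runs l 0], where f <= (l + 1) A. Disjoint nonempty
     blocks number at most [m], so a finite sum of indicators dominates the moment. *)
  have ex : exists l, `[< ~ runs l.+1 0 x >].
    by exists m; apply/asboolP; rewrite runs_empty.
  case: (ex_minnP ex) => l /asboolP nl lmin.
  have xl : runs l 0 x.
    case: l nl lmin => [//|l] nl lmin; apply: contrapT => h.
    by have := lmin l; rewrite ltnn => /(_ (introT (asboolP _) h)).
  have lm : (l <= m)%N by apply: lmin; apply/asboolP; rewrite runs_empty.
  have li : l \in iota 0 m.+1 by rewrite mem_iota.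
  rewrite (bigD1_seq l li (iota_uniq _ _))/=.
  apply: (@le_trans _ _ ((c l)%:E * (\1_(runs l 0) x)%:E)%E); last first.
    by apply: leeDl; rewrite sume_ge0// => k _; rewrite mule_ge0// lee_fin powR_ge0.
  rewrite indicE mem_set// mule1.
  rewrite -poweR_EFin gt0_ler_poweR// ?in_itv/= ?leey ?f0 ?lee_fin ?mulr_ge0//.
  exact: fr.
apply: (@le_trans _ _ (\int[P]_w \sum_(l <- iota 0 m.+1) (c l)%:E * (\1_(runs l 0) (xit xi w))%:E)%E).
  apply: ge0_le_integral => //.
  - by move=> w _; exact: poweR_ge0.
  - by apply: measurable_poweR_comp; exact: measurableT_comp.
  - apply: emeasurable_sum => l; apply: emeasurable_funM => //.
    apply/measurable_EFinP; apply: measurableT_comp; last exact: mx.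
    by apply: measurable_indic; exact: measurable_runs.
rewrite ge0_integral_sum//; last 2 first.
- move=> l; apply: emeasurable_funM => //.
  apply/measurable_EFinP; apply: measurableT_comp; last exact: mx.
  by apply: measurable_indic; exact: measurable_runs.
- by move=> l w _; rewrite mule_ge0// lee_fin powR_ge0.
apply: (@le_trans _ _ (\sum_(l <- iota 0 m.+1) (A `^ q * (l.+1%:R `^ q / l`!%:R))%:E)%E).
  apply: lee_sum => l _; rewrite ge0_integralZl_EFin ?powR_ge0//; last first.
    apply/measurable_EFinP; apply: measurableT_comp; last exact: mx.
    by apply: measurable_indic; exact: measurable_runs.
  have -> : (\int[P]_w (\1_(runs l 0) (xit xi w))%:E = (Pt (runs l 0))%:E)%E.
    rewrite -PtE; last exact: measurable_runs.
    rewrite -[X in P X]setIT -integral_indic//.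
    by apply: measurable_xit_preimage; exact: measurable_runs.
  rewrite -EFinM lee_fin /c powRM// [_ * A `^ q]mulrC -mulrA ler_wpM2l ?powR_ge0//.
  rewrite ler_wpM2l ?powR_ge0//.
  exact: runs_tail_fact.
rewrite sumEFin lee_fin -mulr_sumr powRM//; last first.
  by apply: le_trans (poisson_const_ge1 q1).
rewrite mulrC ler_wpM2r ?powR_ge0//.
have := poisson_moment m.+1 q1.
by rewrite -(big_mkord xpredT (fun l => l.+1%:R `^ q / l`!%:R)) /index_iota subn0.
Qed.

End Restart.

(** * Powers and Jensen's inequality in the extended reals *)

Section Ereal.
Context {R : realType}.
Local Open Scope ereal_scope.

Lemma le_poweR (x y : \bar R) (q : R) : (0 <= q)%R -> 0 <= x -> x <= y -> x `^ q <= y `^ q.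
Proof.
by move=> q0 x0 xy; apply: gt0_ler_poweR => //; rewrite in_itv/= ?leey ?andbT// (le_trans x0).
Qed.

Lemma poweR_add3 (q : R) (x y z : \bar R) : (1 <= q)%R -> 0 <= x -> 0 <= y -> 0 <= z ->
  (x + y + z) `^ q <= (3 `^ q)%:E * (x `^ q + y `^ q + z `^ q).
Proof.
move=> q1; have q0 : (q != 0)%R by rewrite gt_eqF// (lt_le_trans ltr01).
have c0 : 0 < (3 `^ q)%:E :> \bar R by rewrite lte_fin powR_gt0.
have H u : u = +oo -> (3 `^ q)%:E * u = +oo :> \bar R by move=> ->; rewrite gt0_muley.
case: x y z => [x| |]// [y| |]// [z| |]// x0 y0 z0; rewrite ?(poweRyr q0); last by rewrite H// leey.
- change (((x + y + z) `^ q)%:E <= (3 `^ q * (x `^ q + y `^ q + z `^ q))%:E).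
  by rewrite lee_fin; apply: powR_add3 => //; lra.
all: rewrite H ?leey// ?addye ?addey//.
Qed.

End Ereal.

Section Jensen.
Context {d : measure_display} {W : measurableType d} {R : realType} (P : probability W R).
Local Open Scope ereal_scope.

Lemma integral_prob_cst (c : \bar R) : \int[P]_w c = c.
Proof.
transitivity (c * P setT); last by rewrite probability_setT mule1.
exact: (@integral_cst _ _ _ P setT measurableT c).
Qed.

(** Jensen's inequality by the tangent line q a^(q - 1) z <= z^q + (q - 1) a^q, integrated with a
    equal to the mean. If the mean is infinite, a = 1 already makes the right-hand side infinite. *)
Lemma poweR_integral_le (f : W -> \bar R) (q : R) : (1 <= q)%R ->
  measurable_fun setT f -> (forall w, 0 <= f w) ->
  (\int[P]_w f w) `^ q <= \int[P]_w (f w `^ q).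
Proof.
move=> q1 mf f0; have i0 : 0 <= \int[P]_w f w by apply: integral_ge0.
have mfq := measurable_poweR_comp q mf.
move: q1; rewrite le_eqVlt => /predU1P[<-|q1].
  by rewrite poweRe1//; under [leRHS]eq_integral do rewrite poweRe1//.
have q0 : (0 < q)%R by lra.
have qm1 : (0 < q - 1)%R by rewrite subr_gt0.
have young (a z : R) : (0 <= a -> 0 <= z ->
    (q * a `^ (q - 1)) * z <= z `^ q + (q - 1) * a `^ q)%R.
  move=> a0 z0; have := @conjugate_powR R z (a `^ (q - 1))%R q (q / (q - 1))%R z0 (powR_ge0 _ _) q0.
  rewrite divr_gt0// => /(_ isT); rewrite -powRrM mulrCA divff ?gt_eqF// mulr1 invf_div.
  have -> : (q^-1 + (q - 1) / q = 1)%R by field; rewrite gt_eqF.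
  move=> /(_ erefl) h; have := ler_wpM2l (ltW q0) h.
  rewrite mulrDr [(q * (_ / q))%R]mulrCA divff ?gt_eqF// mulr1.
  by rewrite (_ : q * (a `^ q * ((q - 1) / q)) = (q - 1) * a `^ q)%R; [lra|field; rewrite gt_eqF].
have H (a : R) : (0 <= a)%R -> (q * a `^ (q - 1))%:E * \int[P]_w f w <=
    \int[P]_w (f w `^ q) + ((q - 1) * a `^ q)%:E.
  move=> a0; have c0 : (0 <= q * a `^ (q - 1))%R by rewrite mulr_ge0 ?powR_ge0 ?(ltW q0).
  rewrite -ge0_integralZl_EFin//.
  have e0 : (0 <= (q - 1) * a `^ q)%R by rewrite mulr_ge0 ?powR_ge0 ?(ltW qm1).
  have -> : ((q - 1) * a `^ q)%:E = \int[P]_w ((q - 1) * a `^ q)%:E.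
    by rewrite integral_prob_cst.
  rewrite -ge0_integralD//; last by move=> w _; exact: poweR_ge0.
  apply: ge0_le_integral => //.
  - by move=> w _; rewrite mule_ge0.
  - exact: emeasurable_funM.
  - exact: emeasurable_funD.
  - move=> w _; have := f0 w; case: (f w) => [z| |]// z0.
      by rewrite poweR_EFin -EFinM -EFinD lee_fin young.
    by rewrite poweRyr ?gt_eqF// addye// leey.
move: i0 H; case: (\int[P]_w f w) => [a| |]// i0 H.
  have a0 : (0 <= a)%R by [].
  have := H a a0; rewrite -EFinM -mulrA poweR_EFin.
  have -> : (a `^ (q - 1) * a = a `^ q)%R.
    have [->|an0] := eqVneq a 0%R; first by rewrite mulr0 powR0// gt_eqF.
    by rewrite -{2}[a]powRr1// -powRD ?an0 ?implybT// subrK.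
  case: (\int[P]_w (f w `^ q)) => [b| |]; rewrite ?leey// => h.
    by move: h; rewrite -EFinD !lee_fin; set u := (a `^ q)%R; lra.
have := H 1%R ler01; rewrite powR1 mulr1 gt0_muley ?lte_fin//.
rewrite leye_eq => /eqP; case: (\int[P]_w (f w `^ q)) => [b| |]//= _.
by rewrite leey.
Qed.

End Jensen.

Section WeightedSup.
Context {d : measure_display} {Omega : measurableType d} {R : realType} {m : nat}.
Implicit Types (K : set (Omega -> R)) (c : 'I_m -> R) (x : m.-tuple Omega).

Definition wsup K c x : \bar R :=
  ereal_sup [set (`|\sum_(j < m) c j * h (tnth x j)|)%:E | h in K].

Lemma wsup_ge K c x h : K h -> ((`|\sum_(j < m) c j * h (tnth x j)|)%:E <= wsup K c x)%E.
Proof. by move=> Kh; apply: ereal_sup_ubound; exists h. Qed.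

Lemma wsup_le K c x (t : \bar R) :
  (forall h, K h -> ((`|\sum_(j < m) c j * h (tnth x j)|)%:E <= t)%E) -> (wsup K c x <= t)%E.
Proof. by move=> H; apply: ge_ereal_sup => _ [h Kh <-]; exact: H. Qed.

Lemma wsup_ge0 K c x : K !=set0 -> (0 <= wsup K c x)%E.
Proof. by move=> [h Kh]; apply: le_trans (wsup_ge c x Kh); rewrite lee_fin. Qed.

Lemma wsup_eq K c c' x x' : (forall j, c j = c' j) ->
  (forall j, c j != 0 -> tnth x j = tnth x' j) -> wsup K c x = wsup K c' x'.
Proof.
move=> cc xx; congr ereal_sup; apply/seteqP; split => _ [h Kh <-]; exists h => //;
  congr (`|_|%:E); apply: eq_bigr => j _; rewrite -cc;
  by have [->|/xx ->//] := eqVneq (c j) 0; rewrite !mul0r.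
Qed.

End WeightedSup.

(** * Symmetrization with fixed signs *)

Section Symmetrization.
Context {d d' : measure_display} {W : measurableType d} {Omega : measurableType d'}
  {R : realType} (P : probability W R) (m : nat) (xi : 'I_m -> {RV P >-> Omega}).
Hypothesis ind : independent_family xi.
Variable K : set (Omega -> R).
Hypotheses (K0 : K !=set0) (mK : forall h, K h -> measurable_fun setT h)
  (bK : forall h, K h -> exists M, forall y, `|h y| <= M)
  (msup : forall c : 'I_m -> R, measurable_fun setT (wsup K c)).
Variable e : {ffun 'I_m -> bool}.

Definition mean (j : 'I_m) (h : Omega -> R) : R := fine (\int[P]_w (h (xi j w))%:E)%E.

Let sg (j : 'I_m) : R := (-1) ^+ e j.
Let Z x : \bar R := wsup K sg x.
Let Z0 x : (0 <= Z x)%E. Proof. exact: wsup_ge0. Qed.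

Let A (S : {set 'I_m}) (w : W) : \bar R := (\int[P]_w' Z (mix xi S (w, w')))%E.

Let integrable_h j h : K h -> P.-integrable setT (fun w => (h (xi j w))%:E).
Proof.
move=> Kh; have mh : measurable_fun setT (fun w => h (xi j w)).
  by apply: measurableT_comp; [exact: mK|exact: measurable_funP].
apply: (measurable_bounded_integrable (f := fun w => h (xi j w))) => //.
  by have := probability_setT P => /= ->; rewrite ltry.
have [M hM] := bK Kh; exists M; split; first exact: num_real.
by move=> u Mu w _ /=; apply: le_trans (hM _) (ltW Mu).
Qed.

Lemma mean_integral j h : K h -> (\int[P]_w (h (xi j w))%:E)%E = (mean j h)%:E.
Proof. by move=> Kh; rewrite fineK//; apply: integrable_fin_num => //; exact: integrable_h. Qed.

Let A_ge (S : {set 'I_m}) w h : K h ->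
  ((`|\sum_j sg j * (if j \in S then h (xi j w) else mean j h)|)%:E <= A S w)%E.
Proof.
move=> Kh.
pose phi j w' : R := sg j * (if j \in S then h (xi j w) else h (xi j w')).
have iphi j : P.-integrable setT (fun w' => (phi j w')%:E).
  rewrite /phi; case: (j \in S).
    exact: finite_measure_integrable_cst.
  apply: (@eq_integrable _ _ _ P setT measurableT (fun w' => ((sg j)%:E * (h (xi j w'))%:E)%E)).
    by move=> w' _; rewrite -EFinM.
  by apply: integrableZl => //; exact: integrable_h.
have eqI : (\int[P]_w' (\sum_j phi j w')%:E =
    (\sum_j sg j * (if j \in S then h (xi j w) else mean j h))%:E)%E.
  under eq_integral => w' _ do rewrite -sumEFin.
  rewrite integral_sum//.
  rewrite -sumEFin; apply: eq_bigr => j _; rewrite /phi; case: (j \in S).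
    by rewrite integral_prob_cst.
  under eq_integral do rewrite EFinM.
  by rewrite integralZl ?mean_integral//; exact: integrable_h.
rewrite -abse_EFin -eqI.
have mphi : measurable_fun setT (fun w' => (\sum_j phi j w')%:E).
  apply/measurable_EFinP; apply: measurable_sum => j.
  by apply/measurable_EFinP; exact: measurable_int (iphi j).
apply: le_trans (le_abse_integral _ measurableT mphi) _.
apply: ge0_le_integral => //.
- by apply: measurableT_comp.
- apply: measurableT_comp; first exact: msup.
  apply: measurableT_comp; first exact: measurable_mix.
  exact: measurable_pair1.
- move=> w' _; rewrite abse_EFin; apply: le_trans (wsup_ge _ _ Kh).
  rewrite lee_fin le_eqVlt; apply/orP; left; apply/eqP; congr (`|_|).
  by apply: eq_bigr => j _; rewrite /phi tnth_mktuple; case: (j \in S).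
Qed.

Let J : {set 'I_m} := [set j | ~~ e j]%SET.

(* For a fixed sign pattern, an independent copy replaces the coordinates of one
   sign; averaging over the copy turns that part of the signed sum into its
   mean, so three signed sums dominate the centered sum. *)
Definition symm_bound (w : W) : \bar R := (A J w + A (~: J)%SET w + 2%:E * A finset.set0 w)%E.

Lemma symm_bound_ge w h : K h ->
  ((`|\sum_j (h (xi j w) - mean j h)|)%:E <= symm_bound w)%E.
Proof.
move=> Kh; have h1 := A_ge J w Kh; have h2 := A_ge (~: J)%SET w Kh.
have h3 := A_ge finset.set0 w Kh.
have le3 (a b c : R) (x y z : \bar R) : (a%:E <= x)%E -> (b%:E <= y)%E -> (c%:E <= z)%E ->
    ((a + b + 2 * c)%:E <= x + y + 2%:E * z)%E.
  by move=> ax yb zc; rewrite !EFinD EFinM; do !apply: leeD => //; apply: lee_wpmul2l.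
apply: le_trans (le3 _ _ _ _ _ _ h1 h2 h3); rewrite lee_fin.
set s1 := \sum_j _; set s2 := \sum_j _; set s3 := \sum_j _; set s4 := \sum_j _.
have -> : s1 = (s2 - s4) - (s3 - s4).
  rewrite /s1 /s2 /s3 /s4 -!sumrB; apply: eq_bigr => j _.
  rewrite finset.in_setC /J finset.inE finset.in_set0 /sg.
  by case: (e j) => /=; rewrite ?expr1 ?expr0; ring.
have -> : s2 - s4 - (s3 - s4) = s2 - s3 by ring.
have := ler_normB s2 s3; have := normr_ge0 s4; lra.
Qed.

Let mZmix (S : {set 'I_m}) : measurable_fun setT (Z \o mix xi S).
Proof. by apply: measurableT_comp; [exact: msup|exact: measurable_mix]. Qed.

Let mA S : measurable_fun setT (A S).
Proof.
apply: (@measurable_fun_fubini_tonelli_F _ _ _ _ _ P (Z \o mix xi S)) => // z.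
exact: Z0.
Qed.

Let A0 S w : (0 <= A S w)%E.
Proof. by apply: integral_ge0 => w' _; exact: Z0. Qed.

Let A_moment S (q : R) : 1 <= q ->
  (\int[P]_w (A S w `^ q) <= \int[P]_w (Z (xit xi w) `^ q))%E.
Proof.
move=> q1; rewrite (@mix_law _ _ _ _ _ P m xi ind S (fun x => (Z x `^ q)%E)); last 2 first.
- by apply: measurable_poweR_comp; exact: msup.
- by move=> x; exact: poweR_ge0.
apply: ge0_le_integral => //.
- by move=> w _; exact: poweR_ge0.
- by apply: measurable_poweR_comp; exact: mA.
- apply: (@measurable_fun_fubini_tonelli_F _ _ _ _ _ P (fun z => (Z (mix xi S z) `^ q)%E)).
    by apply: measurable_poweR_comp; exact: mZmix.
  by move=> z; exact: poweR_ge0.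
- move=> w _; apply: poweR_integral_le => //.
  by apply: (measurableT_comp (mZmix S)); exact: measurable_pair1.
Qed.

Lemma measurable_symm_bound : measurable_fun setT symm_bound.
Proof.
apply: emeasurable_funD; first by apply: emeasurable_funD; exact: mA.
by apply: emeasurable_funM => //; exact: mA.
Qed.

Lemma symm_bound_ge0 w : (0 <= symm_bound w)%E.
Proof. by apply: adde_ge0; [apply: adde_ge0|apply: mule_ge0]; rewrite ?A0. Qed.

Lemma symm_bound_moment (q : R) : 1 <= q ->
  (\int[P]_w (symm_bound w `^ q) <= (18 `^ q)%:E * \int[P]_w (wsup K sg (xit xi w) `^ q))%E.
Proof.
move=> q1; have q0 : 0 <= q by lra.
have mAq S : measurable_fun setT (fun w => (A S w `^ q)%E).
  by apply: measurable_poweR_comp; exact: mA.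
apply: (@le_trans _ _ (\int[P]_w ((6 `^ q)%:E * (A J w `^ q + A (~: J)%SET w `^ q + A finset.set0 w `^ q)))%E).
  apply: ge0_le_integral => //.
  - by move=> w _; exact: poweR_ge0.
  - by apply: measurable_poweR_comp; exact: measurable_symm_bound.
  - apply: emeasurable_funM => //; apply: emeasurable_funD => //; exact: emeasurable_funD.
  - move=> w _; apply: (@le_trans _ _ ((2%:E * A J w + 2%:E * A (~: J)%SET w + 2%:E * A finset.set0 w) `^ q)%E).
      apply: le_poweR => //; first exact: symm_bound_ge0.
      have l2 (x : \bar R) : (0 <= x -> x <= 2%:E * x)%E.
        by move=> x0; rewrite -{1}[x]mul1e; apply: lee_wpmul2r => //; rewrite lee_fin; lra.
      by apply: leeD => //; apply: leeD; apply: l2; exact: A0.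
    have s0 : (0 <= A J w + A (~: J)%SET w)%E by apply: adde_ge0.
    rewrite -ge0_muleDr// -ge0_muleDr// poweRM//; last by apply: adde_ge0.
    have -> : 6 `^ q = 2 `^ q * 3 `^ q :> R by rewrite -powRM//; congr (_ `^ _); ring.
    rewrite poweR_EFin EFinM -[leRHS]muleA; apply: lee_wpmul2l; first by rewrite lee_fin powR_ge0.
    exact: poweR_add3.
rewrite ge0_integralZl_EFin ?powR_ge0//; last 2 first.
- by move=> w _; do !apply: adde_ge0; exact: poweR_ge0.
- by apply: emeasurable_funD => //; exact: emeasurable_funD.
have p0 S w : (0 <= A S w `^ q)%E by exact: poweR_ge0.
rewrite ge0_integralD//; last 2 first.
- by move=> w _; rewrite adde_ge0.
- exact: emeasurable_funD.
rewrite ge0_integralD//.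
apply: (@le_trans _ _ ((6 `^ q)%:E * (3%:E * \int[P]_w (Z (xit xi w) `^ q)))%E).
  apply: lee_wpmul2l; first by rewrite lee_fin powR_ge0.
  have -> : (3%:E * \int[P]_w (Z (xit xi w) `^ q) = \int[P]_w (Z (xit xi w) `^ q) +
     \int[P]_w (Z (xit xi w) `^ q) + \int[P]_w (Z (xit xi w) `^ q))%E.
    have -> : 3%:E = (1 + 1 + 1)%E :> \bar R by rewrite -!EFinD; congr EFin; ring.
    have i0 : (0 <= \int[P]_w (Z (xit xi w) `^ q))%E.
      by apply: integral_ge0 => w _; exact: poweR_ge0.
    by rewrite !ge0_muleDl ?adde_ge0// !mul1e.
  by apply: leeD; [apply: leeD|]; exact: A_moment.
rewrite muleA; apply: lee_wpmul2r.
  by apply: integral_ge0 => w _; exact: poweR_ge0.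
rewrite -EFinM lee_fin (_ : 18 = 6 * 3); last by ring.
rewrite powRM// ler_wpM2l ?powR_ge0//.
by rewrite -{1}[3]powRr1// ler_powR//; lra.
Qed.

End Symmetrization.

(** * Moments of bounded signed sums and of rare large entries *)

Section MaskedMoment.
Context {d d' : measure_display} {W : measurableType d} {Omega : measurableType d'}
  {R : realType} (P : probability W R) (m : nat) (xi : 'I_m -> {RV P >-> Omega}).
Hypothesis ind : independent_family xi.
Variable K : set (Omega -> R).
Hypotheses (K0 : K !=set0)
  (msup : forall c : 'I_m -> R, measurable_fun setT (wsup K c)).

Definition cut (c : 'I_m -> R) (a b : nat) (j : 'I_m) : R :=
  if (a <= j < b)%N then c j else 0.

Lemma cut_sum c a b (u : 'I_m -> R) :
  \sum_j cut c a b j * u j = \sum_(j < m | (a <= j < b)%N) c j * u j.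
Proof.
by rewrite [RHS]big_mkcond; apply: eq_bigr => j _; rewrite /cut; case: ifP; rewrite ?mul0r.
Qed.

Section Bounded.
Variables (lam c : R) (s : 'I_m -> R).
Hypotheses (lam0 : 0 <= lam) (c0 : 0 <= c) (Klam : forall h y, K h -> `|h y| <= lam)
  (s1 : forall j, `|s j| <= 1).

(** A block is bad as soon as some subinterval has a large signed sum, not only the block itself;
    this makes the events monotone in the block. *)
Let blk a b : set (m.-tuple Omega) :=
  \bigcup_(a' in [set: nat]) \bigcup_(b' in [set: nat])
    (if (a <= a')%N && (b' <= b)%N then [set x | (2 * c)%:E < wsup K (cut s a' b') x]%E else set0).

Let blkP a b x : blk a b x <->
  exists a' b', [/\ (a <= a')%N, (b' <= b)%N & ((2 * c)%:E < wsup K (cut s a' b') x)%E].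
Proof.
split=> [[a' _ [b' _]]|[a' [b' [aa bb h]]]].
  by case: ifP => // /andP[aa bb] h; exists a', b'.
by exists a' => //; exists b' => //; rewrite aa bb.
Qed.

Let wcut a b x h : K h -> ~ ((2 * c)%:E < wsup K (cut s a b) x)%E ->
  `|\sum_(j < m | (a <= j < b)%N) s j * h (tnth x j)| <= 2 * c.
Proof.
move=> Kh /negP; rewrite -leNgt => H; rewrite -lee_fin -cut_sum.
by apply: le_trans H; exact: wsup_ge.
Qed.

Let split_sum a k (u : 'I_m -> R) : (a <= k)%N ->
  \sum_(j < m | (a <= j < m)%N) u j = \sum_(j < m | (a <= j < k)%N) u j + \sum_(j < m | (k <= j < m)%N) u j.
Proof.
move=> ak; rewrite (bigID (fun j : 'I_m => (j < k)%N))/=; congr (_ + _); apply: eq_bigl => j.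
  by rewrite ltn_ord andbT.
by rewrite !ltn_ord !andbT -leqNgt; case: (leqP k j) => //=; rewrite ?andbF// => kj; rewrite (leq_trans ak).
Qed.

(** Cut at the end [k] of the shortest bad block from [a]. Without its last coordinate the sum over
    it is at most 2c, that coordinate adds at most [lam], and from [k] on one run fewer is
    possible. *)
Let runs_sum l a x h : K h -> (a <= m)%N -> ~ runs blk l.+1 a x ->
  `|\sum_(j < m | (a <= j < m)%N) s j * h (tnth x j)| <= l.+1%:R * (2 * c) + l%:R * lam.
Proof.
move=> Kh; elim: l a => [|l IH] a am nr.
  rewrite mul1r mul0r addr0.
  have [ma|am'] := leqP m a.
    rewrite big_pred0 ?normr0 ?mulr_ge0// => j.
    by apply/negbTE; rewrite ltn_ord andbT -ltnNge (leq_trans (ltn_ord j)).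
  apply: wcut => // h1; apply: nr; apply/runsP; exists m; split => //=.
    by rewrite am' leqnn.
  by apply/blkP; exists a, m.
have c2 : 0 <= 2 * c by rewrite mulr_ge0.
have [Bm|nBm] := pselect (blk a m x); last first.
  apply: (@le_trans _ _ (2 * c)).
    by apply: wcut => // h1; apply: nBm; apply/blkP; exists a, m.
  rewrite -[leLHS]addr0 lerD ?mulr_ge0 ?ler0n//.
  by rewrite -[leLHS]mul1r ler_wpM2r// ler1n.
have ex : exists k, (a <= k <= m)%N && `[< blk a k x >].
  by exists m; rewrite am leqnn; apply/asboolP.
case: (ex_minnP ex) => k /andP[/andP[ak km] /asboolP Bk] kmin.
have ak' : (a < k)%N.
  rewrite ltn_neqAle ak andbT; apply/eqP => E; move: Bk => /blkP[a' [b' [aa bb]]].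
  apply/negP; rewrite -leNgt; apply: wsup_le => h' _.
  rewrite cut_sum big_pred0 ?normr0 ?lee_fin// => j; apply/negbTE/negP => /andP[h1 h2].
  by move: (leq_trans (leq_ltn_trans h1 h2) bb); rewrite -E ltnNge (leq_trans aa).
have nk : ~ runs blk l.+1 k x.
  by move=> h1; apply: nr; apply/runsP; exists k; split => //; rewrite ak' km.
case: k ak' km Bk kmin nk ak ex => // k ak' km Bk kmin nk ak ex.
rewrite (split_sum _ ak).
have -> : \sum_(j < m | (a <= j < k.+1)%N) s j * h (tnth x j) =
   \sum_(j < m | (a <= j < k)%N) s j * h (tnth x j) + s (Ordinal km) * h (tnth x (Ordinal km)).
  rewrite (bigD1 (Ordinal km))/=; last by rewrite -ltnS ak' leqnn.
  rewrite addrC; congr (_ + _); apply: eq_bigl => j.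
  rewrite -val_eqE/= ltnS [(j < k)%N]ltn_neqAle; case: (_ <= _)%N => //=; rewrite andbC.
  by [].
have b1 : `|\sum_(j < m | (a <= j < k)%N) s j * h (tnth x j)| <= 2 * c.
  apply: wcut => // h1; suff : (k.+1 <= k)%N by rewrite ltnn.
  apply: kmin; rewrite (ltnW km) andbT -ltnS ak'/=; apply/asboolP/blkP.
  by exists a, k.
have b2 : `|s (Ordinal km) * h (tnth x (Ordinal km))| <= lam.
  by rewrite normrM -[leRHS]mul1r; apply: ler_pM => //; exact: Klam.
have b3 := IH _ km nk.
set u := \sum_(j < m | _) _ in b1 *; set v := s _ * _ in b2 *; set w := \sum_(j < m | _) _ in b3 *.
apply: le_trans (ler_normD _ _) _; apply: le_trans (lerD (ler_normD _ _) (lexx _)) _.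
by rewrite -[l.+2%:R]natr1 -[l.+1%:R in leRHS]natr1; rewrite -natr1 in b3; lra.
Qed.

Lemma restart_moment (q : R) : 1 <= q ->
  (P [set w | exists2 k, (k <= m)%N & (c%:E < wsup K (cut s 0 k) (xit xi w))%E] <= (4^-1)%:E)%E ->
  (\int[P]_w (wsup K s (xit xi w) `^ q) <= ((poisson_const q * (2 * c + lam)) `^ q)%:E)%E.
Proof.
move=> q1 Pc.
have mlt c' a b : measurable [set x | (c'%:E < wsup K (cut s a b) x)%E].
  rewrite -[X in measurable X]setTI; exact: emeasurable_fun_o_infty.
have mblk a b : measurable (blk a b).
  apply: bigcupT_measurable => a'; apply: bigcupT_measurable => b'.
  by case: ifP => // _; exact: mlt.
apply: (@runs_moment _ _ _ _ _ P m xi ind blk) => //.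
- move=> a b x y xy /blkP[a' [b' [aa bb h]]]; apply/blkP; exists a', b'; split => //.
  rewrite -(@wsup_eq _ _ _ _ _ (cut s a' b') _ x)// => j; rewrite /cut.
  case: ifP => [/andP[h1 h2] _|_]; last by rewrite eqxx.
  by apply: xy; rewrite finset.inE (leq_trans aa h1) (leq_trans h2 bb).
- move=> a b a' b' aa bb x /blkP[a1 [b1 [h1 h2 h3]]]; apply/blkP; exists a1, b1.
  by split => //; [exact: leq_trans h1|exact: leq_trans bb].
- move=> a; apply/seteqP; split => // x /blkP[a' [b' [aa bb]]].
  apply/negP; rewrite -leNgt; apply: wsup_le => h' _.
  rewrite cut_sum big_pred0 ?normr0 ?lee_fin ?mulr_ge0// => j; apply/negbTE/negP => /andP[h1 h2].
  by move: (leq_trans (leq_ltn_trans h1 h2) bb); rewrite ltnNge aa.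
- rewrite -lee_fin -PtE//; apply: le_trans Pc; apply: le_measure; rewrite ?inE.
  + exact: measurable_xit_preimage.
  + rewrite (_ : [set w | _] = \bigcup_(k < m.+1) (xit xi @^-1` [set x | (c%:E < wsup K (cut s 0 k) x)%E])).
      by apply: bigcup_measurable => k _; apply: measurable_xit_preimage; exact: mlt.
    by apply/seteqP; split => w /= [k km h]; exists k.
  (* A sum over an interval is the difference of two prefix sums, which turns the bound c for
     prefixes into 2c for blocks. *)
  + move=> w /blkP[a' [b' [aa bb]]]; apply: contraPP => h /=; apply/negP; rewrite -leNgt.
    have pre k h' : (k <= m)%N -> K h' ->
        `|\sum_(j < m | (0 <= j < k)%N) s j * h' (tnth (xit xi w) j)| <= c.
      move=> km Kh; rewrite leNgt; apply/negP => h2; apply: h; exists k => //.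
      by apply: lt_le_trans (wsup_ge _ _ Kh); rewrite lte_fin cut_sum.
    apply: wsup_le => h' Kh; rewrite cut_sum lee_fin.
    have [ab|ab] := leqP b' a'.
      rewrite big_pred0 ?normr0 ?mulr_ge0// => j; apply/negbTE/negP => /andP[h1 h2].
      by move: (leq_ltn_trans h1 h2); rewrite ltnNge ab.
    have -> : \sum_(j < m | (a' <= j < b')%N) s j * h' (tnth (xit xi w) j) =
      \sum_(j < m | (0 <= j < b')%N) s j * h' (tnth (xit xi w) j) -
      \sum_(j < m | (0 <= j < a')%N) s j * h' (tnth (xit xi w) j).
      rewrite [in RHS](bigID (fun j : 'I_m => (j < a')%N))/= addrAC -[LHS]add0r; congr (_ + _).
        apply/esym/eqP; rewrite subr_eq0; apply/eqP; apply: eq_bigl => j.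
        by case: (ltnP j a') => h1; rewrite ?andbF// (ltn_trans h1 ab).
      by apply: eq_bigl => j; rewrite -leqNgt andbC.
    apply: le_trans (ler_normB _ _) _.
    have h1 := pre b' h' bb Kh; have h2 := pre a' h' (leq_trans (ltnW ab) bb) Kh.
    by move: h1 h2; set u := `|_|; set v := `|_|; lra.
- by move=> x; exact: wsup_ge0.
- by rewrite addr_ge0// mulr_ge0.
- move=> l x nr; apply: wsup_le => h Kh; rewrite lee_fin.
  have := runs_sum Kh (leq0n m) nr.
  rewrite (eq_bigl xpredT); last by move=> j; rewrite ltn_ord.
  move=> /le_trans; apply; rewrite mulrDr lerD2l ler_wpM2r// ler_nat//.
Qed.

End Bounded.

End MaskedMoment.

Section SparseMoment.
Context {d d' : measure_display} {W : measurableType d} {Omega : measurableType d'}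
  {R : realType} (P : probability W R) (m : nat) (xi : 'I_m -> {RV P >-> Omega}).
Hypothesis ind : independent_family xi.
Variable K : set (Omega -> R).
Hypotheses (K0 : K !=set0)
  (msup : forall c : 'I_m -> R, measurable_fun setT (wsup K c)).

Definition peak (j : 'I_m) (x : m.-tuple Omega) : \bar R := wsup K (fun i => (i == j)%:R) x.

Lemma peak_eq j x y : tnth x j = tnth y j -> peak j x = peak j y.
Proof.
move=> xy; apply: wsup_eq => // i; have [->//|_] := eqVneq i j.
by rewrite eqxx.
Qed.

Variable lam : R.
Hypotheses (lam0 : 0 <= lam)
  (Plam : (P [set w | exists j, (lam%:E < peak j (xit xi w))%E] <= (4^-1)%:E)%E).

Let big j : set (m.-tuple Omega) := [set x | (lam%:E < peak j x)%E].

Let mbig j : measurable (big j).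
Proof. rewrite -[X in measurable X]setTI; apply: emeasurable_fun_o_infty => //; exact: msup. Qed.

Let big_eq j x y : tnth x j = tnth y j -> big j x -> big j y.
Proof. by move=> xy; rewrite /big/= (peak_eq xy). Qed.

Let blk a b : set (m.-tuple Omega) :=
  \bigcup_(j in [set: 'I_m]) (if (a <= j < b)%N then big j else set0).

Let blkP a b x : blk a b x <-> exists2 j : 'I_m, (a <= j < b)%N & big j x.
Proof.
split=> [[j _]|[j aj bj]]; first by case: ifP => // aj bj; exists j.
by exists j => //; rewrite aj.
Qed.

Let num (S : {pred 'I_m}) x : nat := (\sum_(j | j \in S) `[< big j x >])%N.

(** Every large entry is a bad block by itself, so that restarting behind the first one removes one
    from both counts. *)
Let num_le a l x : ~ runs blk l.+1 a x -> (num [pred j : 'I_m | (a <= j)%N] x <= l)%N.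
Proof.
elim: l a => [|l IH] a nr.
  rewrite leqn0 /num big1// => j; rewrite inE => aj.
  case: asboolP => // bj; exfalso; apply: nr; apply/runsP; exists j.+1; split => //=.
    by rewrite ltnS aj/= ltn_ord.
  by apply/blkP; exists j => //; rewrite aj/=.
have [[j aj bj]|none] := pselect (exists2 j : 'I_m, (a <= j)%N & big j x); last first.
  rewrite /num big1// => j; rewrite inE => aj.
  by case: asboolP => // bj; exfalso; apply: none; exists j.
have [i /andP[ai /asboolP bi] imin] :=
  @arg_minnP _ j (fun j : 'I_m => (a <= j)%N && `[< big j x >]) (fun j : 'I_m => j : nat)
    (introT andP (conj aj (introT (asboolP _) bj))).
have ni : ~ runs blk l.+1 i.+1 x.
  move=> h; apply: nr; apply/runsP; exists i.+1; split => //.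
    by rewrite ltnS ai/= ltn_ord.
  by apply/blkP; exists i => //; rewrite ai/=.
rewrite /num (bigD1 i)/=; last by rewrite inE.
rewrite -add1n leq_add ?leq_b1//; apply: leq_trans (IH _ ni).
rewrite /num [leqLHS]big_mkcond [leqRHS]big_mkcond/=; apply: leq_sum => u _; rewrite !inE.
case: (leqP i.+1 u) => [iu|ui]; first by case: ifP.
case: ifP => // /andP[au ui']; case: asboolP => // bu.
have := imin u; rewrite au/= => /(_ (introT (asboolP _) bu)) iu.
by move: ui'; rewrite -val_eqE/= eqn_leq iu -ltnS ui.
Qed.

Let Y j x : \bar R := (peak j x * (\1_(big j) x)%:E)%E.

Let YE j x : Y j x = if `[< big j x >] then peak j x else 0%E.
Proof.
rewrite /Y indicE; case: asboolP => h; first by rewrite mem_set// mule1.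
by rewrite memNset// mule0.
Qed.

Let peak0 j x : (0 <= peak j x)%E. Proof. exact: wsup_ge0. Qed.

Let Y0 j x : (0 <= Y j x)%E. Proof. by rewrite YE; case: ifP. Qed.

Let mY j : measurable_fun setT (Y j).
Proof.
apply: emeasurable_funM; first exact: msup.
by apply/measurable_EFinP; exact: measurable_indic.
Qed.

Let Y_eq j x y : tnth x j = tnth y j -> Y j x = Y j y.
Proof.
move=> xy; rewrite !YE (peak_eq xy); congr (if _ then _ else _).
by apply: asbool_equiv_eq; split; apply: big_eq.
Qed.

Let num_eq (S : {pred 'I_m}) x y : (forall j, j \in S -> tnth x j = tnth y j) -> num S x = num S y.
Proof.
move=> xy; apply: eq_bigr => j jS; congr nat_of_bool.
by apply: asbool_equiv_eq; split; apply: big_eq; rewrite xy.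
Qed.

Let mnum (S : {pred 'I_m}) : measurable_fun setT (fun x => (num S x)%:R : R).
Proof.
rewrite (_ : (fun x => _) = (fun x => \sum_(j < m) (j \in S)%:R * \1_(big j) x)).
  by apply: measurable_sum => j; apply: measurable_funM => //; exact: measurable_indic.
apply/funext => x; rewrite /num natr_sum [LHS]big_mkcond; apply: eq_bigr => j _.
rewrite indicE; case: (j \in S); rewrite ?mul0r// mul1r.
by case: asboolP => h; [rewrite mem_set|rewrite memNset].
Qed.

Let mblk a b : measurable (blk a b).
Proof.
apply: fin_bigcup_measurable => // j _.
by case: ifP.
Qed.

Let Pblk : Pt xi (blk 0 m) <= 4^-1.
Proof.
rewrite -lee_fin -PtE//; apply: le_trans Plam; apply: le_measure; rewrite ?inE.
- exact: measurable_xit_preimage.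
- rewrite (_ : [set w | _] = xit xi @^-1` (blk 0 m)); first exact: measurable_xit_preimage.
  apply/seteqP; split => w /=.
    by move=> [j h]; apply/blkP; exists j => //=; rewrite ltn_ord.
  by move=> /blkP[j _ h]; exists j.
- by move=> w /blkP[j _ h]; exists j.
Qed.

Let count_moment (q : R) : 1 <= q ->
  (\int[P]_w (((1 + (num predT (xit xi w))%:R)%:E `^ q)) <= (poisson_const q `^ q)%:E)%E.
Proof.
move=> q1; rewrite -[X in (X `^ q)%:E]mulr1.
apply: (@runs_moment _ _ _ _ _ P m xi ind blk _ _ _ _ _ (fun x => (1 + (num predT x)%:R)%:E)) => //.
- move=> a b x y xy /blkP[j ab bj]; apply/blkP; exists j => //.
  by apply: big_eq bj; apply: xy; rewrite finset.inE.
- move=> a b a' b' aa bb x /blkP[j /andP[aj jb] bj]; apply/blkP; exists j => //.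
  by rewrite (leq_trans aa aj) (leq_trans jb bb).
- move=> a; apply/seteqP; split => // x /blkP[j /andP[aj ja]].
  by move: (leq_ltn_trans aj ja); rewrite ltnn.
- by apply/measurable_EFinP; apply: measurable_funD => //; exact: mnum.
- move=> l x nr; rewrite lee_fin mulr1 -natr1 addrC lerD2r ler_nat.
  apply: leq_trans (num_le nr); rewrite /num [leqRHS](eq_bigl predT)//.
Qed.

Let others j x := num [pred i : 'I_m | i != j] x.

Let num_others j x : big j x -> num predT x = (1 + others j x)%N.
Proof. by move=> bj; rewrite /num (bigD1 j)//= (asboolT bj). Qed.

(** The sum is at most its largest term, attained at some [i], times the number 1 + [others i] of
    large entries. The second factor does not involve the coordinate [i], and the sum over all [j]
    avoids naming the random maximizer. *)
Let sum_le (q : R) x : 1 <= q ->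
  ((\sum_j Y j x) `^ q <= \sum_j (Y j x `^ q * ((1 + (others j x)%:R)%:E `^ q)))%E.
Proof.
move=> q1; have q0 : 0 <= q by lra.
have rhs0 j : (0 <= Y j x `^ q * ((1 + (others j x)%:R)%:E `^ q))%E.
  by apply: mule_ge0; exact: poweR_ge0.
have [[j0 bj0]|none] := pselect (exists j, big j x); last first.
  rewrite big1 ?poweR0r ?gt_eqF ?(lt_le_trans ltr01)//; first exact: sume_ge0.
  by move=> j _; rewrite YE; case: asboolP => // h; exfalso; apply: none; exists j.
have [i bi imax] := @Order.TotalTheory.arg_maxP _ _ _ j0 (fun j => `[< big j x >]) (fun j => peak j x)
  (introT (asboolP _) bj0).
apply: (@le_trans _ _ (Y i x `^ q * ((1 + (others i x)%:R)%:E `^ q))%E); last first.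
  by rewrite (bigD1 i)//=; apply: leeDl; exact: sume_ge0.
rewrite -poweRM//.
apply: le_poweR => //; first exact: sume_ge0.
apply: (@le_trans _ _ (\sum_(j < m) (peak i x * (`[< big j x >]%:R)%:E))%E).
  apply: lee_sum => j _; rewrite YE; case: asboolP => h; last by rewrite mule0.
  by rewrite mule1; apply: imax; apply/asboolP.
rewrite -ge0_sume_distrr; last by move=> j _; rewrite lee_fin.
rewrite YE bi; apply: lee_wpmul2l => //.
rewrite sumEFin lee_fin -natr_sum -[X in X + _]/(1%:R) -natrD ler_nat.
by have := num_others (asboolW bi); rewrite /num add1n => <-.
Qed.

(* A peak [> lam] at [j] is independent of the number of peaks at the other
   coordinates, which has Poisson-like moments. *)
Lemma sparse_moment (Phi : W -> \bar R) (q : R) : 1 <= q -> measurable_fun setT Phi ->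
  (forall w, 0 <= Phi w)%E -> (forall j w, peak j (xit xi w) `^ q <= Phi w)%E ->
  (\int[P]_w ((\sum_j (if (lam%:E < peak j (xit xi w))%E then peak j (xit xi w) else 0)) `^ q)
    <= (2 * poisson_const q `^ q)%:E * \int[P]_w Phi w)%E.
Proof.
move=> q1 mPhi Phi0 PPhi; have mx := measurable_xit xi; have q0 : 0 <= q by lra.
have C0 : 0 <= poisson_const q `^ q by exact: powR_ge0.
have YS w : (\sum_j (if (lam%:E < peak j (xit xi w))%E then peak j (xit xi w) else 0) =
    \sum_j Y j (xit xi w))%E.
  by apply: eq_bigr => j _; rewrite YE /big/= asboolb.
under eq_integral do rewrite YS.
have mc (S : {pred 'I_m}) : measurable_fun setT (fun x => ((1 + (num S x)%:R)%:E `^ q : \bar R)%E).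
  by apply: measurable_poweR_comp; apply/measurable_EFinP; apply: measurable_funD => //; exact: mnum.
have mYq j : measurable_fun setT (fun x => (Y j x `^ q)%E) by exact: measurable_poweR_comp.
have mYqx j : measurable_fun setT (fun w => (Y j (xit xi w) `^ q)%E) by exact: (measurableT_comp (mYq j) mx).
pose f j x : \bar R := (Y j x `^ q * ((1 + (others j x)%:R)%:E `^ q))%E.
have mf j : measurable_fun setT (f j) by apply: emeasurable_funM; [exact: mYq|exact: mc].
have f0 j x : (0 <= f j x)%E by apply: mule_ge0; exact: poweR_ge0.
apply: (@le_trans _ _ (\int[P]_w \sum_j f j (xit xi w))%E).
  apply: ge0_le_integral => //.
  - by move=> w _; exact: poweR_ge0.
  - apply: measurable_poweR_comp; apply: emeasurable_sum => j.
    by apply: measurableT_comp; [exact: mY|exact: mx].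
  - by apply: emeasurable_sum => j; apply: measurableT_comp; [exact: mf|exact: mx].
  - by move=> w _; exact: sum_le.
have mfx j : measurable_fun setT (fun w => f j (xit xi w)).
  by apply: measurableT_comp; [exact: mf|exact: mx].
rewrite (@ge0_integral_sum _ W R P setT measurableT _ (fun j w => f j (xit xi w)) mfx (fun j w _ => f0 j _)).
have yo j w w' : Y j (mix xi [set j]%SET (w, w')) = Y j (xit xi w).
  by apply: Y_eq; rewrite mixE tnth_mktuple finset.inE eqxx.
have oo j w w' : others j (mix xi [set j]%SET (w, w')) = others j (xit xi w').
  apply: num_eq => i; rewrite inE => ij.
  by rewrite mixE tnth_mktuple finset.inE (negbTE ij).
pose EY j := (\int[P]_w (Y j (xit xi w) `^ q))%E.
have EY0 j : (0 <= EY j)%E by apply: integral_ge0 => w _; exact: poweR_ge0.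
have step1 j : (\int[P]_w f j (xit xi w) <= EY j * (poisson_const q `^ q)%:E)%E.
  rewrite (@mix_law _ _ _ _ _ P m xi ind [set j]%SET (f j))//.
  apply: (@le_trans _ _ (\int[P]_w (Y j (xit xi w) `^ q * (poisson_const q `^ q)%:E))%E).
    apply: ge0_le_integral => //.
    - by move=> w _; apply: integral_ge0.
    - apply: (@measurable_fun_fubini_tonelli_F _ _ _ _ _ P (fun z => f j (mix xi [set j]%SET z))) => //.
      by apply: measurableT_comp; [exact: mf|exact: measurable_mix].
    - by apply: emeasurable_funM => //; exact: mYqx.
    - move=> w _; rewrite /f; under eq_integral => w' _ do rewrite yo oo.
      rewrite ge0_integralZl ?poweR_ge0//; last 2 first.
        exact: (measurableT_comp (mc _) mx).
        by move=> w' _; exact: poweR_ge0.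
      apply: lee_wpmul2l; first exact: poweR_ge0.
      apply: le_trans (count_moment q1); apply: ge0_le_integral => //.
      + by move=> w' _; exact: poweR_ge0.
      + exact: (measurableT_comp (mc _) mx).
      + exact: (measurableT_comp (mc _) mx).
      + move=> w' _; apply: le_poweR => //.
        rewrite lee_fin lerD2l ler_nat /others /num [leqLHS]big_mkcond.
        by apply: leq_sum => i _; case: ifP.
  rewrite ge0_integralZr//.
  by move=> w _; exact: poweR_ge0.
apply: le_trans (lee_sum _ (fun j _ => step1 j)) _.
rewrite -ge0_sume_distrl// [leLHS]muleC [(2 * _)%R]mulrC EFinM -[leRHS]muleA.
apply: lee_wpmul2l; first by rewrite lee_fin.
pose none : set (m.-tuple Omega) := ~` blk 0 m.
(* At each sample at most one [g j] is nonzero, so that their sum is at most [Phi], however large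
   [m] is. Independence costs the factor 3/4, a lower bound for the probability that no other entry
   is large. *)
pose g j x : \bar R := (Y j x `^ q * (\1_(fun x => others j x = 0%N) x)%:E)%E.
have mo j : measurable (fun x => others j x = 0%N).
  rewrite (_ : (fun x => _) = (fun x => (others j x)%:R : R) @^-1` [set 0]).
    by rewrite -[X in measurable X]setTI; apply: (mnum _) => //.
  by apply/seteqP; split => x /=; [move=> ->|move/eqP; rewrite pnatr_eq0 => /eqP].
have mg j : measurable_fun setT (g j).
  by apply: emeasurable_funM => //; apply/measurable_EFinP; exact: measurable_indic.
have g0 j x : (0 <= g j x)%E by apply: mule_ge0 => //; exact: poweR_ge0.
have mxC (A : set (m.-tuple Omega)) : measurable A -> measurable_fun setT (fun w => (\1_A (xit xi w))%:E : \bar R).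
  move=> mA; apply/measurable_EFinP; apply: measurableT_comp; last exact: mx.
  exact: measurable_indic.
have step2 j : (EY j * (3 / 4)%:E <= \int[P]_w g j (xit xi w))%E.
  rewrite (@mix_law _ _ _ _ _ P m xi ind [set j]%SET (g j))//.
  rewrite -ge0_integralZr//; last by move=> w _; exact: poweR_ge0.
  apply: ge0_le_integral => //.
  - by move=> w _; apply: mule_ge0 => //; exact: poweR_ge0.
  - by apply: emeasurable_funM => //; exact: mYqx.
  - apply: (@measurable_fun_fubini_tonelli_F _ _ _ _ _ P (fun z => g j (mix xi [set j]%SET z))) => //.
    by apply: measurableT_comp; [exact: mg|exact: measurable_mix].
  - move=> w _; rewrite /g.
    under eq_integral => w' _.
      rewrite yo (_ : \1_(fun x => others j x = 0%N) _ = \1_(fun x => others j x = 0%N) (xit xi w')); last first.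
        rewrite !indicE; congr (nat_of_bool _)%:R; apply/idP/idP; rewrite !inE; rewrite /mem/= oo//.
      over.
    rewrite ge0_integralZl ?poweR_ge0//; last exact: mxC.
    apply: lee_wpmul2l; first exact: poweR_ge0.
    have -> : (\int[P]_w' (\1_(fun x => others j x = 0%N) (xit xi w'))%:E =
        P (xit xi @^-1` (fun x => others j x = 0%N)))%E.
      rewrite -[X in P X]setIT -integral_indic//; exact: measurable_xit_preimage.
    rewrite PtE// lee_fin; apply: (@le_trans _ _ (Pt xi none)).
      by rewrite Pt_setC//; move: Pblk; lra.
    apply: Pt_le => //; first exact: measurableC.
    move=> x nb; rewrite /others /num big1// => i _.
    by case: asboolP => // h; exfalso; apply: nb; apply/blkP; exists i => //=; rewrite ltn_ord.
apply: (@le_trans _ _ (2%:E * \int[P]_w (\sum_j g j (xit xi w)))%E).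
  have mgx j : measurable_fun setT (fun w => g j (xit xi w)).
    by apply: measurableT_comp; [exact: mg|exact: mx].
  rewrite (@ge0_integral_sum _ W R P setT measurableT _ (fun j w => g j (xit xi w)) mgx (fun j w _ => g0 j _)).
  rewrite ge0_sume_distrr; last by move=> j _; apply: integral_ge0.
  apply: lee_sum => j _; apply: le_trans (lee_wpmul2l _ (step2 j)); last by rewrite lee_fin.
  rewrite muleA muleC muleA -EFinM -[leLHS]mul1e; apply: lee_wpmul2r => //.
  by rewrite lee_fin; lra.
apply: lee_wpmul2l; first by rewrite lee_fin.
apply: ge0_le_integral => //.
- by move=> w _; exact: sume_ge0.
- by apply: emeasurable_sum => j; apply: measurableT_comp; [exact: mg|exact: mx].
- move=> w _; have [[i gi]|gn] := pselect (exists i, g i (xit xi w) != 0%E); last first.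
    rewrite big1// => j _; apply/eqP; apply: contrapT => /negP h; apply: gn; by exists j.
  have oi : others i (xit xi w) = 0%N.
    move: gi; rewrite /g indicE; case: (boolP (_ \in _)) => [|_]; first by rewrite inE.
    by rewrite mule0 eqxx.
  rewrite (bigD1 i)//= big1 ?adde0.
    apply: le_trans (PPhi i w); rewrite /g -[leRHS]mule1; apply: lee_pmul.
    - exact: poweR_ge0.
    - by rewrite lee_fin.
    - by apply: le_poweR => //; rewrite YE; case: ifP.
    - by rewrite lee_fin indicE lern1 leq_b1.
  move=> j ji; rewrite /g (_ : Y j _ = 0%E) ?poweR0r ?mul0e// ?gt_eqF ?(lt_le_trans ltr01)//.
  rewrite YE; case: asboolP => // bj; exfalso.
  move: oi; rewrite /others /num (bigD1 j)//= (asboolT bj)//.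
Qed.

End SparseMoment.

(** * The chaining functional of the sample *)

Section Partition.
Context {V : Type} (T : set V) (A : set (set V)).
Hypothesis part : partition A id T.

Lemma pblockP x : T x -> A (pblock A id x) /\ pblock A id x x.
Proof.
have [cov _ _] := part; rewrite -cov => -[B AB Bx].
by apply: (@getPex _ [set i | A i /\ i x]); exists B.
Qed.

Lemma pblock_unique B x : T x -> A B -> B x -> pblock A id x = B.
Proof.
move=> Tx AB Bx; have [h1 h2] := pblockP Tx; have [_ tr _] := part.
by apply: tr => //; exists x.
Qed.

End Partition.

Section AdmissibleCode.
Context {V I : Type} (T : set V) (A : nat -> set (set V)) (emb : I -> V).
Hypotheses (adm : admissible T A) (embT : forall f, T (emb f)).

Lemma admissible_code (n1 : nat) : exists c : nat -> I -> nat,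
  [/\ forall i f, (c i f < 2 ^ (2 ^ (n1 + i)))%N,
      forall i f g, c i.+1 f = c i.+1 g -> c i f = c i g &
      forall i f g, c i f = c i g ->
        pblock (A (n1 + i)) id (emb f) = pblock (A (n1 + i)) id (emb g)].
Proof.
pose blk i f := pblock (A (n1 + i)) id (emb f).
have part i : partition (A i) id T by case: (adm i).
have blkA i f : A (n1 + i)%N (blk i f) by case: (pblockP (part (n1 + i)%N) (embT f)).
have blkf i f : blk i f (emb f) by case: (pblockP (part (n1 + i)%N) (embT f)).
have num n : exists2 g : set V -> nat, set_fun (A n) `I_(adm_card n) g & set_inj (A n) g.
  by case: (adm n) => _ /pcard_leP h _; exact/injfunPex.
pose g n := sval (cid2 (num n)).
have gP n : set_fun (A n) `I_(adm_card n) (g n) /\ set_inj (A n) (g n).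
  by rewrite /g; case: cid2.
have blkE i f f' : g (n1 + i)%N (blk i f) = g (n1 + i)%N (blk i f') -> blk i f = blk i f'.
  by move=> h; have [_ inj] := gP (n1 + i)%N; apply: inj h; rewrite inE; exact: blkA.
exists (fun i f => g (n1 + i)%N (blk i f)); split => //.
  move=> i f; have [fn _] := gP (n1 + i)%N; have := fn _ (blkA i f) => /= h.
  (* [adm_card] is 1 at level 0 and 2^(2^n) afterwards, so that 2^(2^n) is a bound at every
     level. *)
  by apply: leq_trans h _; case: (n1 + i)%N.
move=> i f f'; move=> /blkE h; congr (g _ _).
have [_ _ nest] := adm (n1 + i); have := blkA i.+1 f; rewrite addnS => /nest[B AB sub].
rewrite /blk (pblock_unique (part _) _ AB) ?(pblock_unique (part _) _ AB)//.
- by apply: sub; rewrite h; exact: blkf.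
- by apply: sub; exact: blkf.
Qed.

End AdmissibleCode.

Section Peak.
Context {R : realType} {Omega : Type} {m : nat}.
Variables (p p0 : R) (F : set (Omega -> R[i])) (x : 'I_m -> Omega).
Hypotheses (p2 : 2 <= p) (p01 : 1 < p0) (p0p : p0 <= p).
Local Open Scope ereal_scope.

Lemma cmod_ge0 (z : R[i]) : (0 <= cmod z)%R.
Proof. by case: z => a b /=; exact: sqrtr_ge0. Qed.

Lemma sup_unif_ge f : F f -> (disc_norm +oo f x `^ (p - p0))%:E <= sup_unif p p0 F x.
Proof. by move=> Ff; apply: ereal_sup_ubound; exists f. Qed.

Lemma sup_unif_ge_at f j : F f -> (cmod (f (x j)) `^ (p - p0))%:E <= sup_unif p p0 F x.
Proof.
move=> Ff; apply: le_trans (sup_unif_ge Ff); rewrite lee_fin; apply: powR_le.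
- by rewrite subr_ge0.
- exact: cmod_ge0.
- by apply: (@le_bigmax_cond _ _ _ _ _ xpredT (fun j => cmod (f (x j)))).
Qed.

(** For p0 < p one coordinate is at most m^(1/p1) times the normalized l_p1 norm, and p0 / p1 = 1 -
    p0 / p. *)
Lemma disc_norm_at (f : Omega -> R[i]) j :
  (cmod (f (x j)) `^ p0 <= m%:R `^ (1 - p0 / p) * disc_norm (conj_p1 p p0) f x `^ p0)%R.
Proof.
have pp : (0 < p)%R by move: p2; lra.
have p00 : (0 < p0)%R by move: p01; lra.
rewrite /conj_p1; case: eqVneq => [->|pn].
  rewrite divff ?gt_eqF// subrr powRr0 mul1r; apply: powR_le; [exact: ltW|exact: cmod_ge0|].
  by apply: (@le_bigmax_cond _ _ _ _ _ xpredT (fun j => cmod (f (x j)))).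
have pp0 : (0 < p - p0)%R by rewrite subr_gt0 lt_neqAle pn.
set p1 := (p * p0 / (p - p0))%R; have p10 : (0 < p1)%R by rewrite !divr_gt0 ?mulr_gt0.
have m0 : (0 < m%:R :> R)%R by rewrite ltr0n (leq_ltn_trans _ (ltn_ord j)).
rewrite /= -powRrM; have -> : (p1^-1 * p0 = 1 - p0 / p)%R by rewrite /p1; field; rewrite !gt_eqF.
rewrite -powRM ?(ltW m0)//; last first.
  by rewrite mulr_ge0 ?invr_ge0 ?(ltW m0)// sumr_ge0// => i _; exact: powR_ge0.
rewrite mulrA divff ?gt_eqF// mul1r.
have -> : (1 - p0 / p = p1^-1 * p0)%R by rewrite /p1; field; rewrite !gt_eqF.
rewrite powRrM; apply: powR_le; [exact: ltW|exact: cmod_ge0|].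
rewrite -[leLHS](@powRK _ _ p1) ?cmod_ge0 ?gt_eqF//.
apply: powR_le; rewrite ?invr_ge0 ?(ltW p10) ?powR_ge0//.
rewrite (bigD1 j)//= lerDl sumr_ge0// => i _; exact: powR_ge0.
Qed.

Lemma integrandA_ge f g j : F f -> F g ->
  (cmod (f (x j)) `^ (p - p0) * disc_norm (conj_p1 p p0) g x `^ p0)%:E <= integrandA p p0 F x.
Proof.
move=> Ff Fg; rewrite EFinM; apply: lee_pmul; rewrite ?lee_fin ?powR_ge0//.
  exact: sup_unif_ge_at.
by apply: ereal_sup_ubound; exists g.
Qed.

Lemma peak_le_integrandA f j : F f ->
  (cmod (f (x j)) `^ p)%:E <= (m%:R `^ (1 - p0 / p))%:E * integrandA p p0 F x.
Proof.
move=> Ff; have [f0|fn0] := eqVneq (cmod (f (x j))) 0%R.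
  rewrite f0 powR0; last by rewrite gt_eqF//; move: p2; lra.
  apply: mule_ge0; first by rewrite lee_fin powR_ge0.
  by apply: le_trans (integrandA_ge j Ff Ff); rewrite lee_fin mulr_ge0 ?powR_ge0.
apply: le_trans (lee_wpmul2l _ (integrandA_ge j Ff Ff)); last by rewrite lee_fin powR_ge0.
rewrite -EFinM lee_fin mulrCA.
have -> : (cmod (f (x j)) `^ p = cmod (f (x j)) `^ (p - p0) * cmod (f (x j)) `^ p0)%R.
  rewrite -powRD; first by rewrite subrK.
  by rewrite fn0 implybT.
by rewrite ler_wpM2l ?powR_ge0// disc_norm_at.
Qed.

End Peak.

Lemma powR_const_le {R : realType} (a b H r p p0 : R) : 1 <= a -> a <= b -> 0 < H -> 0 < r ->
  1 < p0 -> 0 < p -> (a * H `^ (p0 / p)) `^ (r / p0) <= (b * H `^ p^-1) `^ r.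
Proof.
move=> a1 ab H0 r0 p01 pp; have p00 : 0 < p0 by lra.
have a0 : 0 <= a by lra.
rewrite [r / p0]mulrC [leLHS]powRrM; apply: powR_le; [exact: ltW|exact: powR_ge0|].
rewrite [p0 / p]mulrC powRrM powRM; [|exact: a0|exact: powR_ge0].
rewrite powRK ?powR_ge0 ?gt_eqF// ler_wpM2r ?powR_ge0//; apply: le_trans ab.
by rewrite -[leRHS]powRr1// ler_powR// invf_le1// ltW.
Qed.

Lemma chain_C_ge0 {R : realType} (p : R) : 2 <= p -> 0 <= chain_C p.
Proof.
move=> p2; have pp : 0 < p by lra.
have h : 2 `^ (- p^-1) < 1 :> R.
  by rewrite powR2E expR_lt1 mulNr oppr_lt0 mulr_gt0 ?invr_gt0// ln_gt0// ltr1n.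
have Cw0 : 0 <= chain_Cw p.
  have h1 : 0 <= 2 `^ p :> R by exact: powR_ge0.
  have h2 : 0 <= 5 / (1 - 2 `^ (- p^-1)) :> R by rewrite divr_ge0// subr_ge0 ltW.
  by rewrite /chain_Cw !addr_ge0 ?mulr_ge0//; lra.
by have := mulr_ge0 (ltW pp) Cw0; rewrite /chain_C; lra.
Qed.

Section ChainPoint.
Context {R : realType} {Omega : Type} {m : nat}.
Variables (p p0 H Lam : R) (m0 n1 k : nat) (F : set (Omega -> R[i]))
  (x : 'I_m -> Omega) (b : pred 'I_m).
Hypotheses (p2 : 2 <= p) (p01 : 1 < p0) (p0p : p0 <= p) (H0 : 0 < H) (m1 : (0 < m)%N)
  (m0_ge : (2 ^ n1 <= m0)%N) (m_le : (m <= 2 ^ (n1 + k).+1)%N) (Lam1 : 1 <= Lam)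
  (F0 : F (fun=> 0))
  (hA : (integrandA p p0 F x <= (24 * H `^ (p0 / p))%:E)%E)
  (hB : (integrandB p p0 F x <= (24 * (H * m0%:R) `^ (p0 / p))%:E)%E)
  (hS : forall f, F f -> \sum_(j | b j) cmod (f (x j)) `^ p <= m%:R * Lam).

(** The factor 48 is twice the 24 of [hB]: the slack leaves room for an admissible sequence that
    only nearly attains the infimum in the chaining functional. *)
Definition chain_radius : R := 48 * (H * m0%:R) `^ p^-1.

Definition chain_bound : R := chain_C p * chain_radius * (m%:R * Lam) `^ (1 - p^-1)
  * chain_W p (m%:R * Lam) chain_radius k.+1%:R `^ (1 - p0^-1).

Local Notation D := chain_radius.
Local Notation kap := (p0^-1 - p^-1).
Let pp : 0 < p. Proof. by move: p2; lra. Qed.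
Let p00 : 0 < p0. Proof. by move: p01; lra. Qed.
Let mp : 0 < m%:R :> R. Proof. by rewrite ltr0n. Qed.
Let m0p : 0 < m0%:R :> R.
Proof. by rewrite ltr0n (leq_trans _ m0_ge)// expn_gt0. Qed.
Let Hm0 : 0 < H * m0%:R. Proof. by rewrite mulr_gt0. Qed.
Let D0 : 0 < D. Proof. by rewrite mulr_gt0// powR_gt0. Qed.

Section WithBound.
Variable M : R.
Hypotheses (M0 : 0 < M) (M_ub : forall f j, F f -> cmod (f (x j)) <= M)
  (M_unif : ((M `^ (p - p0))%:E <= sup_unif p p0 F x)%E).

Let rho (u v : 'rV[R[i]]_m) : R := ell_norm (conj_p1 p p0) (u - v).
Let emb (f : Omega -> R[i]) : 'rV[R[i]]_m := \row_j f (x j).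

Let rho_ge0 u v : 0 <= rho u v.
Proof.
rewrite /rho /conj_p1; case: ifP => _ /=; last exact: powR_ge0.
by elim/big_ind: _ => // [a c a0 c0|j _]; [rewrite le_max a0|exact: cmod_ge0].
Qed.

Let diam_ge0 (B : set 'rV[R[i]]_m) u : B u -> (0 <= diam rho B)%E.
Proof.
move=> Bu; apply: (@le_trans _ _ (rho u u)%:E); first by rewrite lee_fin.
by apply: ereal_sup_ubound; exists (u, u).
Qed.

Let kapp : kap * p0 = 1 - p0 / p. Proof. by field; rewrite !gt_eqF. Qed.

Let kapV : p0 != p -> p * p0 / (p - p0) = kap^-1.
Proof.
move=> pn; have pp0 : 0 < p - p0 by rewrite subr_gt0 lt_neqAle pn.
have -> : kap = (p - p0) / (p * p0) by field; rewrite !gt_eqF.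
by rewrite invf_div.
Qed.

Let kap_ge0 : 0 <= kap.
Proof. by rewrite subr_ge0 lef_pV2. Qed.

(* Rescales distances in [l_{p1}^m] to the radii of [lp1_le]. *)
Let cf : R := M `^ (p * kap) * m%:R `^ (- kap).

Let cfp : 0 < cf. Proof. by rewrite mulr_gt0// powR_gt0. Qed.
Let cf0 : 0 <= cf. Proof. exact: ltW. Qed.

Let cfE : cf `^ p0 = M `^ (p - p0) * (m%:R `^ (p^-1 - p0^-1)) `^ p0.
Proof.
rewrite /cf powRM; [|exact: powR_ge0|exact: powR_ge0]; rewrite -[(M `^ _) `^ _]powRrM.
have -> : p * kap * p0 = p - p0 by field; rewrite !gt_eqF.
by rewrite opprB.
Qed.

Let lp1_le_rho (d : 'I_m -> R) (z : 'rV[R[i]]_m) t : (forall j, d j = cmod (z 0 j)) ->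
  ell_norm (conj_p1 p p0) z <= t -> lp1_le p p0 M d (cf * t).
Proof.
move=> dz zt; rewrite /lp1_le /cf; move: zt; rewrite /conj_p1; case: eqVneq => [->|pn] zt.
  move=> j; rewrite subrr mulr0 oppr0 !powRr0 !mul1r dz; apply: le_trans zt.
  by apply: (@le_bigmax_cond _ _ _ _ _ xpredT (fun j => cmod (z 0 j))).
have pp0 : 0 < p - p0 by rewrite subr_gt0 lt_neqAle pn.
have k0 : 0 < kap by rewrite subr_gt0 ltf_pV2// lt_neqAle pn.
move: zt => /=; rewrite kapV//.
rewrite invrK => zt.
have S0 : 0 <= \sum_(j < m) cmod (z 0 j) `^ kap^-1 by apply: sumr_ge0 => j _; exact: powR_ge0.
have t0 : 0 <= t by apply: le_trans zt; exact: powR_ge0.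
rewrite (eq_bigr (fun j => cmod (z 0 j) `^ kap^-1)); last by move=> j _; rewrite dz.
rewrite !powRM ?mulr_ge0 ?powR_ge0//; rewrite -!powRrM mulfK ?gt_eqF// mulNr divff ?gt_eqF//.
rewrite powRN powRr1 ?ler0n// [m%:R * _]mulrA [m%:R * _]mulrCA divff ?gt_eqF// mulr1.
rewrite ler_wpM2l ?powR_ge0//.
rewrite -[leLHS](@powRVK _ _ kap^-1) ?invr_eq0 ?gt_eqF// invrK.
by apply: powR_le; rewrite ?invr_ge0 ?(ltW k0) ?powR_ge0.
Qed.

(** Why the chain may start at level n1: as 2^n1 <= m0, the radius D e_0 is at least 48 H^(1/p), and
    [hA] alone places every function of the class within it. *)
Let start_le f : F f -> lp1_le p p0 M (fun j => cmod (f (x j))) (D * lev p n1 0).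
Proof.
move=> Ff.
have h : M `^ (p - p0) * disc_norm (conj_p1 p p0) f x `^ p0 <= 24 * H `^ (p0 / p).
  rewrite -lee_fin; apply: le_trans hA; rewrite EFinM.
  apply: lee_pmul; rewrite ?lee_fin ?powR_ge0//.
  by apply: ereal_sup_ubound; exists f.
have Dl : 48 * H `^ p^-1 <= D * lev p n1 0.
  rewrite /chain_radius /lev addn0 powRN powRM ?(ltW H0) ?ler0n// mulrA -mulrA ler_peMr ?mulr_ge0 ?powR_ge0//.
  rewrite ler_pdivlMr ?powR_gt0// mul1r powRrM; apply: powR_le; rewrite ?powR_ge0 ?invr_ge0 ?(ltW pp)//.
  by rewrite powR_mulrn// -natrX ler_nat.
have D0' : 0 <= D * lev p n1 0 by apply: le_trans Dl; rewrite mulr_ge0// powR_ge0.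
move: h; rewrite /lp1_le /conj_p1; case: eqVneq => [pE|pn].
  rewrite pE subrr powRr0 mul1r divff ?gt_eqF// powRr1 ?(ltW H0)//= => h j.
  apply: le_trans Dl; rewrite -(@powR_leE _ _ _ p) ?cmod_ge0 ?mulr_ge0 ?powR_ge0//.
  rewrite powRM ?powR_ge0// powRVK ?(ltW H0) ?gt_eqF//.
  apply: (@le_trans _ _ (24 * H)).
    apply: le_trans h; apply: powR_le; [exact: ltW|exact: cmod_ge0|].
    by apply: (@le_bigmax_cond _ _ _ _ _ xpredT (fun j => cmod (f (x j)))).
  rewrite ler_pM2r//; apply: (@le_trans _ _ (48 `^ 1)); first by rewrite powRr1//; lra.
  by rewrite ler_powR//; move: p2; lra.
have pp0 : 0 < p - p0 by rewrite subr_gt0 lt_neqAle pn.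
have k0 : 0 < kap by rewrite subr_gt0 ltf_pV2// lt_neqAle pn.
rewrite /= kapV// invrK => h.
set S := \sum_(j < m) _ in h *.
have S0 : 0 <= S by apply: sumr_ge0 => j _; exact: powR_ge0.
have r0 : 0 < kap^-1 / p0 by rewrite divr_gt0// invr_gt0.
have E1 : (M `^ (p - p0) * ((m%:R^-1 * S) `^ kap) `^ p0) `^ (kap^-1 / p0) = M `^ p * (m%:R^-1 * S).
  rewrite powRM; [|exact: powR_ge0|exact: powR_ge0]; rewrite -!powRrM.
  have -> : (p - p0) * (kap^-1 / p0) = p by rewrite -kapV//; field; rewrite !gt_eqF.
  have -> : kap * (p0 * (kap^-1 / p0)) = 1.
    by rewrite [p0 * _]mulrC divfK ?gt_eqF// divff ?gt_eqF.
  by rewrite powRr1// mulr_ge0 ?invr_ge0 ?ler0n.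
have := powR_le (ltW r0) (mulr_ge0 (powR_ge0 M (p - p0)) (powR_ge0 _ p0)) h.
rewrite E1 => h2.
have -> : M `^ p * S = m%:R * (M `^ p * (m%:R^-1 * S)) by field; rewrite gt_eqF.
apply: ler_wpM2l; [exact: ler0n|apply: le_trans h2 _].
apply: (@le_trans _ _ ((48 * H `^ p^-1) `^ kap^-1)); last first.
  by apply: powR_le; rewrite ?invr_ge0 ?mulr_ge0 ?powR_ge0.
by apply: powR_const_le => //; [rewrite ler1n|rewrite ler_nat|rewrite invr_gt0].
Qed.

Let gamma_adm : exists2 A, admissible (sample_image F x) A &
  forall f, F f -> (\sum_(0 <= n <oo)
    ((2 `^ (n%:R / p))%:E * diam rho (pblock (A n) id (emb f))) `^ p0 <=
    (D `^ p0 / cf `^ p0)%:E)%E.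
Proof.
set X := (H * m0%:R) `^ (p0 / p).
have X0 : 0 < X by rewrite powR_gt0.
have DX : 48 * X <= D `^ p0.
  rewrite /chain_radius powRM ?powR_ge0// -powRrM [p^-1 * _]mulrC ler_wpM2r ?powR_ge0//.
  rewrite -{1}[48]powRr1// ler_powR//; [lra|by move: p01; lra].
pose term A n u := (((2 `^ (n%:R / p))%:E * diam rho (pblock (A n) id u)) `^ p0)%E.
pose G := [set ereal_sup [set (\sum_(0 <= n <oo) term A n u)%E | u in sample_image F x]
  | A in admissible (sample_image F x)].
have TF : sample_image F x (emb (fun=> 0)) by exists (fun=> 0).
have G0 : (0 <= ereal_inf G)%E.
  apply: le_ereal_inf_tmp => _ [A _ <-].
  apply: (@le_trans _ _ (\sum_(0 <= n <oo) term A n (emb (fun=> 0%R)))%E).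
    by apply: nneseries_ge0 => n _ _; exact: poweR_ge0.
  by apply: ereal_sup_ubound; exists (emb (fun=> 0)).
have hG : ((cf `^ p0)%:E * ereal_inf G <= (24 * X)%:E)%E.
  apply: le_trans hB; rewrite /integrandB /gamma_disc /gamma -/rho -/G.
  rewrite poweRM ?poweR_ge0 ?lee_fin ?powR_ge0//.
  rewrite -poweRrM mulVf ?gt_eqF// poweRe1// poweR_EFin cfE EFinM -muleA.
  apply: lee_wpmul2r; last exact: M_unif.
  by rewrite mule_ge0// lee_fin powR_ge0.
have : (ereal_inf G < (48 * X / cf `^ p0)%:E)%E.
  rewrite ltNge; apply/negP => h.
  have : ((cf `^ p0)%:E * (48 * X / cf `^ p0)%:E <= (24 * X)%:E)%E.
    by apply: le_trans hG; apply: lee_wpmul2l; [rewrite lee_fin powR_ge0|exact: h].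
  rewrite -EFinM lee_fin mulrC divfK ?gt_eqF ?powR_gt0//; move: X0; lra.
move=> /ereal_inf_lt[_ [A adm <-] h]; exists A => // f Ff.
apply: (@le_trans _ _ (48 * X / cf `^ p0)%:E); last first.
  by rewrite lee_fin ler_pM2r// invr_gt0 powR_gt0.
by apply: le_trans (ltW h); apply: ereal_sup_ubound; exists (emb f) => //; exists f.
Qed.

Lemma chain_point_pos :
  \sum_eps `[< exists2 f, F f & chain_bound <
     `|rsum eps (fun j => if b j then cmod (f (x j)) `^ p else 0)| >]%:R <= 2 ^+ m / 16 :> R.
Proof.
have w00 : 0 < m%:R * Lam by rewrite mulr_gt0// (lt_le_trans ltr01).
have [A adm hsum] := gamma_adm.
pose I := {f : Omega -> R[i] | F f}.
pose embI (f : I) := emb (sval f).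
have embT f : sample_image F x (embI f) by exists (sval f) => //; exact: (svalP f).
have [c [c_lt c_nest c_blk]] := admissible_code adm embT n1.
pose blk i (f : I) := pblock (A (n1 + i)%N) id (embI f).
have part i : partition (A i) id (sample_image F x) by case: (adm i).
have blkP i f : A (n1 + i)%N (blk i f) /\ blk i f (embI f) by apply: (pblockP (part _)).
pose term n (f : I) := (((2 `^ (n%:R / p))%:E * diam rho (pblock (A n) id (embI f))) `^ p0)%E.
have term0 n f : (0 <= term n f)%E by exact: poweR_ge0.
have psum n f : (\sum_(0 <= i < n) term i f <= (D `^ p0 / cf `^ p0)%:E)%E.
  apply: le_trans (hsum _ (svalP f)).
  by apply: (@nneseries_lim_ge _ (fun n => term n f) xpredT) => // i _ _; exact: term0.
(* A finite chaining sum forces every diameter along the chain to be finite. *)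
have dfin i f : (diam rho (blk i f) = (fine (diam rho (blk i f)))%:E)%E.
  have d0 : (0 <= diam rho (blk i f))%E by case: (blkP i f) => _ /diam_ge0.
  rewrite fineK// ge0_fin_numE//.
  have : (term (n1 + i)%N f < +oo)%E.
    apply: (@le_lt_trans _ _ (D `^ p0 / cf `^ p0)%:E); last by rewrite ltry.
    apply: le_trans (psum (n1 + i).+1 f).
    by rewrite big_nat_recr//=; apply: leeDr; apply: sume_ge0.
  move=> /lty_poweRy; rewrite gt_eqF// => /(_ isT).
  rewrite -/(blk i f); case: (diam rho (blk i f)) => [r| |]; rewrite ?ltry//.
  by rewrite gt0_muley ?lte_fin ?powR_gt0.
have dm0 i f : 0 <= fine (diam rho (blk i f)).
  by rewrite fine_ge0//; case: (blkP i f) => _ /diam_ge0.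
(* The radius has to be a function of the code. It is well defined because functions with equal
   codes lie in the same block. *)
pose t i code := if pselect (exists f, c i f = code) is left h
  then cf * fine (diam rho (blk i (sval (cid h)))) else 0.
have tE i f : t i (c i f) = cf * fine (diam rho (blk i f)).
  rewrite /t; case: pselect => [h|[]]; last by exists f.
  by case: (cid h) => g /= /c_blk; rewrite /blk => ->.
have W00 : m%:R <= m%:R * Lam by rewrite ler_peMr ?ler0n.
apply: le_trans (@chain_signs R m I p p0 M (m%:R * Lam) D k.+1%:R b
  (fun f j => cmod (sval f (x j))) (fun f g j => cmod (sval f (x j) - sval g (x j)))
  n1 k c t (exist _ _ F0) p2 p01 p0p M0 w00 W00 D0 _ (lexx _) _ _ _ _ c_lt c_nest _ _ _ _ _ _).
- apply: ler_sum => eps _; rewrite ler_nat; case: asboolP => [[f Ff h]|//].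
  by rewrite (asboolT (_ : exists f : I, _))//; exists (exist _ f Ff).
- by rewrite ler1n.
- by move=> f j; rewrite cmod_ge0 M_ub//; exact: (svalP f).
- by move=> f; apply: hS; exact: (svalP f).
- by move=> f g j; exact: cmod_ge0.
- move=> f g j; set u := sval f _; set v := sval g _.
  rewrite ler_norml; apply/andP; split.
    rewrite lerNl opprB lerBlDr.
    by have := le_normcD (v - u) u; rewrite subrK -[cmod (v - u)]normcN opprB.
  by rewrite lerBlDr; have := le_normcD (u - v) v; rewrite subrK.
- by move=> i y; rewrite /t; case: pselect => // h; rewrite mulr_ge0.
- move=> i f g cfg; rewrite tE; apply: (lp1_le_rho (z := embI f - embI g)) => //.
    by move=> j; rewrite !mxE.
  rewrite -lee_fin -dfin; apply: ereal_sup_ubound; exists (embI f, embI g) => //.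
  have [_ h1] := blkP i f; have [_ h2] := blkP i g; split => //=.
  by rewrite /blk (c_blk _ _ _ cfg).
- move=> i f; rewrite !tE ler_wpM2l// -lee_fin -!dfin.
  apply: ereal_sup_le => _ [[u v] [/= hu hv] <-]; exists (u, v) => //.
  have [h1 h2] := blkP i.+1 f; have [h3 h4] := blkP i f.
  have [_ _ nest] := adm (n1 + i)%N; rewrite addnS in h1; have [B AB sub] := nest _ h1.
  have -> : blk i f = B by apply: (pblock_unique (part _)) => //; apply: sub.
  by split; apply: sub.
- move=> f; apply: (@le_trans _ _ (cf `^ p0 * (D `^ p0 / cf `^ p0))); last first.
    by rewrite mulrC divfK// gt_eqF// powR_gt0.
  rewrite (eq_bigr (fun i : 'I_k.+1 => cf `^ p0 *
      (2 `^ ((n1 + i)%:R / p) * fine (diam rho (blk i f))) `^ p0)); last first.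
    move=> i _; rewrite tE -powRM ?mulr_ge0 ?powR_ge0//; congr (_ `^ _).
    by rewrite /lev powRN invrK; ring.
  rewrite -mulr_sumr ler_wpM2l ?powR_ge0// -lee_fin -sumEFin.
  apply: le_trans (psum (n1 + k.+1)%N f).
  rewrite (big_cat_nat (leq0n n1) (leq_addr _ _))/=.
  apply: (@le_trans _ _ (\sum_(n1 <= i < n1 + k.+1) term i f)%E); last first.
    by apply: leeDr; apply: sume_ge0.
  rewrite [X in (_ <= X)%E](_ : _ = \sum_(i < k.+1) term (n1 + i)%N f)%E; last first.
    rewrite -[X in (\sum_(X <= _ < _) _)%E]add0n big_addn addKn big_mkord.
    by apply: eq_bigr => i _; rewrite addnC.
  apply: lee_sum => i _.
  by rewrite /term -/(blk i f) dfin -EFinM poweR_EFin.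
- move=> f; exact: start_le (svalP f).
- by rewrite -natrX ler_nat.
Qed.

End WithBound.

Let vals : set R := [set r | exists f j, F f /\ r = cmod (f (x j))].
Let M := sup vals.

Let vals_has_sup : has_sup vals.
Proof.
split; first by exists (cmod (0 : R[i])), (fun=> 0), (Ordinal m1).
exists ((m%:R `^ (1 - p0 / p) * (24 * H `^ (p0 / p))) `^ p^-1) => _ [f [j [Ff ->]]].
rewrite -[leLHS](@powRK _ _ p) ?cmod_ge0 ?gt_eqF//.
apply: powR_le; rewrite ?powR_ge0 ?invr_ge0 ?(ltW pp)// -lee_fin.
apply: le_trans (@peak_le_integrandA _ _ _ p p0 F x p2 p01 p0p f j Ff) _.
by rewrite EFinM; apply: lee_wpmul2l => //; rewrite lee_fin powR_ge0.
Qed.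

Let le_M f j : F f -> cmod (f (x j)) <= M.
Proof. by move=> Ff; apply: sup_ubound => //; [case: vals_has_sup|exists f, j]. Qed.

Let M_ge0 : 0 <= M.
Proof. by apply: le_trans (le_M (Ordinal m1) F0); exact: cmod_ge0. Qed.

(** [M] need not be attained, so the bound is obtained by contradiction from a value close to it.
    For p0 = p it says 1 <= [sup_unif], a zero value to the power 0 being 1. *)
Let sup_unif_M : ((M `^ (p - p0))%:E <= sup_unif p p0 F x)%E.
Proof.
have [pE|pn] := eqVneq p0 p.
  rewrite pE subrr powRr0.
  by have := @sup_unif_ge_at _ _ _ p p0 F x p0p (fun=> 0) (Ordinal m1) F0; rewrite pE subrr powRr0.
have pp0 : 0 < p - p0 by rewrite subr_gt0 lt_neqAle pn.
rewrite leNgt; apply/negP => h.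
have u0 : (0 <= sup_unif p p0 F x)%E.
  apply: le_trans (@sup_unif_ge_at _ _ _ p p0 F x p0p (fun=> 0) (Ordinal m1) F0).
  by rewrite lee_fin powR_ge0.
move: u0 h; case E : (sup_unif p p0 F x) => [u| |]//; rewrite lee_fin lte_fin => u0 uM.
have : u `^ (p - p0)^-1 < M.
  rewrite -(@powR_ltE _ _ _ (p - p0)) ?powR_ge0// powRVK// gt_eqF//.
case: vals_has_sup => ne _ /(sup_gt ne)[_ [f [j [Ff ->]]]].
rewrite -(@powR_ltE _ _ _ (p - p0)) ?powR_ge0 ?cmod_ge0// powRVK// ?gt_eqF// => h.
by have := @sup_unif_ge_at _ _ _ p p0 F x p0p f j Ff; rewrite E lee_fin leNgt h.
Qed.

Lemma chain_point :
  \sum_eps `[< exists2 f, F f & chain_bound <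
     `|rsum eps (fun j => if b j then cmod (f (x j)) `^ p else 0)| >]%:R <= 2 ^+ m / 16 :> R.
Proof.
have w00 : 0 < m%:R * Lam by rewrite mulr_gt0// (lt_le_trans ltr01).
move: M_ge0; rewrite le_eqVlt => /predU1P[ME|M0].
  rewrite big1 ?divr_ge0 ?exprn_ge0//.
  move=> eps _; case: asboolP => // -[f Ff].
  rewrite /rsum big1 ?normr0 => [|j _].
    rewrite ltNge /chain_bound !mulr_ge0 ?powR_ge0 ?(ltW D0)//.
    exact: chain_C_ge0.
  have : cmod (f (x j)) <= 0 by rewrite ME le_M.
  have := cmod_ge0 (f (x j)) => h1 h2.
  have -> : cmod (f (x j)) = 0 by apply/le_anti; rewrite h1 h2.
  by rewrite powR0 ?gt_eqF// if_same mulr0.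
by apply: chain_point_pos M0 _ _ => //; exact: le_M.
Qed.

End ChainPoint.

(** * Moments of the discretization error *)

Section Mask.
Context {d d' : measure_display} {W : measurableType d} {Omega : measurableType d'}
  {R : realType} {m : nat} (K : set (Omega -> R)).
Hypotheses (m1 : (0 < m)%N) (K0 : K !=set0)
  (msup : forall c : 'I_m -> R, measurable_fun setT (wsup K c)).
Implicit Types (x : m.-tuple Omega) (lam : R).

Definition envelope y : \bar R := ereal_sup [set (`|h y|)%:E | h in K].

(** The cut is made at points of [Omega], not function by function: where some |h| exceeds [lam],
    the whole class is set to 0. Masked sums thus remain sums over independent coordinates, and the
    discarded entries are the rare peaks. *)
Definition mask lam : set (Omega -> R) :=
  [set (fun y => if (envelope y <= lam%:E)%E then h y else 0) | h in K].

Lemma peak_envelope j x : peak K j x = envelope (tnth x j).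
Proof.
congr ereal_sup; apply/seteqP; split => _ [h Kh <-]; exists h => //.
all: congr (`|_|%:E); rewrite (bigD1 j)//= eqxx mul1r big1 ?addr0// => i /negbTE ->.
all: by rewrite mul0r.
Qed.

Lemma measurable_envelope : measurable_fun setT envelope.
Proof.
pose cst_tuple y : m.-tuple Omega := [tuple y | _ < m].
have mc : measurable_fun setT cst_tuple.
  apply/measurable_fun_tnthP => i; rewrite (_ : _ \o _ = id)//.
  by apply/funext => y /=; rewrite tnth_mktuple.
rewrite (_ : envelope = peak K (Ordinal m1) \o cst_tuple).
  by apply: measurableT_comp => //; exact: msup.
by apply/funext => y /=; rewrite peak_envelope tnth_mktuple.
Qed.

Let cmask (c : 'I_m -> R) (S : {set 'I_m}) (j : 'I_m) : R := if j \in S then c j else 0.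

Lemma wsup_mask lam c x : wsup (mask lam) c x =
  wsup K (fun j => if (envelope (tnth x j) <= lam%:E)%E then c j else 0) x.
Proof.
congr ereal_sup; apply/seteqP; split.
  move=> _ [_ [g Kg <-] <-]; exists g => //; congr (`|_|%:E); apply: eq_bigr => j _.
  by case: ifP => _; rewrite ?mul0r ?mulr0.
move=> _ [h Kh <-]; exists (fun y => if (envelope y <= lam%:E)%E then h y else 0); first by exists h.
congr (`|_|%:E); apply: eq_bigr => j _.
by case: ifP => _; rewrite ?mul0r ?mulr0.
Qed.

(** For each of the finitely many patterns [S] of unmasked coordinates, the masked supremum
    coincides with a supremum over [K] whose weights vanish off [S]. *)
Lemma measurable_wsup_mask lam (c : 'I_m -> R) : measurable_fun setT (wsup (mask lam) c).
Proof.
pose ms (S : {set 'I_m}) : set (m.-tuple Omega) :=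
  \bigcap_(j in [set: 'I_m]) ((@tnth _ _ ^~ j) @^-1`
    (if j \in S then [set y | (envelope y <= lam%:E)%E] else [set y | (lam%:E < envelope y)%E])).
have mms S : measurable (ms S).
  apply: fin_bigcap_measurable => // j _; rewrite -[X in measurable X]setTI.
  apply: measurable_tnth => //; case: ifP => _; rewrite -[X in measurable X]setTI.
    by apply: emeasurable_fun_infty_c => //; exact: measurable_envelope.
  by apply: emeasurable_fun_o_infty => //; exact: measurable_envelope.
have msP S x : ms S x -> wsup (mask lam) c x = wsup K (cmask c S) x.
  move=> mx; rewrite wsup_mask; congr (wsup K _ x); apply/funext => j.
  rewrite /cmask; have := mx j Logic.I => /=; case: (j \in S) => /=; first by move=> ->.
  by rewrite ltNge => /negbTE ->.
move=> _ Y mY; rewrite setTI.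
rewrite (_ : _ @^-1` _ = \bigcup_(S in [set: {set 'I_m}]) (ms S `&` (wsup K (cmask c S)) @^-1` Y)).
  apply: fin_bigcup_measurable => // S _; apply: measurableI => //.
  by rewrite -[X in measurable X]setTI; apply: msup.
apply/seteqP; split => x /=.
  move=> Yx; exists [set j | (envelope (tnth x j) <= lam%:E)%E]%SET => //.
  have mx : ms [set j | (envelope (tnth x j) <= lam%:E)%E]%SET x.
    by move=> j _ /=; rewrite finset.inE; case: leP.
  by split => //=; rewrite -(msP _ _ mx).
by move=> [S _ [mx]]; rewrite /= -(msP _ _ mx).
Qed.

Lemma mask_nonempty lam : mask lam !=set0.
Proof. by case: K0 => h Kh; exists (fun y => if (envelope y <= lam%:E)%E then h y else 0); exists h. Qed.

Lemma mask_le lam h y : 0 <= lam -> mask lam h -> `|h y| <= lam.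
Proof.
move=> lam0 [g Kg <-]; case: ifP => [le|_]; last by rewrite normr0.
by rewrite -lee_fin; apply: le_trans le; apply: ereal_sup_ubound; exists g.
Qed.

Lemma measurable_mask lam h : (forall g, K g -> measurable_fun setT g) ->
  mask lam h -> measurable_fun setT h.
Proof.
move=> mK [g Kg <-]; apply: measurable_fun_ifT => //; last exact: mK.
apply: (measurable_fun_bool true).
rewrite (_ : _ @^-1` _ = [set y | (envelope y <= lam%:E)%E])//.
by apply: emeasurable_fun_infty_c => //; exact: measurable_envelope.
Qed.

Lemma wsup_le_mask lam c x : (forall j, `|c j| <= 1) ->
  (wsup K c x <= wsup (mask lam) c x +
    \sum_j (if (lam%:E < peak K j x)%E then peak K j x else 0))%E.
Proof.
move=> c1; apply: wsup_le => h Kh.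
pose hm y := if (envelope y <= lam%:E)%E then h y else 0.
apply: (@le_trans _ _ ((`|\sum_j c j * hm (tnth x j)|)%:E +
    \sum_(j < m) (if (lam%:E < peak K j x)%E then (`|h (tnth x j)|)%:E else 0))%E); last first.
  apply: leeD; first by apply: wsup_ge; exists h.
  apply: lee_sum => j _; case: ifP => // _; rewrite peak_envelope.
  by apply: ereal_sup_ubound; exists h.
have -> : (\sum_(j < m) (if (lam%:E < peak K j x)%E then (`|h (tnth x j)|)%:E else 0) =
   (\sum_(j < m) (if (lam%:E < peak K j x)%E then `|h (tnth x j)| else 0))%:E)%E.
  by rewrite -sumEFin; apply: eq_bigr => j _; case: ifP.
rewrite -EFinD lee_fin -lerBlDl; apply: le_trans (lerB_dist _ _) _.
rewrite -sumrB; apply: le_trans (ler_norm_sum _ _ _) _; apply: ler_sum => j _.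
rewrite -mulrBr normrM peak_envelope /hm ltNge; case: ifP => /= _.
  by rewrite subrr normr0 mulr0.
by rewrite subr0 -[leRHS]mul1r ler_wpM2r.
Qed.

End Mask.

Section Mean.
Context {d d' : measure_display} {W : measurableType d} {Omega : measurableType d'}
  {R : realType} (P : probability W R) (mu : probability Omega R) (m : nat)
  (xi : 'I_m -> {RV P >-> Omega}).
Hypotheses (m1 : (0 < m)%N)
  (muE : forall E : set Omega, measurable E ->
     mu E = ((m%:R^-1)%:E * \sum_(j < m) P (xi j @^-1` E))%E).

Lemma integral_mean_law (g : Omega -> \bar R) : measurable_fun setT g -> (forall y, 0 <= g y)%E ->
  (\int[mu]_y g y = (m%:R^-1)%:E * \sum_(j < m) \int[P]_w g (xi j w))%E.
Proof.
move=> mg g0.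
pose X (k : nat) := xi (insubd (Ordinal m1) k).
have mX k : measurable_fun setT (X k) by exact: measurable_funP.
pose ms k : {measure set Omega -> \bar R} := distribution P (X k).
have c0 : (0 <= m%:R^-1 :> R)%R by rewrite invr_ge0 ler0n.
have XE (j : 'I_m) : X j = xi j by rewrite /X valKd.
transitivity (\int[mscale (NngNum c0) (msum ms m)]_y g y)%E.
  apply: eq_measure_integral => A mA _; apply: etrans (muE mA) _.
  rewrite /mscale/= /msum; congr (_ * _)%E.
  by apply: eq_bigr => j _; rewrite /ms XE.
rewrite ge0_integral_mscale//; congr (_ * _)%E.
rewrite ge0_integral_measure_sum//; apply: eq_bigr => j _.
by rewrite ge0_integral_distribution//= XE.
Qed.

End Mean.

Lemma powR_add_double {R : realType} (u v q : R) : 1 <= q -> 0 <= u -> 0 <= v -> v <= 2 * u ->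
  3 `^ q * (u `^ q + v `^ q) <= (3 * (2 * (2 * u))) `^ q.
Proof.
move=> q1 u0 v0 vu; have q0 : 0 <= q by lra.
have w0 : 0 <= 2 * u by rewrite mulr_ge0.
rewrite [leRHS]powRM ?mulr_ge0// ler_wpM2l ?powR_ge0//.
have h1 : u `^ q <= (2 * u) `^ q by apply: powR_le => //; lra.
have h2 : v `^ q <= (2 * u) `^ q by apply: powR_le.
rewrite [leRHS]powRM//; apply: (@le_trans _ _ (2 * (2 * u) `^ q)); first lra.
rewrite ler_wpM2r ?powR_ge0//.
by rewrite -{1}[2]powRr1// ler_powR//; lra.
Qed.

Section Markov.
Context {d : measure_display} {W : measurableType d} {R : realType} (P : probability W R).

Lemma markov_mul (f : W -> \bar R) (r a : R) : measurable_fun setT f -> (forall w, 0 <= f w)%E ->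
  0 < r -> 0 < a -> (\int[P]_w f w <= a%:E)%E ->
  (P [set w | (r * a)%:E < f w]%E <= (r^-1)%:E)%E.
Proof.
move=> mf f0 r0 a0 fa; set E := [set w | _].
have mE : measurable E by rewrite -[X in measurable X]setTI; exact: emeasurable_fun_o_infty.
have h : ((r * a)%:E * P E <= a%:E)%E.
  apply: le_trans fa; rewrite -[X in P X]setIT -integral_indic// -ge0_integralZl_EFin//; last 2 first.
  - by apply/measurable_EFinP; exact: measurable_indic.
  - by rewrite mulr_ge0// ltW.
  apply: ge0_le_integral => //.
  - by move=> w _; rewrite mule_ge0// lee_fin ?mulr_ge0// ltW.
  - by apply: emeasurable_funM => //; apply/measurable_EFinP; exact: measurable_indic.
  - move=> w _; rewrite indicE; case: (boolP (w \in E)) => [|_]; rewrite ?mule0//.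
    by rewrite inE /E/= mule1 => /ltW.
have e := fineK (fin_num_measure P E mE); move: h; rewrite -e -EFinM !lee_fin => h.
rewrite -(ler_pM2l (mulr_gt0 r0 a0)); apply: le_trans h _.
by rewrite le_eqVlt; apply/orP; left; apply/eqP; field; rewrite gt_eqF.
Qed.

End Markov.

Section Main.
Context {d d' : measure_display} {W : measurableType d'} {Omega : measurableType d}
  {R : realType} (mu : probability Omega R) (P : probability W R)
  (m : nat) (xi : 'I_m -> {RV P >-> Omega})
  (F : set (Omega -> R[i])) (p p0 H : R) (m0 n1 k : nat).
Hypotheses (ind : independent_family xi)
  (muE : forall E : set Omega, measurable E ->
     mu E = ((m%:R^-1)%:E * \sum_(j < m) P (xi j @^-1` E))%E)
  (bF : bounded_class F) (F0 : F (fun=> 0)) (p2 : 2 <= p) (p01 : 1 < p0) (p0p : p0 <= p)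
  (H0 : 0 < H) (m1 : (0 < m)%N) (m0_ge : (2 ^ n1 <= m0)%N) (m_le : (m <= 2 ^ (n1 + k).+1)%N)
  (mIA : measurable_fun setT (fun w => integrandA p p0 F (sample xi w)))
  (mIB : measurable_fun setT (fun w => integrandB p p0 F (sample xi w)))
  (mwsup : forall c : 'I_m -> R,
     measurable_fun setT (fun x : m.-tuple Omega => weighted_sup p F c (tnth x)))
  (A1 : (\int[P]_w integrandA p p0 F (sample xi w) <= (H `^ (p0 / p))%:E)%E)
  (B1 : (\int[P]_w integrandB p p0 F (sample xi w) <= ((H * m0%:R) `^ (p0 / p))%:E)%E).

Definition powers : set (Omega -> R) := [set (fun y => cmod (f y) `^ p) | f in F].

Lemma wsup_powers c : wsup powers c = (fun x : m.-tuple Omega => weighted_sup p F c (tnth x)).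
Proof.
apply/funext => x; congr ereal_sup; apply/seteqP; split.
  by move=> _ [_ [f Ff <-] <-]; exists f.
by move=> _ [f Ff <-]; exists (fun y => cmod (f y) `^ p) => //; exists f.
Qed.

Let pp : 0 < p. Proof. by move: p2; lra. Qed.
Let mp : 0 < m%:R :> R. Proof. by rewrite ltr0n. Qed.
Let K := powers.
Let K0 : K !=set0. Proof. by exists (fun y => cmod ((0 : R[i])) `^ p), (fun=> 0). Qed.
Let msup (c : 'I_m -> R) : measurable_fun setT (wsup K c).
Proof. by rewrite wsup_powers. Qed.
Let Kge0 h y : K h -> 0 <= h y.
Proof. by move=> [f Ff <-]; exact: powR_ge0. Qed.

Lemma measurable_powers h : powers h -> measurable_fun setT h.
Proof.
move=> [f Ff <-]; have [[mr mi] _] := bF Ff.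
rewrite (_ : (fun y => _) = (fun y => (complex.Re (f y) ^+ 2 + complex.Im (f y) ^+ 2) `^ (2^-1 * p))).
  apply: (measurableT_comp (measurable_powR (2^-1 * p))).
  by apply: measurable_funD; apply: measurable_funX.
by apply/funext => y; rewrite powRrM powR12_sqrt ?addr_ge0 ?sqr_ge0//; case: (f y).
Qed.

Lemma bounded_powers h : powers h -> exists M, forall y, `|h y| <= M.
Proof.
move=> [f Ff <-]; have [_ [M hM]] := bF Ff; exists (M `^ p) => y.
rewrite ger0_norm ?powR_ge0//; apply: powR_le; [exact: ltW|exact: cmod_ge0|exact: hM].
Qed.

(** The factor 4 lets Markov's inequality bound the probability of any entry above the threshold by
    1/4, as [sparse_moment] asks. *)
Definition threshold : R := 4 * (m%:R `^ (1 - p0 / p) * H `^ (p0 / p)).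
Let lam := threshold.
Let lam0 : 0 < lam. Proof. by rewrite !mulr_gt0// powR_gt0. Qed.

Let IA w := integrandA p p0 F (sample xi w).

Let IA0 w : (0 <= IA w)%E.
Proof.
rewrite /IA /integrandA mule_ge0//.
  apply: le_trans (@sup_unif_ge_at _ _ _ p p0 F _ p0p (fun=> 0) (Ordinal m1) F0).
  by rewrite lee_fin powR_ge0.
apply: (@le_trans _ _ (disc_norm (conj_p1 p p0) (fun=> 0) (sample xi w) `^ p0)%:E).
  by rewrite lee_fin powR_ge0.
by apply: ereal_sup_ubound; exists (fun=> 0).
Qed.

Let IB0 w : (0 <= integrandB p p0 F (sample xi w))%E.
Proof.
rewrite /integrandB mule_ge0//; last exact: poweR_ge0.
apply: le_trans (@sup_unif_ge_at _ _ _ p p0 F _ p0p (fun=> 0) (Ordinal m1) F0).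
by rewrite lee_fin powR_ge0.
Qed.

Lemma peak_le_A j w : (peak K j (xit xi w) <= (m%:R `^ (1 - p0 / p))%:E * IA w)%E.
Proof.
apply: wsup_le => _ [f Ff <-].
rewrite (bigD1 j)//= eqxx mul1r big1 ?addr0; last by move=> i /negbTE ->; rewrite mul0r.
rewrite ger0_norm ?powR_ge0// tnth_mktuple.
by apply: (@peak_le_integrandA _ _ _ p p0 F (sample xi w)).
Qed.

Lemma peak_threshold : (P [set w | exists j, (lam%:E < peak K j (xit xi w))%E] <= (4^-1)%:E)%E.
Proof.
have a0 : 0 < H `^ (p0 / p) by rewrite powR_gt0.
apply: le_trans (markov_mul mIA IA0 (ltr0n R 4) a0 A1).
have mpk j c : measurable [set w | (c%:E < peak K j (xit xi w))%E].
  rewrite -[X in measurable X]setTI; apply: emeasurable_fun_o_infty => //.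
  by apply: measurableT_comp; [exact: msup|exact: measurable_xit].
apply: le_measure; rewrite ?inE.
- rewrite (_ : [set w | _] = \bigcup_(j in [set: 'I_m]) [set w | (lam%:E < peak K j (xit xi w))%E]).
    by apply: fin_bigcup_measurable.
  by apply/seteqP; split => w /=; [move=> [j h]; exists j|move=> [j _ h]; exists j].
- by rewrite -[X in measurable X]setTI; apply: emeasurable_fun_o_infty.
- move=> w [j h]; rewrite /= ltNge; apply/negP => h2.
  move: h; rewrite ltNge => /negP; apply; apply: le_trans (peak_le_A j w) _.
  by rewrite /lam /threshold mulrCA EFinM; apply: lee_wpmul2l.
Qed.

Let Mk := mask K lam.
Let Mk0 : Mk !=set0. Proof. exact: mask_nonempty. Qed.
Let mMk (c : 'I_m -> R) : measurable_fun setT (wsup Mk c).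
Proof. exact: measurable_wsup_mask. Qed.

Definition sgn (e : {ffun 'I_m -> bool}) (j : 'I_m) : R := (-1) ^+ e j.

Let sgn1 e j : `|sgn e j| <= 1.
Proof. by rewrite /sgn normrX normrN1 expr1n. Qed.

Let Sb w : \bar R := wsup Mk (fun=> 1) (xit xi w).

Let mSb : measurable_fun setT Sb.
Proof. by apply: measurableT_comp; [exact: mMk|exact: measurable_xit]. Qed.

Let Sb0 w : (0 <= Sb w)%E. Proof. exact: wsup_ge0. Qed.

Let keep x (j : 'I_m) : bool := (envelope K (x j) <= lam%:E)%E.

(** An averaging argument. Three events of probability at most 1/24 each are discarded; on the other
    samples at most 1/8 of the sign vectors fail for some prefix, twice the 1/16 of [chain_point] by
    the maximal inequality. The failure probability averaged over the signs is therefore at most 1/8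
    + 1/8, and some sign vector does no worse. *)
Lemma sign_choice Lam c : 1 <= Lam -> (\int[P]_w Sb w <= (m%:R * (24^-1 * Lam))%:E)%E ->
  c = chain_bound (m := m) p p0 H Lam m0 k ->
  exists e, (P [set w | exists2 l, (l <= m)%N & (c%:E < wsup Mk (cut (sgn e) 0 l) (xit xi w))%E]
    <= (4^-1)%:E)%E.
Proof.
move=> Lam1 SL cE.
have a0 : 0 < H `^ (p0 / p) by rewrite powR_gt0.
have m0p : 0 < m0%:R :> R by rewrite ltr0n (leq_trans _ m0_ge)// expn_gt0.
have b0 : 0 < (H * m0%:R) `^ (p0 / p) by rewrite powR_gt0// mulr_gt0.
have L0 : 0 < Lam by lra.
have s0 : 0 < m%:R * (24^-1 * Lam) by rewrite !mulr_gt0// invr_gt0 ltr0n.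
have r0 : 0 < 24 :> R by exact: ltr0n.
have NA := markov_mul mIA IA0 r0 a0 A1.
have NB := markov_mul mIB IB0 r0 b0 B1.
have NS := markov_mul mSb Sb0 r0 s0 SL.
set EA := [set w | _] in NA; set EB := [set w | _] in NB; set ES := [set w | _] in NS.
have mEA : measurable EA by rewrite -[X in measurable X]setTI; exact: emeasurable_fun_o_infty.
have mEB : measurable EB by rewrite -[X in measurable X]setTI; exact: emeasurable_fun_o_infty.
have mES : measurable ES by rewrite -[X in measurable X]setTI; exact: emeasurable_fun_o_infty.
pose N := EA `|` EB `|` ES.
have mN : measurable N by do 2 apply: measurableU => //.
have PN : (P N <= (8^-1)%:E)%E.
  apply: (@le_trans _ _ ((24^-1)%:E + (24^-1)%:E + (24^-1)%:E)%E).
    apply: le_trans (measureU2 _ _ _) _ => //; first exact: measurableU.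
    by apply: leeD => //; apply: le_trans (measureU2 _ _ _) _ => //; apply: leeD.
  by rewrite -!EFinD lee_fin; lra.
pose E e := [set w | exists2 l, (l <= m)%N & (c%:E < wsup Mk (cut (sgn e) 0 l) (xit xi w))%E].
have mE e : measurable (E e).
  rewrite (_ : E e = \bigcup_(l < m.+1) [set w | (c%:E < wsup Mk (cut (sgn e) 0 l) (xit xi w))%E]).
    apply: bigcup_measurable => l _; rewrite -[X in measurable X]setTI.
    apply: emeasurable_fun_o_infty => //.
    by apply: measurableT_comp; [exact: mMk|exact: measurable_xit].
  by apply/seteqP; split => w /= [l lm h]; exists l.
have good w : ~ N w -> \sum_e \1_(E e) w <= 2 ^+ m / 8 :> R.
  move=> nN; have x := 0; set y := sample xi w.
  have hA : (integrandA p p0 F y <= (24 * H `^ (p0 / p))%:E)%E.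
    by rewrite leNgt; apply/negP => h; apply: nN; left; left.
  have hB : (integrandB p p0 F y <= (24 * (H * m0%:R) `^ (p0 / p))%:E)%E.
    by rewrite leNgt; apply/negP => h; apply: nN; left; right.
  have hS f : F f -> \sum_(j | keep y j) cmod (f (y j)) `^ p <= m%:R * Lam.
    move=> Ff; rewrite -lee_fin.
    have -> : m%:R * Lam = 24 * (m%:R * (24^-1 * Lam)) by field.
    apply: (@le_trans _ _ (Sb w)); last first.
      by rewrite leNgt; apply/negP => h; apply: nN; right.
    have Mf : Mk (fun z => if (envelope K z <= lam%:E)%E then cmod (f z) `^ p else 0).
      by exists (fun z => cmod (f z) `^ p) => //; exists f.
    apply: le_trans (wsup_ge _ _ Mf); rewrite lee_fin; apply: le_trans (ler_norm _).
    rewrite big_mkcond; apply: ler_sum => j _; rewrite mul1r tnth_mktuple.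
    exact: lexx.
  have cp := @chain_point R Omega m p p0 H Lam m0 n1 k F y (keep y) p2 p01 p0p H0 m1
    m0_ge m_le Lam1 F0 hA hB hS.
  pose I := {f : Omega -> R[i] | F f}.
  pose a (f : I) (j : 'I_m) : R := if keep y j then cmod (sval f (y j)) `^ p else 0.
  have lv := levy_maximal a c.
  apply: (@le_trans _ _ (\sum_e (`[< exists l f, c < `|psum e (a f) l| >])%:R)).
    apply: ler_sum => e _; rewrite indicE ler_nat; case: (boolP (w \in E e)) => //.
    rewrite inE => -[l lm /ereal_sup_gt[_ [h [_ [f Ff <-] <-] <-]]].
    rewrite lte_fin => hh; rewrite asboolT//; exists l, (exist _ f Ff).
    move: hh; rewrite cut_sum /psum; congr (c < `|_|); apply: eq_big => j; first by [].
    by move=> _; rewrite /a /keep /= tnth_mktuple.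
  apply: le_trans lv _; apply: (@le_trans _ _ (2 * (2 ^+ m / 16))); last first.
    by rewrite le_eqVlt; apply/orP; left; apply/eqP; field.
  rewrite ler_pM2l//; apply: le_trans cp; apply: ler_sum => e _.
  rewrite ler_nat cE; case: asboolP => [[f hf]|//].
  by rewrite asboolT//; exists (sval f); [exact: (svalP f)|].
have card2 : \sum_(e : {ffun 'I_m -> bool}) 1 = 2 ^+ m :> R.
  by rewrite sumr_const card_ffun card_bool card_ord natrX.
have SP : \sum_e fine (P (E e)) <= 2 ^+ m / 4.
  rewrite -lee_fin -sumEFin.
  have -> : (\sum_e (fine (P (E e)))%:E = \int[P]_w \sum_e (\1_(E e) w)%:E)%E.
    rewrite ge0_integral_sum//; last first.
      by move=> e; apply/measurable_EFinP; exact: measurable_indic.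
    apply: eq_bigr => e _; rewrite integral_indic// setIT fineK//.
    exact: fin_num_measure.
  apply: (@le_trans _ _ (\int[P]_w ((2 ^+ m / 8)%:E + (2 ^+ m)%:E * (\1_N w)%:E))%E).
    apply: ge0_le_integral => //.
    - by move=> w _; apply: sume_ge0 => e _; rewrite lee_fin.
    - by apply: emeasurable_sum => e; apply/measurable_EFinP; exact: measurable_indic.
    - apply: emeasurable_funD => //; apply: emeasurable_funM => //.
      by apply/measurable_EFinP; exact: measurable_indic.
    - move=> w _; rewrite sumEFin -EFinM -EFinD lee_fin indicE.
      case: (boolP (w \in N)) => [_|]; last first.
        by rewrite notin_setE => /good h; rewrite mulr0 addr0.
      rewrite mulr1; apply: (@le_trans _ _ (2 ^+ m)).
        rewrite -card2; apply: ler_sum => e _; rewrite indicE.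
        by case: (_ \in _).
      by rewrite lerDr divr_ge0// exprn_ge0.
  rewrite ge0_integralD//; last first.
    apply: emeasurable_funM => //; apply/measurable_EFinP; exact: measurable_indic.
  rewrite integral_prob_cst ge0_integralZl_EFin ?exprn_ge0//; last first.
    by apply/measurable_EFinP; exact: measurable_indic.
  rewrite integral_indic// setIT.
  apply: (@le_trans _ _ ((2 ^+ m / 8)%:E + (2 ^+ m)%:E * (8^-1)%:E)%E).
    by apply: leeD => //; apply: lee_wpmul2l => //; rewrite lee_fin exprn_ge0.
  by rewrite -EFinM -EFinD lee_fin le_eqVlt; apply/orP; left; apply/eqP; field.
have [e he] : exists e, fine (P (E e)) <= 4^-1.
  apply: contrapT => none; move: SP; apply/negP; rewrite -ltNge.
  have gt e : 0 < fine (P (E e)) - 1 / 4.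
    by rewrite subr_gt0 mul1r ltNge; apply/negP => h; apply: none; exists e.
  rewrite -card2 mulr_suml -subr_gt0 -sumrB (bigD1 [ffun=> true])//=.
  by apply: ltr_pwDl; [exact: gt|apply: sumr_ge0 => e _; exact: ltW].
exists e; rewrite -[X in (X <= _)%E](fineK (fin_num_measure P (E e) (mE e))).
by rewrite lee_fin.
Qed.

Let bMk h : Mk h -> exists M, forall y, `|h y| <= M.
Proof. by move=> Mh; exists lam => y; apply: (mask_le (K := K)) => //; exact: ltW. Qed.

Let mMkf h : Mk h -> measurable_fun setT h.
Proof. exact: (measurable_mask m1 msup measurable_powers). Qed.

Let mx : measurable_fun setT (xit xi). Proof. exact: measurable_xit. Qed.

Lemma Lp_powE f : F f ->
  Lp_pow mu p f = (m%:R^-1 * \sum_(j < m) mean xi j (fun y => cmod (f y) `^ p))%:E.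
Proof.
move=> Ff; have Kf : K (fun y => cmod (f y) `^ p) by exists f.
rewrite /Lp_pow poweR_Lnorm ?gt_eqF//.
rewrite (eq_integral (fun y => (cmod (f y) `^ p)%:E)); last first.
  by move=> y _; rewrite /= ger0_norm ?cmod_ge0.
rewrite (integral_mean_law m1 muE)//; last 2 first.
- by apply/measurable_EFinP; exact: measurable_powers.
- by move=> y; rewrite lee_fin powR_ge0.
rewrite EFinM -sumEFin; congr (_ * _)%E; apply: eq_bigr => j _.
exact: (mean_integral xi measurable_powers bounded_powers j Kf).
Qed.

Section Signs.
Variables (e : {ffun 'I_m -> bool}) (c : R).
Hypotheses (c0 : 0 <= c)
  (Pc : (P [set w | exists2 l, (l <= m)%N & (c%:E < wsup Mk (cut (sgn e) 0 l) (xit xi w))%E]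
    <= (4^-1)%:E)%E).

Let Am : R := 2 * c + lam.
Let Am0 : 0 <= Am. Proof. by apply: addr_ge0; [rewrite mulr_ge0|exact: ltW]. Qed.

Let Z_moment (q : R) : 1 <= q ->
  (\int[P]_w (wsup Mk (sgn e) (xit xi w) `^ q) <= ((poisson_const q * Am) `^ q)%:E)%E.
Proof.
move=> q1; apply: restart_moment => //; first exact: ltW.
by move=> h y Mh; apply: (mask_le (K := K)) => //; exact: ltW.
Qed.

Let poisson0 (q : R) : 1 <= q -> 0 <= poisson_const q.
Proof. by move=> /poisson_const_ge1; apply: le_trans. Qed.

(** A masked sum consists of its centered part and its means, and masking does not increase the
    means. As [c] is itself computed from a bound on the left-hand side, the estimate feeds back on
    itself. *)
Lemma mask_bootstrap (Smu : R) : (forall f, F f -> (Lp_pow mu p f <= Smu%:E)%E) ->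
  (\int[P]_w Sb w <= (m%:R * Smu + 18 * (poisson_const 1 * Am))%:E)%E.
Proof.
move=> hS; have Smu0 : 0 <= Smu.
  by rewrite -lee_fin; apply: le_trans (hS _ F0); exact: poweR_ge0.
have mS0 : 0 <= m%:R * Smu by rewrite mulr_ge0 ?ler0n.
have pw w : (Sb w <= symm_bound xi Mk e w + (m%:R * Smu)%:E)%E.
  apply: wsup_le => h Mh; have [g Kg hE] := Mh; have [f Ff gE] := Kg.
  have h_ge0 y : 0 <= h y by rewrite -hE; case: ifP => // _; exact: Kge0.
  have sb := symm_bound_ge xi mMkf bMk mMk e w Mh.
  have means : \sum_j mean xi j h <= m%:R * Smu.
    apply: (@le_trans _ _ (\sum_j mean xi j g)).
      apply: ler_sum => j _; rewrite -lee_fin.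
      rewrite -(mean_integral xi mMkf bMk j Mh) -(mean_integral xi measurable_powers bounded_powers j Kg).
      apply: ge0_le_integral => //.
      - by move=> w' _; rewrite lee_fin.
      - apply/measurable_EFinP; apply: measurableT_comp; first exact: mMkf.
        exact: measurable_funP.
      - apply/measurable_EFinP; apply: measurableT_comp; first exact: measurable_powers.
        exact: measurable_funP.
      - by move=> w' _; rewrite lee_fin -hE; case: ifP => // _; exact: Kge0.
    have := hS _ Ff; rewrite Lp_powE// lee_fin gE => h1.
    by rewrite -ler_pdivrMl.
  apply: (@le_trans _ _ ((`|\sum_j (h (xi j w) - mean xi j h)|)%:E + (m%:R * Smu)%:E)%E).
    rewrite -EFinD lee_fin (eq_bigr (fun j => h (xi j w))); last first.
      by move=> j _; rewrite mul1r tnth_mktuple.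
    rewrite ger0_norm ?sumr_ge0//; apply: le_trans (lerD (ler_norm _) means).
    by rewrite sumrB subrK.
  exact: leeD.
apply: (@le_trans _ _ (\int[P]_w (symm_bound xi Mk e w + (m%:R * Smu)%:E))%E).
  apply: ge0_le_integral => //.
  by apply: emeasurable_funD => //; exact: measurable_symm_bound.
rewrite ge0_integralD//; last 2 first.
- by move=> w _; exact: symm_bound_ge0.
- exact: measurable_symm_bound.
rewrite integral_prob_cst addrC EFinD; apply: leeD => //.
have := symm_bound_moment ind Mk0 mMk e (lexx (1 : R)).
have -> : (\int[P]_w (symm_bound xi Mk e w `^ 1) = \int[P]_w symm_bound xi Mk e w)%E.
  by apply: eq_integral => w _; rewrite poweRe1 ?symm_bound_ge0.
move=> /le_trans; apply; rewrite powRr1//.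
apply: (@le_trans _ _ (18%:E * ((poisson_const 1 * Am) `^ 1)%:E)%E).
  by apply: lee_wpmul2l; [rewrite lee_fin|exact: Z_moment].
by rewrite powRr1// mulr_ge0// poisson0.
Qed.

(** Here 216 = 18 * 12: the 18 is the cost of symmetrization, and 12 = 3 * 2 * 2 that of adding to
    the masked sums the peaks, whose bound is at most twice as large. *)
Lemma error_moment (q : R) : 1 <= q ->
  (\int[P]_w (integrandA p p0 F (sample xi w) `^ q) <= ((H `^ (p0 / p)) `^ q)%:E)%E ->
  measurable_fun setT (fun w => disc_error mu p F (sample xi w)) ->
  (\int[P]_w ((`|disc_error mu p F (sample xi w)|) `^ q)
    <= ((216 / m%:R * (poisson_const q * Am)) `^ q)%:E)%E.
Proof.
move=> q1 Aq mEr; have q0 : 0 <= q by lra.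
have er_le w : (disc_error mu p F (sample xi w) <= (m%:R^-1)%:E * symm_bound xi K e w)%E.
  apply: ge_ereal_sup => _ [f Ff <-].
  have Kf : K (fun y => cmod (f y) `^ p) by exists f.
  rewrite Lp_powE// -EFinB abse_EFin -mulrBr normrM ger0_norm ?invr_ge0 ?ler0n//.
  rewrite EFinM; apply: lee_wpmul2l; first by rewrite lee_fin invr_ge0.
  rewrite -sumrB; exact: (symm_bound_ge xi measurable_powers bounded_powers msup e w Kf).
have er0 w : (0 <= disc_error mu p F (sample xi w))%E.
  refine (le_trans (abse_ge0 _) (ereal_sup_ubound _)).
  by exists (fun=> 0).
have mZ : measurable_fun setT (fun w => wsup Mk (sgn e) (xit xi w)).
  by apply: measurableT_comp; [exact: mMk|exact: mx].
pose big w : \bar R := (\sum_j (if (lam%:E < peak K j (xit xi w))%E then peak K j (xit xi w) else 0))%E.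
have big0 w : (0 <= big w)%E.
  by apply: sume_ge0 => j _; case: ifP => // _; exact: wsup_ge0.
have mbig : measurable_fun setT big.
  apply: emeasurable_sum => j; apply: measurable_fun_ifT => //.
    apply: (measurable_fun_bool true).
    rewrite setTI (_ : _ @^-1` _ = [set w | (lam%:E < peak K j (xit xi w))%E])//.
    rewrite -[X in measurable X]setTI; apply: emeasurable_fun_o_infty => //.
    by apply: measurableT_comp; [exact: msup|exact: mx].
  by apply: measurableT_comp; [exact: msup|exact: mx].
pose Phi w : \bar R := (((m%:R `^ (1 - p0 / p))%:E * IA w) `^ q)%E.
have mPhi : measurable_fun setT Phi.
  by apply: measurable_poweR_comp; apply: emeasurable_funM.
have IPhi : (\int[P]_w Phi w <= (lam `^ q)%:E)%E.
  rewrite /Phi; under eq_integral => w _ do rewrite poweRM ?IA0 ?lee_fin ?powR_ge0//.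
  rewrite poweR_EFin ge0_integralZl_EFin ?powR_ge0//; last 2 first.
  - by move=> w _; exact: poweR_ge0.
  - exact: measurable_poweR_comp.
  apply: (@le_trans _ _ (((m%:R `^ (1 - p0 / p)) `^ q)%:E * ((H `^ (p0 / p)) `^ q)%:E)%E).
    by apply: lee_wpmul2l; [rewrite lee_fin powR_ge0|exact: Aq].
  rewrite -EFinM lee_fin -powRM ?powR_ge0//; apply: powR_le => //.
    by rewrite mulr_ge0 ?powR_ge0.
  by rewrite /lam /threshold ler_peMl ?mulr_ge0 ?powR_ge0// ler1n.
have IR : (\int[P]_w (big w `^ q) <= ((2 * (poisson_const q * lam)) `^ q)%:E)%E.
  have := sparse_moment ind K0 msup peak_threshold q1 mPhi (fun w => poweR_ge0 _ _) _.
  move=> /(_ (fun j w => le_poweR q0 (wsup_ge0 _ _ K0) (peak_le_A j w))) /le_trans; apply.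
  apply: (@le_trans _ _ ((2 * poisson_const q `^ q)%:E * (lam `^ q)%:E)%E).
    apply: lee_wpmul2l; last exact: IPhi.
    by rewrite lee_fin; apply: mulr_ge0; [|exact: powR_ge0].
  rewrite -EFinM lee_fin; move: (poisson0 q1) (ltW lam0).
  move: (poisson_const q) lam => u l u0 l0; rewrite -mulrA -powRM//.
  rewrite [leRHS]powRM ?mulr_ge0// ler_wpM2r ?powR_ge0//.
  by rewrite -{1}[2]powRr1// ler_powR//; lra.
have IZ : (\int[P]_w (wsup K (sgn e) (xit xi w) `^ q) <= ((12 * (poisson_const q * Am)) `^ q)%:E)%E.
  apply: (@le_trans _ _ (\int[P]_w ((3 `^ q)%:E * (wsup Mk (sgn e) (xit xi w) `^ q + big w `^ q)))%E).
    apply: ge0_le_integral => //.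
    - by move=> w _; exact: poweR_ge0.
    - by apply: measurable_poweR_comp; apply: measurableT_comp; [exact: msup|exact: mx].
    - apply: emeasurable_funM => //.
      by apply: emeasurable_funD; exact: measurable_poweR_comp.
    - move=> w _; apply: (@le_trans _ _ ((wsup Mk (sgn e) (xit xi w) + big w + 0) `^ q)%E).
        rewrite adde0; apply: le_poweR => //; first exact: wsup_ge0.
        exact: wsup_le_mask.
      apply: le_trans (poweR_add3 q1 _ _ _) _ => //; first exact: wsup_ge0.
      by rewrite poweR0r ?adde0// gt_eqF// (lt_le_trans ltr01).
  rewrite ge0_integralZl_EFin ?powR_ge0//; last 2 first.
  - by move=> w _; rewrite adde_ge0// poweR_ge0.
  - by apply: emeasurable_funD; exact: measurable_poweR_comp.
  rewrite ge0_integralD//; last 4 first.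
  - by move=> w _; exact: poweR_ge0.
  - exact: measurable_poweR_comp.
  - by move=> w _; exact: poweR_ge0.
  - exact: measurable_poweR_comp.
  apply: (@le_trans _ _ ((3 `^ q)%:E * (((poisson_const q * Am) `^ q)%:E + ((2 * (poisson_const q * lam)) `^ q)%:E))%E).
    by apply: lee_wpmul2l; [rewrite lee_fin powR_ge0|apply: leeD => //; exact: Z_moment].
  have cp0 := poisson0 q1.
  rewrite -EFinD -EFinM lee_fin.
  have -> : 12 * (poisson_const q * Am) = 3 * (2 * (2 * (poisson_const q * Am))) by ring.
  apply: powR_add_double => //; first exact: mulr_ge0.
    by apply: mulr_ge0 => //; apply: mulr_ge0 => //; exact: ltW.
  by apply: ler_wpM2l => //; apply: ler_wpM2l => //; rewrite lerDr mulr_ge0.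
apply: (@le_trans _ _ (\int[P]_w (((m%:R^-1)%:E * symm_bound xi K e w) `^ q))%E).
  have msb : measurable_fun setT (fun w => ((m%:R^-1)%:E * symm_bound xi K e w)%E).
    by apply: emeasurable_funM => //; exact: measurable_symm_bound.
  apply: ge0_le_integral => //.
  - by move=> w _; exact: poweR_ge0.
  - by apply: measurable_poweR_comp; exact: measurableT_comp.
  - exact: measurable_poweR_comp.
  - by move=> w _; rewrite gee0_abs//; apply: le_poweR.
have c1 : 0 <= m%:R^-1 :> R by rewrite invr_ge0.
have -> : (\int[P]_w (((m%:R^-1)%:E * symm_bound xi K e w) `^ q) =
    ((m%:R^-1) `^ q)%:E * \int[P]_w (symm_bound xi K e w `^ q))%E.
  rewrite -ge0_integralZl_EFin ?powR_ge0//.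
  - apply: eq_integral => w _; rewrite poweRM ?poweR_EFin ?lee_fin//.
    exact: symm_bound_ge0.
  - by move=> w _; exact: poweR_ge0.
  - by apply: measurable_poweR_comp; exact: measurable_symm_bound.
apply: (@le_trans _ _ ((m%:R^-1 `^ q)%:E * ((18 `^ q)%:E * ((12 * (poisson_const q * Am)) `^ q)%:E))%E).
  apply: lee_wpmul2l; first by rewrite lee_fin powR_ge0.
  apply: le_trans (symm_bound_moment ind K0 msup e q1) _.
  by apply: lee_wpmul2l; [rewrite lee_fin powR_ge0|exact: IZ].
have := mulr_ge0 (poisson0 q1) Am0; move: (poisson_const q * Am) => u u0.
have -> : 216 / m%:R * u = m%:R^-1 * (18 * (12 * u)) by field; rewrite gt_eqF.
rewrite -!EFinM lee_fin [leRHS]powRM ?mulr_ge0// ler_wpM2l ?powR_ge0//.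
by rewrite [leRHS]powRM ?mulr_ge0.
Qed.

End Signs.

End Main.

(** * Size of the rate, solution of the bootstrap and conclusion *)

Lemma powR_ge1 {R : realType} (x r : R) : 1 <= x -> 0 <= r -> 1 <= x `^ r.
Proof. by move=> x1 r0; have := powR_le r0 ler01 x1; rewrite powR1. Qed.

Section Rate.
Context {R : realType}.
Variables (p p0 H : R) (m m0 n1 k : nat).
Hypotheses (p2 : 2 <= p) (p01 : 1 < p0) (p0p : p0 <= p) (H0 : 0 < H) (m01 : (1 <= m0)%N)
  (m16 : 16 * m0%:R <= m%:R :> R)
  (msize : expR 1 * (expR 1 * ln (ln (m%:R / m0%:R))) `^ (p / holder_conj p0) * H * m0%:R <= m%:R)
  (m0_ge : (2 ^ n1 <= m0)%N) (m0_lt : (m0 < 2 ^ n1.+1)%N) (m_ge : (2 ^ (n1 + k) <= m)%N).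

Definition rate : R := (H * m0%:R / m%:R) `^ p^-1
  * (ln (ln (m%:R / m0%:R)) + ln (m%:R / (H * m0%:R))) `^ (1 - p0^-1).

Local Notation y := (m%:R / m0%:R : R).
Local Notation del := (H * m0%:R / m%:R).
Local Notation th := (1 - p0^-1).
Local Notation N := (ln (ln y) + ln (m%:R / (H * m0%:R))).

Let pp : 0 < p. Proof. by move: p2; lra. Qed.
Let p00 : 0 < p0. Proof. by move: p01; lra. Qed.
Let m0p : 0 < m0%:R :> R. Proof. by rewrite ltr0n. Qed.
Let mp : 0 < m%:R :> R. Proof. by move: m16 m0p; lra. Qed.
Let del0 : 0 < del. Proof. by rewrite divr_gt0 ?mulr_gt0. Qed.
Let th0 : 0 < th. Proof. by rewrite subr_gt0 invf_lt1. Qed.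
Let th1 : th <= 1. Proof. by rewrite gerBl invr_ge0 ltW. Qed.
Let delV : m%:R / (H * m0%:R) = del^-1. Proof. by rewrite invf_div. Qed.

Let lny : 2 <= ln y.
Proof.
have y16 : 16 <= y by rewrite ler_pdivlMr.
apply: (@le_trans _ _ (ln 16)); last by rewrite ler_ln ?posrE// (lt_le_trans _ y16)// ltr0n.
have -> : 16 = 2 ^+ 4 :> R by ring.
by rewrite lnXn// -[leRHS]mulr_natr; have := ln2_ge_half (R := R); lra.
Qed.

Let lny0 : 0 < ln y. Proof. by apply: lt_le_trans lny. Qed.

Let LL_half : 2^-1 <= ln (ln y).
Proof. by apply: le_trans ln2_ge_half _; rewrite ler_ln ?posrE. Qed.

Let e2 : 2 <= expR 1 :> R.
Proof. by apply: le_trans (expR_ge1Dx 1); lra. Qed.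

Let size_del : expR 1 * (expR 1 * ln (ln y)) `^ (p * th) <= del^-1.
Proof.
have e : p / holder_conj p0 = p * th.
  by rewrite /holder_conj invf_div; field; rewrite gt_eqF.
rewrite -delV ler_pdivlMr ?mulr_gt0// mulrA -e; exact: msize.
Qed.

Let eLL1 : 1 <= expR 1 * ln (ln y).
Proof. by have := e2; have := LL_half; move: (expR 1) (ln (ln y)) => *; nra. Qed.

Let delV_e : expR 1 <= del^-1.
Proof.
apply: le_trans size_del; rewrite ler_peMr ?expR_ge0//.
apply: powR_ge1 => //.
by rewrite mulr_ge0 ?(ltW pp) ?(ltW th0).
Qed.

Let delVp : 0 < del^-1. Proof. by rewrite invr_gt0. Qed.

Let lndel : 1 <= ln (m%:R / (H * m0%:R)).
Proof.
by rewrite delV -[leLHS](expRK 1) ler_ln ?posrE ?expR_gt0.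
Qed.

Let N1 : 1 <= N. Proof. by have := LL_half; have := lndel; lra. Qed.
Let N0 : 0 < N. Proof. by apply: lt_le_trans N1. Qed.

Let del1 : del <= 1.
Proof.
rewrite -[del]invrK invf_le1//; apply: le_trans delV_e; by apply: le_trans e2; lra.
Qed.

Let del_root : 0 < del `^ p^-1. Proof. exact: powR_gt0. Qed.

Lemma rate_gt0 : 0 < rate.
Proof. by rewrite mulr_gt0// powR_gt0. Qed.

Let delV_root : (del^-1) `^ p^-1 = (del `^ p^-1)^-1.
Proof. by rewrite powRV// ltW. Qed.

(** The purpose of the second lower bound on [m]. With del = H m0 / m it makes ln (ln (m/m0))^(1 -
    1/p0) at most del^(-1/p), while ln (1/del) <= p del^(-1/p); both logarithms are thus compensated
    by the factor del^(1/p). The bootstrap needs a rate bounded in terms of p alone. *)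
Lemma rate_le : rate <= 2 * (1 + p).
Proof.
have LL0 : 0 <= ln (ln y) by apply: le_trans LL_half; lra.
have z0 : 0 <= ln (m%:R / (H * m0%:R)) by apply: le_trans lndel.
have h1 : ln (ln y) `^ th <= (del `^ p^-1)^-1.
  rewrite -delV_root.
  apply: (@le_trans _ _ (((expR 1 * ln (ln y)) `^ (p * th)) `^ p^-1)); last first.
    apply: powR_le; rewrite ?invr_ge0 ?(ltW pp) ?powR_ge0//.
    apply: le_trans size_del; rewrite ler_peMl ?powR_ge0//; apply: le_trans e2; lra.
  rewrite -powRrM mulrAC divff ?gt_eqF// mul1r; apply: powR_le; [exact: ltW|exact: LL0|].
  by rewrite ler_peMl//; apply: le_trans e2; lra.
have h2 : ln (m%:R / (H * m0%:R)) `^ th <= p * (del `^ p^-1)^-1.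
  apply: (@le_trans _ _ (ln (m%:R / (H * m0%:R)))).
    by rewrite -[leRHS]powRr1// ler_powR.
  rewrite delV -delV_root -{1}[del^-1](@powRVK _ _ p) ?gt_eqF ?(ltW delVp)//.
  rewrite ln_powR ler_wpM2l ?(ltW pp)//.
  have q0 : 0 < del^-1 `^ p^-1 by exact: powR_gt0.
  by have := ln_add1_le q0; lra.
have h3 : N `^ th <= 2 * (ln (ln y) `^ th + ln (m%:R / (H * m0%:R)) `^ th).
  have := powR_add3 (ltW th0) LL0 z0 (lexx 0).
  set a := ln (ln y) in LL0 *; set b := ln _ in z0 *.
  have H2 (u : R) : 0 <= u -> a <= u -> b <= u -> (a + b) `^ th <= 2 * u `^ th.
    move=> u0 au bu; apply: (@le_trans _ _ ((2 * u) `^ th)).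
      by apply: powR_le; [exact: ltW|exact: addr_ge0|lra].
    rewrite powRM// ler_wpM2r ?powR_ge0//.
    by rewrite -[leRHS]powRr1// ler_powR// ler1n.
  move=> _; have pa := powR_ge0 a th; have pb := powR_ge0 b th.
  have [ab|/ltW ba] := leP a b.
    by apply: le_trans (H2 b z0 ab (lexx b)) _; lra.
  by apply: le_trans (H2 a LL0 (lexx a) ba) _; lra.
rewrite /rate; have dr := del_root.
apply: (@le_trans _ _ (del `^ p^-1 * (2 * ((del `^ p^-1)^-1 + p * (del `^ p^-1)^-1)))).
  by apply: ler_wpM2l; [exact: ltW|lra].
by rewrite le_eqVlt; apply/orP; left; apply/eqP; field; rewrite gt_eqF.
Qed.

Lemma threshold_le : threshold m p p0 H <= 4 * (m%:R * rate).
Proof.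
rewrite /threshold ler_pM2l//.
have -> : m%:R `^ (1 - p0 / p) * H `^ (p0 / p) = m%:R * (H / m%:R) `^ (p0 / p).
  rewrite powRD_gt0// powRr1 ?ltW// powRN powRM ?invr_ge0 ?(ltW H0) ?(ltW mp)//.
  by rewrite powRV ?(ltW mp)//; ring.
rewrite ler_pM2l//; apply: (@le_trans _ _ (del `^ p^-1)); last first.
  rewrite /rate ler_peMr ?(ltW del_root)//.
  by apply: powR_ge1 => //; exact: ltW.
apply: (@le_trans _ _ (del `^ (p0 / p))).
  apply: powR_le; rewrite ?divr_ge0 ?(ltW p00) ?(ltW pp) ?(ltW H0)//.
  by rewrite ler_pM2r ?invr_gt0// ler_peMr ?(ltW H0)// ler1n.
rewrite powRrM; apply: powR_le; rewrite ?invr_ge0 ?(ltW pp) ?powR_ge0//.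
rewrite -(subrK 1 p0) powRD_gt0// powRr1 ?(ltW del0)// ler_piMl ?(ltW del0)//.
by apply: le_trans (powR_le _ (ltW del0) del1) _; rewrite ?powR1// subr_ge0 ltW.
Qed.

(** The number of levels is of order ln (m/m0), so that its logarithm is of order ln (ln (m/m0)).
    Constants are absorbed by ln (m/m0) >= 2, a consequence of m >= 16 m0. *)
Let lnL : ln k.+1%:R <= 3 * ln (ln y).
Proof.
have y0 : 0 < y by rewrite divr_gt0.
have ln21 : ln 2 <= 1 :> R by rewrite -[leRHS](expRK 1) ler_ln ?posrE ?expR_gt0.
have k2 : k%:R * ln 2 <= ln 2 + ln y.
  rewrite -lnM ?posrE// mulr_natl -lnXn// ler_ln ?posrE ?mulr_gt0 ?exprn_gt0 ?invr_gt0//.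
  rewrite mulrA ler_pdivlMr// -natrX -!natrM ler_nat.
  have h : (2 ^ k * 2 ^ n1 <= m)%N by rewrite -expnD addnC.
  apply: leq_trans (leq_mul (leqnn _) (ltnW m0_lt)) _.
  by rewrite expnS mulnCA leq_mul2l h orbT.
have L4 : k.+1%:R <= 4 * ln y.
  rewrite -natr1; move: k2 lny ln21 (ln2_ge_half (R := R)).
  by move: (k%:R) (ln 2) (ln y) (ler0n R k) => u v w; nra.
have lny4 : 4 * ln y <= (ln y) ^+ 3.
  by move: lny; move: (ln y) => w; rewrite !exprS expr0; nra.
rewrite mulr_natl -lnXn// ler_ln ?posrE ?exprn_gt0//.
exact: le_trans lny4.
Qed.

(** The factor 1 + ln Lam hidden in [chain_W] is paid for with a power Lam^(1/(2p)). This leaves the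
    total exponent 1 - 1/(2p), still below 1, as the bootstrap requires. *)
Lemma chain_bound_le Lam : 1 <= Lam ->
  chain_bound (m := m) p p0 H Lam m0 k <=
  384 * p * chain_C p * (m%:R * rate * Lam `^ (1 - (2 * p)^-1)).
Proof.
move=> Lam1; have Lam0 : 0 < Lam by lra.
have lnLam0 : 0 <= ln Lam by rewrite ln_ge0.
have Cc := chain_C_ge0 p2.
have Hm0 : 0 < H * m0%:R by rewrite mulr_gt0.
have DE : chain_radius p H m0 * (m%:R * Lam) `^ (1 - p^-1) =
    48 * (m%:R * (del `^ p^-1 * Lam `^ (1 - p^-1))).
  rewrite /chain_radius [(_ * Lam) `^ _]powRM ?(ltW mp) ?(ltW Lam0)//.
  rewrite [m%:R `^ _]powRD_gt0// powRr1 ?(ltW mp)// powRN.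
  rewrite [del `^ _]powRM ?invr_ge0 ?(ltW mp) ?(ltW Hm0)// powRV ?(ltW mp)//; ring.
have W0 : 0 <= chain_W p (m%:R * Lam) (chain_radius p H m0) k.+1%:R.
  rewrite /chain_W !addr_ge0//; first by rewrite ln_ge0// ler1n.
  by rewrite le_max lexx.
have WN : chain_W p (m%:R * Lam) (chain_radius p H m0) k.+1%:R <= 4 * (N * (1 + ln Lam)).
  have wD : m%:R * Lam / chain_radius p H m0 `^ p <= Lam * del^-1.
    rewrite /chain_radius powRM ?powR_ge0// powRVK ?gt_eqF ?(ltW Hm0)//.
    rewrite -delV ler_pdivrMr ?mulr_gt0 ?powR_gt0//.
    have -> : Lam * (m%:R / (H * m0%:R)) * (48 `^ p * (H * m0%:R)) = 48 `^ p * (m%:R * Lam).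
      by field; rewrite !gt_eqF.
    rewrite ler_peMl ?mulr_ge0 ?(ltW mp) ?(ltW Lam0)//.
    by apply: powR_ge1; [rewrite ler1n|exact: ltW].
  have hmax : Num.max 0 (ln (m%:R * Lam / chain_radius p H m0 `^ p)) <= ln Lam + ln (m%:R / (H * m0%:R)).
    rewrite ge_max addr_ge0 ?(le_trans _ lndel)//= delV -lnM ?posrE//.
    rewrite ler_ln ?posrE ?mulr_gt0 ?invr_gt0 ?powR_gt0//.
    by rewrite mulr_gt0// powR_gt0.
  rewrite /chain_W; move: hmax lnL lndel LL_half lnLam0.
  set a := Num.max _ _; set b := ln k.+1%:R; set c := ln (m%:R / _); set l := ln (ln y); set u := ln Lam.
  by move: a b c l u => *; nra.
have Wth : chain_W p (m%:R * Lam) (chain_radius p H m0) k.+1%:R `^ th <= 4 * (N `^ th * (1 + ln Lam)).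
  have l1 : 1 <= 1 + ln Lam by rewrite lerDl.
  have one (x : R) : 1 <= x -> x `^ th <= x.
    by move=> x1; rewrite -[leRHS]powRr1 ?(le_trans _ x1)// ler_powR.
  apply: (@le_trans _ _ ((4 * (N * (1 + ln Lam))) `^ th)); first by apply: powR_le; rewrite ?(ltW th0).
  rewrite powRM ?mulr_ge0 ?(ltW N0) ?(le_trans _ l1)// powRM ?(ltW N0) ?(le_trans _ l1)//.
  apply: ler_pM; rewrite ?mulr_ge0 ?powR_ge0//; first by apply: one; rewrite ler1n.
  by rewrite ler_wpM2l ?powR_ge0// one.
have lnLam : 1 + ln Lam <= 2 * p * Lam `^ (2 * p)^-1.
  have p20 : 0 < 2 * p by rewrite mulr_gt0.
  have u0 : 0 < Lam `^ (2 * p)^-1 by rewrite powR_gt0.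
  rewrite -{1}[Lam](@powRVK _ _ (2 * p)) ?gt_eqF ?(ltW Lam0)// ln_powR.
  have := ln_add1_le u0; move: p2; set u := Lam `^ _; set v := ln u => h1 h2.
  have := ler_wpM2l (ltW p20) h2; lra.
rewrite /chain_bound -[chain_C p * _ * _]mulrA DE.
have e : Lam `^ (1 - (2 * p)^-1) = Lam `^ (1 - p^-1) * Lam `^ (2 * p)^-1.
  by rewrite -powRD_gt0//; congr (_ `^ _); field; rewrite gt_eqF.
have h := le_trans Wth (ler_wpM2l (ler0n R 4) (ler_wpM2l (powR_ge0 N th) lnLam)).
apply: (@le_trans _ _ (chain_C p * (48 * (m%:R * (del `^ p^-1 * Lam `^ (1 - p^-1)))) *
   (4 * (N `^ th * (2 * p * Lam `^ (2 * p)^-1))))).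
  apply: ler_wpM2l h; apply: mulr_ge0 => //; apply: mulr_ge0; first exact: ler0n.
  by rewrite !mulr_ge0 ?powR_ge0 ?(ltW mp).
rewrite e /rate le_eqVlt; apply/orP; left; apply/eqP; ring.
Qed.

End Rate.

(** Either 48 C <= Lam^(1/(2p)), and 24 C Lam^(1 - 1/(2p)) is absorbed as at most half of [Lam], or
    Lam is below (48 C)^(2p). *)
Lemma bootstrap_solve {R : realType} (p C S Lam s : R) : 2 <= p -> 0 <= C -> 0 <= S ->
  Lam = 24 * Num.max 1 s -> s <= S + C * Lam `^ (1 - (2 * p)^-1) ->
  Lam <= (48 + (48 * C) `^ (2 * p)) * (1 + S).
Proof.
move=> p2 C0 S0 LE sS; have p20 : 0 < 2 * p by lra.
have L1 : 1 <= Lam by rewrite LE; case: (leP 1 s); lra.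
have L0 : 0 < Lam by lra.
have Lb : Lam <= 24 * (1 + S + C * Lam `^ (1 - (2 * p)^-1)).
  rewrite {1}LE ler_pM2l// ge_max; apply/andP; split; last by lra.
  by rewrite -addrA lerDl addr_ge0// mulr_ge0// powR_ge0.
have pw0 : 0 <= (48 * C) `^ (2 * p) by exact: powR_ge0.
have [h|h] := leP (48 * C) (Lam `^ (2 * p)^-1).
  have e : Lam `^ (1 - (2 * p)^-1) * Lam `^ (2 * p)^-1 = Lam.
    by rewrite -powRD_gt0// subrK powRr1// ltW.
  have h2 := ler_wpM2r (powR_ge0 Lam (1 - (2 * p)^-1)) h.
  rewrite [leRHS]mulrC e in h2.
  have : Lam <= 48 * (1 + S) by lra.
  move=> /le_trans; apply; rewrite ler_wpM2r//; lra.
have : Lam <= (48 * C) `^ (2 * p).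
  rewrite -[leLHS](@powRVK _ _ (2 * p)) ?gt_eqF ?(ltW L0)//.
  by apply: powR_le; rewrite ?(ltW p20) ?powR_ge0// ltW.
move: pw0; set u := _ `^ _ => u0 h3; nra.
Qed.

Section Constants.
Context {R : realType}.

Definition radius_const (p : R) : R := 768 * p * chain_C p + 4.

Definition bootstrap_const (p : R) : R :=
  48 + (48 * (18 * poisson_const 1 * radius_const p * (2 * (1 + p)))) `^ (2 * p).

Definition moment_const (p : R) : R :=
  216 * expR (expR 1) * radius_const p * bootstrap_const p.

Lemma radius_const_gt0 (p : R) : 2 <= p -> 0 < radius_const p.
Proof.
move=> p2; have p0 : 0 <= p by lra.
by have := mulr_ge0 p0 (chain_C_ge0 p2); rewrite /radius_const; move: (chain_C p) => *; lra.
Qed.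

Lemma radius_const_le (p x u c lam : R) : 1 <= u -> 0 < x ->
  c <= 384 * p * chain_C p * (x * u) -> lam <= 4 * x ->
  2 * c + lam <= radius_const p * (x * u).
Proof.
move=> u1 x0; have : x <= x * u by rewrite ler_peMr// ltW.
by rewrite /radius_const; move: (chain_C p) (x * u) => *; lra.
Qed.

Lemma bootstrap_const_gt0 (p : R) : 0 < bootstrap_const p.
Proof. by rewrite /bootstrap_const ltr_pwDl ?ltr0n// powR_ge0. Qed.

Lemma moment_const_gt0 (p : R) : 2 <= p -> 0 < moment_const p.
Proof.
move=> p2; rewrite /moment_const; apply: mulr_gt0; last exact: bootstrap_const_gt0.
apply: mulr_gt0; last exact: radius_const_gt0.
by apply: mulr_gt0; [exact: ltr0n|exact: expR_gt0].
Qed.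

End Constants.

Lemma error_moment_rate {R : realType} (p : R) (d d' : measure_display)
    (Omega : measurableType d) (mu : probability Omega R)
    (W : measurableType d') (P : probability W R)
    (m : nat) (xi : 'I_m -> {RV P >-> Omega})
    (F : set (Omega -> R[i])) (p0 H : R) (m0 : nat) (Smu q : R) :
  2 <= p -> independent_family xi ->
  (forall E : set Omega, measurable E ->
     mu E = ((m%:R^-1)%:E * \sum_(j < m) P (xi j @^-1` E))%E) ->
  bounded_class F -> F (fun=> 0) ->
  1 < p0 -> p0 <= p -> 0 < H -> (1 <= m0)%N ->
  random_variables xi mu p p0 F -> condB xi p p0 H m0 F ->
  16 * m0%:R <= m%:R :> R ->
  expR 1 * (expR 1 * ln (ln (m%:R / m0%:R))) `^ (p / holder_conj p0) * H * m0%:R <= m%:R ->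
  (forall f, F f -> (Lp_pow mu p f <= Smu%:E)%E) -> 1 <= q -> condA xi p p0 H F q ->
  (\int[P]_w ((`|disc_error mu p F (sample xi w)|) `^ q) <=
    ((moment_const p * (q / (1 + ln q)) * (rate p p0 H m m0 * (1 + Smu))) `^ q)%:E)%E.
Proof.
move=> p2 ind muE bF F0 p01 p0p H0 m01 [mEr mIA mIB mws] hB m16 msize hS q1 hA.
have pp : 0 < p by lra.
have p21 : 1 <= 2 * p by lra.
have p20 : 0 < 2 * p by lra.
have q0 : 0 < q by lra.
have m0p : 0 < m0%:R :> R by rewrite ltr0n.
have mp : 0 < m%:R :> R by lra.
have m1 : (0 < m)%N by rewrite -(ltr0n R).
have m0m : (m0 <= m)%N by rewrite -(ler_nat R); lra.
have Smu0 : 0 <= Smu.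
  by rewrite -lee_fin; apply: le_trans (hS _ F0); exact: poweR_ge0.
have IA0 w : (0 <= integrandA p p0 F (sample xi w))%E.
  rewrite /integrandA mule_ge0//.
    apply: le_trans (@sup_unif_ge_at _ _ _ p p0 F _ p0p (fun=> 0) (Ordinal m1) F0).
    by rewrite lee_fin powR_ge0.
  apply: (@le_trans _ _ (disc_norm (conj_p1 p p0) (fun=> 0) (sample xi w) `^ p0)%:E).
    by rewrite lee_fin powR_ge0.
  by apply: ereal_sup_ubound; exists (fun=> 0).
have unroot (x : \bar R) (a : R) : (0 <= x)%E -> 0 <= a -> (x `^ q^-1 <= a%:E)%E -> (x <= (a `^ q)%:E)%E.
  move=> x0 a0 xa; have := le_poweR (ltW q0) (poweR_ge0 x q^-1) xa.
  by rewrite -poweRrM mulVf ?gt_eqF// poweRe1// poweR_EFin.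
have Aq : (\int[P]_w (integrandA p p0 F (sample xi w) `^ q) <= ((H `^ (p0 / p)) `^ q)%:E)%E.
  apply: unroot hA; rewrite ?powR_ge0//.
  by apply: integral_ge0 => w _; exact: poweR_ge0.
(* By Jensen's inequality (A_q) implies (A_1), which is all that the chaining uses; the moment of
   order q itself enters only through the large entries. *)
have A1 : (\int[P]_w integrandA p p0 F (sample xi w) <= (H `^ (p0 / p))%:E)%E.
  have i0 : (0 <= \int[P]_w integrandA p p0 F (sample xi w))%E by exact: integral_ge0.
  have := le_trans (poweR_integral_le P q1 mIA IA0) Aq.
  rewrite -poweR_EFin => h.
  have qV : 0 <= q^-1 by rewrite invr_ge0 ltW.
  have := le_poweR qV (poweR_ge0 _ q) h.
  by rewrite -!poweRrM mulfV ?gt_eqF// !poweRe1// lee_fin powR_ge0.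
(* The chain starts at the last level with 2^n1 <= m0 and ends where 2^(n1 + k) is within a factor 2
   of [m]. *)
pose n1 := trunc_log 2 m0; pose k := (trunc_log 2 m - n1)%N.
have /andP[n1_le n1_lt] : (2 ^ n1 <= m0 < 2 ^ n1.+1)%N by exact: trunc_log_bounds.
have /andP[n2_le n2_lt] : (2 ^ trunc_log 2 m <= m < 2 ^ (trunc_log 2 m).+1)%N by exact: trunc_log_bounds.
have n12 : (n1 + k = trunc_log 2 m)%N by rewrite subnKC// leq_trunc_log.
have mge : (2 ^ (n1 + k) <= m)%N by rewrite n12.
have mle : (m <= 2 ^ (n1 + k).+1)%N by rewrite n12 ltnW.
set rt := rate p p0 H m m0.
have rt0 : 0 < rt by exact: rate_gt0.
have rt1 : rt <= 2 * (1 + p) by exact: rate_le.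
set lam := threshold m p p0 H.
have lam0 : 0 <= lam by rewrite /lam /threshold !mulr_ge0 ?powR_ge0.
have lam_le : lam <= 4 * (m%:R * rt) by exact: threshold_le.
pose Mk := mask (powers F p) lam.
have Mk0 : Mk !=set0.
  by apply: mask_nonempty; exists (fun y => cmod ((0 : R[i])) `^ p), (fun=> 0).
pose Sb w : \bar R := wsup Mk (fun=> 1) (xit xi w).
(* A crude bound, to ensure that the mean is finite; only then can the bootstrap inequality be
   solved for it. *)
have Sb_le w : (Sb w <= (m%:R * lam)%:E)%E.
  apply: wsup_le => h Mh; rewrite lee_fin; apply: le_trans (ler_norm_sum _ _ _) _.
  apply: (@le_trans _ _ (\sum_(j < m) lam)).
    by apply: ler_sum => j _; rewrite mul1r; exact: (mask_le _ lam0 Mh).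
  by rewrite sumr_const card_ord mulr_natl.
have Sb0 w : (0 <= Sb w)%E by exact: wsup_ge0.
have iSb : (\int[P]_w Sb w \is a fin_num)%E.
  rewrite ge0_fin_numE; last exact: integral_ge0.
  apply: (@le_lt_trans _ _ (\int[P]_w (m%:R * lam)%:E)%E); last by rewrite integral_prob_cst ltry.
  apply: ge0_le_integral => //; apply: measurableT_comp; last exact: measurable_xit.
  by apply: measurable_wsup_mask => // c; rewrite wsup_powers.
pose s := fine (\int[P]_w Sb w)%E / m%:R.
have sE : (\int[P]_w Sb w = (m%:R * s)%:E)%E.
  by rewrite /s mulrC divfK ?gt_eqF// fineK.
(* The factor 24 serves Markov's inequality with probability 1/24, and the maximum with 1 secures m
   <= m Lam, which the chaining requires. *)
pose Lam := 24 * Num.max 1 s.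
have Lam1 : 1 <= Lam by rewrite /Lam -[leLHS]mul1r ler_pM ?ler1n// le_max lexx.
have sLam : s <= 24^-1 * Lam.
  by rewrite /Lam mulrA mulVf ?mul1r ?gt_eqF ?ltr0n// le_max lexx orbT.
set c := chain_bound (m := m) p p0 H Lam m0 k.
have c_le : c <= 384 * p * chain_C p * (m%:R * rt * Lam `^ (1 - (2 * p)^-1)).
  by apply: (chain_bound_le p2 p01 H0 m01 m16 msize n1_lt mge).
have c0 : 0 <= c.
  rewrite /c /chain_bound mulr_ge0 ?powR_ge0// mulr_ge0 ?powR_ge0//.
  rewrite mulr_ge0 ?chain_C_ge0// /chain_radius mulr_ge0 ?powR_ge0//; exact: ler0n.
have SLam : (\int[P]_w Sb w <= (m%:R * (24^-1 * Lam))%:E)%E.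
  by rewrite sE lee_fin ler_pM2l.
have [e he] := sign_choice F0 p2 p01 p0p H0 m1 n1_le mle mIA mIB mws A1 hB Lam1 SLam (erefl c).
have ms_le := mask_bootstrap ind muE bF F0 p2 H0 m1 mws c0 he hS.
have er_le := error_moment ind muE bF F0 p2 p01 p0p H0 m1 mIA mws A1 c0 he q1 Aq mEr.
have b0 : 0 < Lam `^ (1 - (2 * p)^-1) by rewrite powR_gt0// (lt_le_trans ltr01).
have b1 : 1 <= Lam `^ (1 - (2 * p)^-1).
  by apply: powR_ge1 => //; rewrite subr_ge0 invf_le1.
have radius : 2 * c + lam <= radius_const p * (m%:R * rt * Lam `^ (1 - (2 * p)^-1)).
  exact: (radius_const_le b1 (mulr_gt0 mp rt0) c_le lam_le).
have rc0 := radius_const_gt0 p2.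
have pc0 : 0 < poisson_const 1 :> R by apply: lt_le_trans (poisson_const_ge1 (lexx 1)).
have boot : s <= Smu + 18 * poisson_const 1 * radius_const p * (2 * (1 + p)) * Lam `^ (1 - (2 * p)^-1).
  move: ms_le; rewrite -/lam -/Mk -/(Sb _) => ms_le.
  have : ((m%:R * s)%:E <= (m%:R * Smu + 18 * (poisson_const 1 * (2 * c + lam)))%:E)%E by rewrite -sE.
  rewrite lee_fin => h; rewrite -(ler_pM2l mp); apply: le_trans h _.
  rewrite [leRHS]mulrDr lerD2l.
  apply: (@le_trans _ _ (18 * (poisson_const 1 * (radius_const p * (m%:R * rt * Lam `^ (1 - (2 * p)^-1)))))).
    by rewrite ler_pM2l ?ltr0n// ler_pM2l.
  have -> : 18 * (poisson_const 1 * (radius_const p * (m%:R * rt * Lam `^ (1 - (2 * p)^-1)))) =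
    18 * poisson_const 1 * radius_const p * (m%:R * Lam `^ (1 - (2 * p)^-1)) * rt by ring.
  have -> : m%:R * (18 * poisson_const 1 * radius_const p * (2 * (1 + p)) * Lam `^ (1 - (2 * p)^-1)) =
    18 * poisson_const 1 * radius_const p * (m%:R * Lam `^ (1 - (2 * p)^-1)) * (2 * (1 + p)) by ring.
  apply: ler_wpM2l rt1; apply: mulr_ge0; last by rewrite mulr_ge0 ?ltW.
  by rewrite mulr_ge0 ?(ltW rc0)// mulr_ge0 ?(ltW pc0)// ler0n.
have C20 : 0 <= 18 * poisson_const 1 * radius_const p * (2 * (1 + p)).
  apply: mulr_ge0; last by apply: mulr_ge0 => //; rewrite addr_ge0// ltW.
  by apply: mulr_ge0; [apply: mulr_ge0; [|exact: ltW]|exact: ltW].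
have Lam_le := bootstrap_solve p2 C20 Smu0 (erefl Lam) boot.
apply: le_trans er_le _; rewrite lee_fin; apply: powR_le.
- exact: ltW.
- rewrite mulr_ge0 ?divr_ge0 ?ler0n// mulr_ge0//.
    by apply: le_trans (poisson_const_ge1 q1).
  by rewrite addr_ge0// mulr_ge0.
have LamB : Lam `^ (1 - (2 * p)^-1) <= bootstrap_const p * (1 + Smu).
  apply: le_trans Lam_le; rewrite -[leRHS]powRr1 ?(le_trans _ Lam1)// ler_powR//.
  by rewrite gerBl invr_ge0 ltW.
have qq0 : 0 <= q / (1 + ln q) by rewrite divr_ge0 ?(ltW q0)// addr_ge0// ln_ge0.
have radius2 : 2 * c + lam <= radius_const p * (m%:R * rt * (bootstrap_const p * (1 + Smu))).
  apply: le_trans radius _; rewrite ler_pM2l// ler_pM2l//; exact: mulr_gt0.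
apply: (@le_trans _ _ (216 / m%:R * (poisson_const q * (radius_const p * (m%:R * rt * (bootstrap_const p * (1 + Smu))))))).
  rewrite ler_wpM2l ?divr_ge0 ?ler0n// ler_wpM2l//.
  by apply: le_trans (poisson_const_ge1 q1).
rewrite le_eqVlt; apply/orP; left; apply/eqP.
rewrite /moment_const /poisson_const; move: (q / (1 + ln q)) => u; field.
by rewrite gt_eqF.
Qed.

Theorem theorem3p1 (R : realType) (p : R) (hp : 2 <= p) :
  exists2 C : R, 0 < C &
  forall (d d' : measure_display)
    (Omega : measurableType d) (mu : probability Omega R)
    (W : measurableType d') (P : probability W R)
    (m : nat) (xi : 'I_m -> {RV P >-> Omega})
    (F : set (Omega -> R[i])) (p0 H : R) (m0 : nat),
  independent_family xi ->
  (forall E : set Omega, measurable E ->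
     mu E = ((m%:R^-1)%:E * \sum_(j < m) P (xi j @^-1` E))%E) ->
  bounded_class F -> F (fun=> 0) ->
  1 < p0 <= p -> 0 < H -> (1 <= m0 <= m)%N ->
  random_variables xi mu p p0 F ->
  condB xi p p0 H m0 F ->
  Num.max (16 * m0%:R)
    (expR 1 * (expR 1 * ln (ln (m%:R / m0%:R))) `^ (p / holder_conj p0)
       * H * m0%:R) <= m%:R ->
  (forall q : R, 1 <= q -> condA xi p p0 H F q ->
     ((\int[P]_w (`|disc_error mu p F (sample xi w)|) `^ q) `^ q^-1
        <= (C * q / (1 + ln q))%:E * Theta mu p p0 H m m0 F)%E) /\
  ((forall q : R, 1 <= q -> condA xi p p0 H F q) ->
   forall t : R, expR 1 <= t ->
     (P [set w | C%:E * Theta mu p p0 H m m0 F * t%:E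
                   < disc_error mu p F (sample xi w)]
        <= (expR (- (t * ln t / expR 1)))%:E)%E).
Proof.
have e1 : 1 <= expR 1 :> R by apply: le_trans (expR_ge1Dx 1); lra.
have e0 : 0 < expR 1 :> R by exact: expR_gt0.
have [K K0 KE] : exists2 K : R, 0 < K & moment_const p = K.
  by exists (moment_const p) => //; exact: moment_const_gt0.
(* The additional factor e is what gives exp (- q) in Markov's inequality for the tail. *)
exists (expR 1 * K); first by rewrite mulr_gt0.
move=> d d' Omega mu W P m xi F p0 H m0 ind muE bF F0 /andP[p01 p0p] H0 /andP[m01 m0m].
move=> rv hB; rewrite ge_max => /andP[m16 msize].
have rt0 : 0 < rate p p0 H m m0 by exact: rate_gt0.
rewrite /Theta -/(rate p p0 H m m0); set rt := rate _ _ _ _ _ in rt0 *.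
set S := ereal_sup _.
have S0 : (0 <= S)%E.
  apply: (@le_trans _ _ (Lp_pow mu p (fun=> 0))); first exact: poweR_ge0.
  by apply: ereal_sup_ubound; exists (fun=> 0).
have fS f : F f -> (Lp_pow mu p f <= S)%E.
  by move=> Ff; apply: ereal_sup_ubound; exists f.
have [mEr _ _ _] := rv.
have C0 : 0 < expR 1 * K by rewrite mulr_gt0.
have qc (q : R) : 1 <= q -> 0 < q / (1 + ln q).
  by move=> q1; rewrite divr_gt0 ?(lt_le_trans ltr01 q1)// ltr_pwDl// ln_ge0.
(* If the norms are unbounded, Theta is infinite and both claims are trivial. *)
move: S0 fS; case: S => [Smu| |]// S0 fS; last first.
  rewrite addey// gt0_muley ?lte_fin//; split.
    move=> q q1 _; have h := qc q q1.
    by rewrite -mulrA gt0_muley ?leey// lte_fin mulr_gt0.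
  move=> _ t et; rewrite gt0_muley ?lte_fin// gt0_mulye ?lte_fin ?(lt_le_trans e0)//.
  rewrite [X in P X](_ : _ = set0) ?measure0 ?lee_fin ?expR_ge0//.
  by apply/seteqP; split => // w /=; rewrite ltNge leey.
have mb (q : R) : 1 <= q -> condA xi p p0 H F q ->
  (\int[P]_w ((`|disc_error mu p F (sample xi w)|) `^ q) <=
    ((K * (q / (1 + ln q)) * (rt * (1 + Smu))) `^ q)%:E)%E.
  move=> q1 hA; rewrite -KE.
  exact: (error_moment_rate hp ind muE bF F0 p01 p0p H0 m01 rv hB m16 msize fS q1 hA).
have T0 : 0 < rt * (1 + Smu) by rewrite mulr_gt0// ltr_pwDl.
split.
  move=> q q1 hA; have q0 : 0 < q by lra.
  have qV : 0 <= q^-1 by rewrite invr_ge0 ltW.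
  have i0 : (0 <= \int[P]_w ((`|disc_error mu p F (sample xi w)|) `^ q))%E.
    by apply: integral_ge0 => w _; exact: poweR_ge0.
  have := le_poweR qV i0 (mb q q1 hA).
  have u0 : 0 <= K * (q / (1 + ln q)) by rewrite mulr_ge0 ?(ltW (qc q q1)) ?(ltW K0).
  rewrite poweR_EFin powRK ?gt_eqF//; last by rewrite mulr_ge0 ?(ltW T0).
  move=> /le_trans; apply; rewrite -EFinD -!EFinM lee_fin ler_wpM2r ?(ltW T0)//.
  have -> : expR 1 * K * q / (1 + ln q) = expR 1 * (K * (q / (1 + ln q))) by rewrite !mulrA.
  by rewrite ler_peMl.
move=> hA t et; have t0 : 0 < t by apply: lt_le_trans et.
have lt1 : 1 <= ln t by rewrite -[leLHS](expRK 1) ler_ln ?posrE.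
set q := t * ln t; have q1 : 1 <= q.
  by rewrite /q -[leLHS]mul1r; apply: ler_pM => //; apply: le_trans et.
have q0 : 0 < q by lra.
(* Since 1 + ln q = 1 + ln t + ln (ln t) >= ln t, the choice q = t ln t makes the moment factor at
   most t. *)
have qt : q / (1 + ln q) <= t.
  have l0 : 0 < 1 + ln q by rewrite ltr_pwDl// ln_ge0.
  rewrite ler_pdivrMr// /q lnM ?posrE//; last by apply: lt_le_trans lt1.
  rewrite ler_wpM2l ?(ltW t0)//; have : 0 <= ln (ln t) by rewrite ln_ge0.
  lra.
rewrite -EFinD -!EFinM; set th := rt * (1 + Smu) in T0 *.
have mE : measurable [set w | ((expR 1 * K * th * t)%:E < disc_error mu p F (sample xi w))%E].
  by rewrite -[X in measurable X]setTI; exact: emeasurable_fun_o_infty.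
set E := [set w | _] in mE *.
set x := K * th * t; have x0 : 0 < x by apply: mulr_gt0 => //; exact: mulr_gt0.
have xE : expR 1 * K * th * t = expR 1 * x by rewrite /x; ring.
have h : (((expR 1 * x) `^ q)%:E * P E <= (x `^ q)%:E)%E.
  apply: (@le_trans _ _ (\int[P]_w ((`|disc_error mu p F (sample xi w)|) `^ q))%E).
    rewrite -[X in P X]setIT -integral_indic// -ge0_integralZl_EFin ?powR_ge0//; last first.
      by apply/measurable_EFinP; exact: measurable_indic.
    apply: ge0_le_integral => //.
    - by move=> w _; rewrite mule_ge0// lee_fin powR_ge0.
    - by apply: emeasurable_funM => //; apply/measurable_EFinP; exact: measurable_indic.
    - by apply: measurable_poweR_comp; exact: measurableT_comp.
    - move=> w _; rewrite indicE; case: (boolP (w \in E)) => [|_]; last by rewrite mule0 poweR_ge0.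
      rewrite inE /E/= xE mule1 => h; rewrite -poweR_EFin; apply: le_poweR; first exact: ltW.
        by rewrite lee_fin mulr_ge0 ?(ltW e0) ?(ltW x0).
      by apply: le_trans (ltW h) (lee_abs _).
  apply: le_trans (mb q q1 (hA q q1)) _; rewrite lee_fin; apply: powR_le; first exact: ltW.
    apply: mulr_ge0; last exact: ltW.
    by apply: mulr_ge0; apply: ltW => //; exact: qc.
  rewrite -/th; have -> : x = K * t * th by rewrite /x mulrAC.
  by apply: ler_wpM2r; [exact: ltW|rewrite ler_pM2l].
have fE := fineK (fin_num_measure P E mE); rewrite -fE in h *.
move: h; rewrite -EFinM !lee_fin powRM ?(ltW e0) ?(ltW x0)// -mulrA mulrCA.
rewrite ger_pMr ?powR_gt0// => h.
have eq : expR 1 `^ q = expR q by rewrite -expRM mul1r.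
apply: (@le_trans _ _ (expR (- q))).
  by rewrite expRN -[leRHS]div1r ler_pdivlMr ?expR_gt0// mulrC -eq.
rewrite ler_expR lerN2 ler_pdivrMr// ler_peMr//; exact: ltW.
Qed.
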